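(* Let $\varepsilon>0$ be a constant. There is an algorithm that, given a metric $k$-DOAT instance $\langle T, c\rangle$ with $k = o(\sqrt{\log n})$ in which $T$ has $n$ vertices and $\lambda = O\big(n^{1/(2k+2)^2}\big)$ leaves, computes in $O(n)$ time a set $S'$ of at most $k$ shortcuts with $\mathrm{diam}(T+S') \le (1+\varepsilon)\,\mathrm{diam}(T+S^* )$, where $S^*$ is an optimal solution. Specifically, for sufficiently large $n$ (below a constant threshold $n_0$ depending on $\varepsilon$ the instance is solved exactly), the algorithm is: let $B$ be the set of branch vertices of $T$ and $\eta = 2n^{1/(2k+2)}$; compute $x_1,\ldots,x_{\eta-|B|}$ by Gonzalez algorithm on $T$ with $h=\eta-|B|$; let $V' = B\cup\{x_1,\ldots,x_{\eta-|B|}\}$; build the tree $T'$ on $V'$ having an edge $(u,v)$ of cost $d_T(u,v)$ whenever the path in $T$ between $u$ and $v$ contains no vertex of $V'$ other than $u,v$; define shortcut costs $c'(u,v)=c(u,v)$ for all distinct $u,v\in V'$ (a shortcut may be added even between endpoints of an edge of $T'$); compute an optimal set $S'$ of $k$ shortcuts for the reduced instance $(T',c')$, i.e., one minimizing $\mathrm{diam}(T'+S')$; output $S'$.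
   Context: An instance of $k$-DOAT is a pair $\langle T, c\rangle$ where $T$ is a tree on $n$ vertices and $c$ assigns a non-negative cost $c(u,v)$ to every pair of distinct vertices (tree edges included); $c$ is accessed through an oracle returning $c(u,v)$ in constant time. For a set $S$ of shortcuts (pairs of distinct vertices), $T+S$ is $T$ plus the edges of $S$, each edge $(u,v)$ with cost $c(u,v)$; $d_G$ is the shortest-path distance and $\mathrm{diam}(G)=\max_{u,v}d_G(u,v)$. An optimal solution $S^*$ is a set of $k$ shortcuts minimizing $\mathrm{diam}(T+S^* )$. The instance is metric if $c(u,v)\le c(u,w)+c(w,v)$ for all distinct $u,v,w$. A branch vertex of $T$ is an internal vertex of degree at least $3$. Gonzalez algorithm on a graph $G$ with non-negative edge costs and integer $h$ picks an arbitrary vertex $x_1$ and, for $i<h$, picks $x_{i+1}\in\arg\max_{v\in V(G)}\min_{1\le j\le i}d_G(v,x_j)$. *)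

(* Defs.v *)
From HB Require Import structures.
From mathcomp Require Import all_boot all_order all_algebra.
From mathcomp Require Import all_classical all_reals all_analysis.

Set Implicit Arguments.
Unset Strict Implicit.
Unset Printing Implicit Defensive.

Import Order.TTheory GRing.Theory Num.Theory.
Import numFieldNormedType.Exports.

Local Open Scope ring_scope.

(** * Weighted multigraphs *)

(* [G u v] lists the costs of the parallel edges between [u] and [v]; parallel
   edges are needed because a shortcut of the reduced instance may join the
   endpoints of an edge of the reduced tree. *)
Definition wgraph (R : realType) (V : finType) : Type := V -> V -> seq R.

Inductive walk (R : realType) (V : finType) (G : wgraph R V) :
    V -> V -> R -> Prop :=
| walk_nil u : walk G u u 0
| walk_cons u v w x l : x \in G u v -> walk G v w l -> walk G u w (x + l).

(* All costs are non-negative and all the graphs considered are connected, so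
   this infimum is a minimum over a nonempty set. *)
Definition dist (R : realType) (V : finType) (G : wgraph R V) (u v : V) : R :=
  inf [set l | walk G u v l]%classic.

(* The diameter of a graph whose vertex set is [A]. *)
Definition diam (R : realType) (V : finType) (A : {set V}) (G : wgraph R V) : R :=
  \big[Num.max/0]_(u in A) \big[Num.max/0]_(v in A) dist G u v.

(** * Instances of k-DOAT *)

Definition is_tree (V : finType) (e : rel V) : Prop :=
  [/\ (0 < #|V|)%N, symmetric e, irreflexive e,
      forall u v, connect e u v
    & forall p : seq V, ucycle e p -> (size p < 3)%N].

Definition degree (V : finType) (e : rel V) (u : V) : nat := #|[set v | e u v]|.

Definition leaves (V : finType) (e : rel V) : {set V} :=
  [set u | degree e u == 1%N].

Definition branch_vertices (V : finType) (e : rel V) : {set V} :=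
  [set u | (3 <= degree e u)%N].

(* The values [c u u] are never used. *)
Definition doat_instance (R : realType) (V : finType) (e : rel V)
    (c : V -> V -> R) : Prop :=
  [/\ is_tree e, forall u v, c u v = c v u
    & forall u v, u != v -> 0 <= c u v].

Definition metric (R : realType) (V : finType) (c : V -> V -> R) : Prop :=
  forall u v w, u != v -> u != w -> v != w -> c u v <= c u w + c w v.

Definition tree_graph (R : realType) (V : finType) (e : rel V)
    (c : V -> V -> R) : wgraph R V :=
  fun u v => nseq (e u v) (c u v).

(* A shortcut is an unordered pair of distinct vertices, i.e., a 2-element set. *)
Definition shortcuts (V : finType) (A : {set V}) : {set {set V}} :=
  [set p : {set V} | (p \subset A) && (#|p| == 2%N)].

Definition add_shortcuts (R : realType) (V : finType) (c : V -> V -> R)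
    (G : wgraph R V) (S : {set {set V}}) : wgraph R V :=
  fun u v => G u v ++ nseq ([set u; v] \in S) (c u v).

(* "At most k" rather than "exactly k": adding a shortcut never increases the
   diameter, so the optimal value is the same, and [A] may have fewer than [k]
   pairs (in the reduced instance the centers need not be distinct). *)
Definition optimal_shortcuts (R : realType) (V : finType) (A : {set V})
    (G : wgraph R V) (c : V -> V -> R) (k : nat) (S : {set {set V}}) : Prop :=
  [/\ S \subset shortcuts A, (#|S| <= k)%N
    & forall S' : {set {set V}}, S' \subset shortcuts A -> (#|S'| <= k)%N ->
        diam A (add_shortcuts c G S) <= diam A (add_shortcuts c G S')].

(** * The reduction *)

(* [x 0, ..., x h.-1] is a possible outcome of Gonzalez' algorithm. *)
Definition gonzalez (R : realType) (V : finType) (G : wgraph R V) (h : nat)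
    (x : nat -> V) : Prop :=
  let mindist i v :=
    \big[Num.min/dist G v (x 0%N)]_(j < i) dist G v (x j) in
  forall i, (0 < i < h)%N -> forall v, mindist i v <= mindist i (x i).

Definition eta (R : realType) (n k : nat) : nat :=
  Num.truncn (2 * n%:R `^ ((2 * k + 2)%N%:R^-1) : R).

(* The simple path of [e] from [u] to [v] meets [A] at most in [u] and [v]. *)
Definition consecutive (V : finType) (e : rel V) (A : {set V}) (u v : V) : Prop :=
  exists p : seq V,
    [/\ path e u p, last u p = v, uniq (u :: p)
      & forall w, w \in p -> w \in A -> w = v].

(* The reduced tree: its vertex set is [A]. *)
Definition reduced_tree (R : realType) (V : finType) (e : rel V)
    (c : V -> V -> R) (A : {set V}) : wgraph R V :=
  fun u v => nseq [&& u \in A, v \in A, u != v & `[< consecutive e A u v >]]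
                  (dist (tree_graph e c) u v).

(* [S] is a possible output of the reduction-based algorithm. *)
Definition reduction_output (R : realType) (n : nat) (e : rel 'I_n)
    (c : 'I_n -> 'I_n -> R) (k : nat) (S : {set {set 'I_n}}) : Prop :=
  let B := branch_vertices e in
  let h := (eta R n k - #|B|)%N in
  (#|B| < eta R n k)%N /\
  exists2 x : nat -> 'I_n, gonzalez (tree_graph e c) h x
    & let A := B :|: [set x i | i : 'I_h] in
      optimal_shortcuts A (reduced_tree e c A) c k S.

(** * The machine model: a word RAM with real registers and a cost oracle *)

(* The memory consists of arrays, named by natural numbers: arrays of machine
   words and arrays of real numbers.  A program is a finite piece of syntax, so
   it only uses finitely many of them.  Real numbers can only be added,
   subtracted and compared. *)
Record state (R : realType) := State {
  iarr : nat -> nat -> nat;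
  rarr : nat -> nat -> R }.

Inductive iexp : Type :=
| IConst of nat
| IGet of nat & iexp
| IAdd of iexp & iexp
| ISub of iexp & iexp
| IMul of iexp & iexp
| IDiv of iexp & iexp.

Inductive rexp : Type :=
| RZero
| RGet of nat & iexp
| RCost of iexp & iexp
| RAdd of rexp & rexp
| RSub of rexp & rexp.

Inductive bexp : Type :=
| BEqI of iexp & iexp
| BLeI of iexp & iexp
| BLeR of rexp & rexp
| BNot of bexp
| BAnd of bexp & bexp.

Inductive cmd : Type :=
| Skip
| SetI of nat & iexp & iexp  (* [SetI a i e]: word array [a], index [i] *)
| SetR of nat & iexp & rexp
| Seq of cmd & cmd
| If of bexp & cmd & cmd
| While of bexp & cmd.

Fixpoint ieval (R : realType) (s : state R) (e : iexp) : nat :=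
  match e with
  | IConst m => m
  | IGet a i => iarr s a (ieval s i)
  | IAdd e1 e2 => ieval s e1 + ieval s e2
  | ISub e1 e2 => ieval s e1 - ieval s e2
  | IMul e1 e2 => ieval s e1 * ieval s e2
  | IDiv e1 e2 => ieval s e1 %/ ieval s e2
  end%N.

Fixpoint reval (R : realType) (oracle : nat -> nat -> R) (s : state R)
    (r : rexp) : R :=
  match r with
  | RZero => 0
  | RGet a i => rarr s a (ieval s i)
  | RCost i j => oracle (ieval s i) (ieval s j)
  | RAdd r1 r2 => reval oracle s r1 + reval oracle s r2
  | RSub r1 r2 => reval oracle s r1 - reval oracle s r2
  end.

Fixpoint beval (R : realType) (oracle : nat -> nat -> R) (s : state R)
    (b : bexp) : bool :=
  match b with
  | BEqI e1 e2 => ieval s e1 == ieval s e2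
  | BLeI e1 e2 => (ieval s e1 <= ieval s e2)%N
  | BLeR r1 r2 => reval oracle s r1 <= reval oracle s r2
  | BNot b1 => ~~ beval oracle s b1
  | BAnd b1 b2 => beval oracle s b1 && beval oracle s b2
  end.

Definition update (T : Type) (m : nat -> nat -> T) (a i : nat) (x : T) :
    nat -> nat -> T :=
  fun b j => if (b == a) && (j == i) then x else m b j.

(* [exec W oracle p s t s']: started in [s], the program [p] halts in [s'] after
   [t] steps, a step being an assignment or the evaluation of a test.
   Expressions have bounded size, so charging them a unit cost only affects the
   constant factors.  Only words smaller than [W] can be stored: a program
   trying to store a larger one is stuck. *)
Inductive exec (R : realType) (W : nat) (oracle : nat -> nat -> R) :
    cmd -> state R -> nat -> state R -> Prop :=
| exec_Skip s : exec W oracle Skip s 0 s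
| exec_SetI s a i e : (ieval s e < W)%N ->
    exec W oracle (SetI a i e) s 1
      (State (update (iarr s) a (ieval s i) (ieval s e)) (rarr s))
| exec_SetR s a i r :
    exec W oracle (SetR a i r) s 1
      (State (iarr s) (update (rarr s) a (ieval s i) (reval oracle s r)))
| exec_Seq p q s1 s2 s3 t1 t2 :
    exec W oracle p s1 t1 s2 -> exec W oracle q s2 t2 s3 ->
    exec W oracle (Seq p q) s1 (t1 + t2)%N s3
| exec_If b p q s1 s2 t :
    exec W oracle (if beval oracle s1 b then p else q) s1 t s2 ->
    exec W oracle (If b p q) s1 t.+1 s2
| exec_WhileF b p s : ~~ beval oracle s b -> exec W oracle (While b p) s 1 s
| exec_WhileT b p s1 s2 s3 t1 t2 : beval oracle s1 b ->
    exec W oracle p s1 t1 s2 -> exec W oracle (While b p) s2 t2 s3 ->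
    exec W oracle (While b p) s1 (t1 + t2).+1 s3.

Definition cost_oracle (R : realType) (n : nat) (c : 'I_n -> 'I_n -> R)
    (i j : nat) : R :=
  if (insub i, insub j) is (Some u, Some v) then
    if u != v then c u v else 0
  else 0.

(* [es] lists the edges of [e], each once and in an arbitrary orientation. *)
Definition edge_list (n : nat) (e : rel 'I_n) (es : seq ('I_n * 'I_n)) : Prop :=
  size es = n.-1 /\
  forall u v, e u v = ((u, v) \in es) || ((v, u) \in es).

(* Input: word array 0 holds [n] and [k]; word arrays 1 and 2 hold the first and
   second endpoints of the tree edges; everything else is zero. *)
Definition input_state (R : realType) (n k : nat) (es : seq ('I_n * 'I_n)) :
    state R :=
  State (fun a i => match a with
           | 0 => nth 0 [:: n; k] i
           | 1 => nth 0 [seq nat_of_ord p.1 | p <- es] i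
           | 2 => nth 0 [seq nat_of_ord p.2 | p <- es] i
           | _ => 0
           end)%N
        (fun _ _ => 0).

(* Output: word array 3 holds the number of pairs at index 0; word arrays 4 and
   5 hold their first and second endpoints. *)
Definition output_shortcuts (R : realType) (n : nat) (s : state R)
    (S : {set {set 'I_n}}) : Prop :=
  exists es : seq ('I_n * 'I_n),
    [/\ iarr s 3 0 = size es,
        forall i, (i < size es)%N ->
          iarr s 4 i = nth 0%N [seq nat_of_ord p.1 | p <- es] i /\
          iarr s 5 i = nth 0%N [seq nat_of_ord p.2 | p <- es] i
      & S = [set p | p \in [seq [set q.1; q.2] | q <- es]]].

(* Main.v *)
(* Let [D] be the optimal diameter and [r] the largest distance of a vertex from
   the [h] centers.  The centers and a farthest vertex are [h + 1] vertices
   pairwise at distance at least [r].  The leaves, the branch vertices and the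
   ends of the optimal shortcuts cut the tree into O(lambda + k) paths, and a
   vertex of such a path is within [D] of one of its ends, since it must leave
   the path through them: hence h + 1 = O((lambda + k) (D / r + 1)).  Moving the
   ends of the optimal shortcuts one at a time to their nearest centers costs at
   most 4 r 2^k by the triangle inequality, which is at most [eps * D] because
   [h] exceeds any constant multiple of lambda 4^k.

   For the running time, the vertices are ordered by peeling off leaves, which
   places the vertices of each chain of degree-2 vertices consecutively.  On a
   chain, the distance to the centers is the minimum of an increasing and of a
   decreasing function of the depth; so it is determined by its values at
   O(lambda + h) marked vertices, and the farthest vertex of each chain is found
   by binary search.  Each of the C(eta^2 + k, k) candidate sets of the reduced
   instance is evaluated in O(k eta^2) steps, and the product is O(n) because
   eta^(2k+2) <= 4^(k+1) n and 16^k = O(k!). *)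

Require Import Defs.
From HB Require Import structures.
From mathcomp Require Import all_boot all_order all_algebra.
From mathcomp Require Import all_classical all_reals all_analysis.
From mathcomp Require Import zify ring lra.

Set Implicit Arguments.
Unset Strict Implicit.
Unset Printing Implicit Defensive.

Import Order.TTheory GRing.Theory Num.Theory.
Import numFieldNormedType.Exports.

Local Open Scope ring_scope.

(** * Distances *)

(** Lower bounds on distances rarely come from analysing a path. They come from exhibiting a
    function that varies along each edge by at most the cost of that edge, and [lipschitz_dist] does
    the rest. Adding a shortcut, reducing the instance, packing and the correctness of the computed
    labels are all treated in this way, so simple paths of the tree hardly appear. The factor
    [2 ^ k] comes from a doubling of the error: a route through a moved shortcut has two parts that
    both carry the error made so far, hence an error [E] becomes [2 * E + 4 * r]. Centers may
    coincide with each other or with branch vertices. Marks may therefore be repeated and a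
    candidate shortcut may join a vertex to itself; the constructions are arranged so that this is
    harmless. For [k >= 1] one has [eta ^ 4 <= 16 * n], which pays for the centers and for the
    distance matrix even with [log n] replaced by the crude bound [(2 * k + 2) * eta]. For [k = 0]
    this fails, and the program stops at once. *)

Lemma ge_min_l (R : realType) (x y : R) : Num.min x y <= x.
Proof. by rewrite ge_min lexx. Qed.

Lemma ge_min_r (R : realType) (x y : R) : Num.min x y <= y.
Proof. by rewrite ge_min lexx orbT. Qed.

Section Distance.
Context {R : realType} {V : finType}.
Implicit Types (G : wgraph R V) (u v w : V) (f : V -> R).

Definition nonneg_graph G := forall u v x, x \in G u v -> 0 <= x.
Definition sym_graph G := forall u v x, x \in G u v -> x \in G v u.
Definition conn_graph G := forall u v, exists l, walk G u v l.

Lemma walk_cat G u v w l1 l2 :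
  walk G u v l1 -> walk G v w l2 -> walk G u w (l1 + l2).
Proof.
elim=> [x|x y z a l xa _ IH] h2; first by rewrite add0r.
by rewrite -addrA; apply: walk_cons xa (IH h2).
Qed.

Lemma walk_edge G u v x : x \in G u v -> walk G u v x.
Proof. by move=> xG; rewrite -[x]addr0; apply: walk_cons xG (walk_nil _ _). Qed.

Lemma walk_sym G u v l : sym_graph G -> walk G u v l -> walk G v u l.
Proof.
move=> sG; elim=> [x|x y z a l' xa _ IH]; first exact: walk_nil.
by rewrite addrC; apply: walk_cat IH (walk_edge (sG _ _ _ xa)).
Qed.

Lemma lipschitz_walk G f u v l :
  (forall u v x, x \in G u v -> f u <= f v + x) ->
  walk G u v l -> f u <= f v + l.
Proof.
move=> fL; elim=> [x|x y z a l' xa _ IH]; first by rewrite addr0.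
by have := fL _ _ _ xa; lra.
Qed.

Lemma walk_ge0 G u v l : nonneg_graph G -> walk G u v l -> 0 <= l.
Proof.
move=> nG w; have := @lipschitz_walk G (fun=> 0) u v l _ w.
by rewrite add0r; apply=> a b x /nG; rewrite add0r.
Qed.

Lemma dist_le_walk G u v l : nonneg_graph G -> walk G u v l -> dist G u v <= l.
Proof.
move=> nG w; apply: ge_inf; last exact: w.
by exists 0 => x /= /(walk_ge0 nG).
Qed.

Lemma dist_ge G u v m : (exists l, walk G u v l) ->
  (forall l, walk G u v l -> m <= l) -> m <= dist G u v.
Proof. by move=> [l w] h; apply: lb_le_inf => [|x /= /h //]; exists l. Qed.

(** The main tool for lower bounds on distances: a potential [f] replaces the study of shortest
    paths. *)
Lemma lipschitz_dist G f u v : (exists l, walk G u v l) ->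
  (forall u v x, x \in G u v -> f u <= f v + x) -> f u - f v <= dist G u v.
Proof.
move=> wl fL; apply: dist_ge => // l /(lipschitz_walk fL).
by rewrite lerBlDl.
Qed.

Lemma dist_ge0 G u v : nonneg_graph G -> 0 <= dist G u v.
Proof.
move=> nG; rewrite /dist.
case: (pselect (exists l, walk G u v l)) => [wl|nwl].
  by apply: (dist_ge wl) => l /(walk_ge0 nG).
by rewrite (_ : mkset _ = set0) ?inf0 //; apply/seteqP; split=> // l wl; case: nwl; exists l.
Qed.

Lemma distxx G u : nonneg_graph G -> dist G u u = 0.
Proof.
move=> nG; apply/le_anti; rewrite dist_ge0 // andbT.
exact: dist_le_walk (walk_nil _ _).
Qed.

Lemma dist_edge G u v x : nonneg_graph G -> x \in G u v -> dist G u v <= x.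
Proof. by move=> nG xG; apply: dist_le_walk (walk_edge xG). Qed.

Lemma dist_triangle G u v w : nonneg_graph G ->
  (exists l, walk G u v l) -> (exists l, walk G v w l) ->
  dist G u w <= dist G u v + dist G v w.
Proof.
move=> nG uv vw; rewrite -lerBlDr; apply: dist_ge => // l1 w1.
rewrite lerBlDr -lerBlDl; apply: dist_ge => // l2 w2.
by rewrite lerBlDl; apply: dist_le_walk (walk_cat w1 w2).
Qed.

Lemma dist_sym G u v : sym_graph G -> dist G u v = dist G v u.
Proof.
by move=> sG; congr inf; apply/seteqP; split=> l /=; apply: walk_sym.
Qed.

End Distance.

(** * Adding a shortcut to a graph *)

Section Shortcuts.
Context {R : realType} {V : finType} {c : V -> V -> R}.
Hypothesis c_sym : forall u v, c u v = c v u.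
Hypothesis c_ge0 : forall u v, u != v -> 0 <= c u v.
Implicit Types (G : wgraph R V) (u v w : V) (S : {set {set V}}).

Lemma mem_add_shortcuts G S u v x :
  (x \in add_shortcuts c G S u v) =
  (x \in G u v) || ([set u; v] \in S) && (x == c u v).
Proof. by rewrite /add_shortcuts mem_cat mem_nseq; case: (_ \in S). Qed.

(** A singleton in [S] would create loops of cost [c u u], about which nothing is assumed. *)
Definition proper_pairs S := forall u, [set u; u] \notin S.

Lemma shortcuts_proper (A : {set V}) S : S \subset shortcuts A -> proper_pairs S.
Proof.
move=> /fintype.subsetP sS u; apply/negP => /sS.
by rewrite inE => /andP[_]; rewrite finset.setUid cards1.
Qed.

Lemma nonneg_add_shortcuts G S :
  nonneg_graph G -> proper_pairs S -> nonneg_graph (add_shortcuts c G S).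
Proof.
move=> nG pS u v x; rewrite mem_add_shortcuts => /orP[/nG //|/andP[uvS /eqP->]].
by apply: c_ge0; apply: contraNneq (pS u) => uv; rewrite {2}uv.
Qed.

Lemma sym_add_shortcuts G S : sym_graph G -> sym_graph (add_shortcuts c G S).
Proof.
move=> sG u v x; rewrite !mem_add_shortcuts => /orP[/sG->//|].
by rewrite c_sym finset.setUC => ->; rewrite orbT.
Qed.

Lemma walk_mono G1 G2 u v l : (forall u v x, x \in G1 u v -> x \in G2 u v) ->
  walk G1 u v l -> walk G2 u v l.
Proof.
move=> s12; elim=> [x|x y z a l' xa _ IH]; first exact: walk_nil.
exact: walk_cons (s12 _ _ _ xa) IH.
Qed.

Lemma conn_add_shortcuts G S : conn_graph G -> conn_graph (add_shortcuts c G S).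
Proof.
move=> cG u v; have [l w] := cG u v; exists l; apply: walk_mono w => a b x xG.
by rewrite mem_add_shortcuts xG.
Qed.

(** A shortest path uses the new edge at most once, in one of its two directions. For the lower
    bound, the right-hand side as a function of [u] is a potential [f] on the new graph with
    [f v <= 0]; crossing the new edge in [f] is paid by the term that already contains [c a b]. *)
Lemma dist_add_shortcut G S a b u v :
  nonneg_graph G -> sym_graph G -> conn_graph G -> proper_pairs S -> a != b ->
  dist (add_shortcuts c G ([set a; b] |: S)) u v =
  let d := dist (add_shortcuts c G S) in
  Num.min (d u v) (Num.min (d u a + c a b + d b v) (d u b + c a b + d a v)).
Proof.
move=> nG sG cG pS ab /=; set G1 := add_shortcuts c G S.
set G2 := add_shortcuts c G _; set d := dist G1.
have n1 : nonneg_graph G1 by exact: nonneg_add_shortcuts.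
have p2 : proper_pairs ([set a; b] |: S).
  move=> x; rewrite !inE negb_or pS andbT; apply/eqP => /setP E.
  have := E a; have := E b; rewrite !inE !eqxx /= orbT !orbb.
  by move=> /eqP bx /eqP ax; rewrite ax bx eqxx in ab.
have n2 : nonneg_graph G2 by exact: nonneg_add_shortcuts.
have s1 : sym_graph G1 by exact: sym_add_shortcuts.
have s2 : sym_graph G2 by exact: sym_add_shortcuts.
have c1 : conn_graph G1 by exact: conn_add_shortcuts.
have c2 : conn_graph G2 by exact: conn_add_shortcuts.
have s12 x y z : z \in G1 x y -> z \in G2 x y.
  rewrite !mem_add_shortcuts !inE => /orP[->//|/andP[-> ->]].
  by rewrite !orbT.
have d21 x y : dist G2 x y <= d x y.
  apply: dist_ge => // l w; apply: dist_le_walk => //.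
  by apply: walk_mono w.
have abG2 : c a b \in G2 a b by rewrite mem_add_shortcuts !inE eqxx eqxx orbT.
have t1 x y z : d x z <= d x y + d y z by apply: dist_triangle.
have t2 x y z : dist G2 x z <= dist G2 x y + dist G2 y z by apply: dist_triangle.
have cab : 0 <= c a b by apply: c_ge0.
apply/le_anti/andP; split.
  rewrite !le_min d21 /=.
  have e1 := dist_edge n2 abG2; have e2 := dist_edge n2 (s2 _ _ _ abG2).
  apply/andP; split.
    have := t2 u a v; have := t2 a b v.
    by have := d21 u a; have := d21 b v; lra.
  have := t2 u b v; have := t2 b a v.
  by have := d21 u b; have := d21 a v; lra.
pose f x := Num.min (d x v) (Num.min (d x a + c a b + d b v) (d x b + c a b + d a v)).
have fv : f v <= 0.
  by rewrite /f; apply: (le_trans (ge_min_l _ _)); rewrite /d distxx.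
have dge x y : 0 <= d x y by apply: dist_ge0.
have dxx x : d x x = 0 by exact: distxx.
suff fL x y z : z \in G2 x y -> f x <= f y + z.
  have := lipschitz_dist (c2 u v) fL.
  by rewrite -/(f u); lra.
rewrite mem_add_shortcuts !inE => H.
have [xyz|/negP xyz] := boolP (z \in G1 x y).
  have dxy : d x y <= z by exact: dist_edge.
  rewrite /f -lerBlDr !le_min !lerBlDr; apply/and3P; split.
  - rewrite (le_trans (ge_min_l _ _)) //.
    by have := t1 x y v; lra.
  - rewrite (le_trans (ge_min_r _ _)) // (le_trans (ge_min_l _ _)) //.
    by have := t1 x y a; lra.
  - rewrite (le_trans (ge_min_r _ _)) // (le_trans (ge_min_r _ _)) //.
    by have := t1 x y b; lra.
have [/eqP xyab /eqP ->] : [set x; y] == [set a; b] /\ z == c x y.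
  move: H xyz; rewrite mem_add_shortcuts.
  by case: (z \in G x y) => //=; case: eqP => //= _; case: (_ \in S) => //= /[swap] /eqP->; rewrite eqxx.
have : (x = a /\ y = b) \/ (x = b /\ y = a).
  move: xyab => /setP E; have := E a; have := E b; have := E x; have := E y.
  rewrite !inE !eqxx ?orbT /=.
  move=> /esym/orP[]/eqP-> /esym/orP[]/eqP->; rewrite ?eqxx ?orbb ?[b == a]eq_sym ?(negbTE ab) //=; [by right | by left].
case=> -[-> ->].
  rewrite /f -lerBlDr !le_min !lerBlDr; apply/and3P; split.
  - rewrite (le_trans (ge_min_r _ _)) // (le_trans (ge_min_l _ _)) //.
    by rewrite dxx; lra.
  - rewrite (le_trans (ge_min_r _ _)) // (le_trans (ge_min_l _ _)) //.
    by rewrite dxx; have := dge b a; lra.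
  - rewrite (le_trans (ge_min_l _ _)) //.
    by rewrite dxx; lra.
rewrite (c_sym b a) /f -lerBlDr !le_min !lerBlDr; apply/and3P; split.
- rewrite (le_trans (ge_min_r _ _)) // (le_trans (ge_min_r _ _)) //.
  by rewrite dxx; lra.
- rewrite (le_trans (ge_min_l _ _)) //.
  by rewrite dxx; lra.
- rewrite (le_trans (ge_min_r _ _)) // (le_trans (ge_min_r _ _)) //.
  by rewrite dxx; have := dge a b; lra.
Qed.

End Shortcuts.

Section Diameter.
Context {R : realType} {V : finType} {A : {set V}} {G : wgraph R V}.

Lemma diam_ge0 : 0 <= diam A G.
Proof. exact: bigmax_ge_id. Qed.

Lemma dist_le_diam u v : u \in A -> v \in A -> dist G u v <= diam A G.
Proof.
move=> uA vA; apply: le_trans (le_bigmax_cond _ _ uA).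
exact: (le_bigmax_cond _ (fun v => dist G u v) vA).
Qed.

Lemma diam_le x : 0 <= x ->
  (forall u v, u \in A -> v \in A -> dist G u v <= x) -> diam A G <= x.
Proof. by move=> x0 h; apply: bigmax_le => // u uA; apply: bigmax_le => // v; apply: h. Qed.

End Diameter.

(** * Distances in an instance *)

Section Instance.
Context {R : realType} {V : finType} {e : rel V} {c : V -> V -> R}.
Hypothesis inst : doat_instance e c.
Local Notation T := (tree_graph e c).

Lemma inst_sym u v : c u v = c v u.
Proof. by case: inst. Qed.

Lemma inst_ge0 u v : u != v -> 0 <= c u v.
Proof. by case: inst => _ _; apply. Qed.

Lemma tree_sym : symmetric e.
Proof. by case: inst => -[]. Qed.

Lemma tree_irr : irreflexive e.
Proof. by case: inst => -[]. Qed.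

Lemma tree_connect u v : connect e u v.
Proof. by case: inst => -[]. Qed.

Lemma mem_tree_graph u v x : (x \in T u v) = e u v && (x == c u v).
Proof. by rewrite /tree_graph mem_nseq; case: (e u v). Qed.

Lemma tree_graph_edge u v : e u v -> c u v \in T u v.
Proof. by move=> uv; rewrite mem_tree_graph uv eqxx. Qed.

Lemma nonneg_tree_graph : nonneg_graph T.
Proof.
move=> u v x; rewrite mem_tree_graph => /andP[uv /eqP->].
by apply: inst_ge0; apply: contraTneq uv => ->; rewrite tree_irr.
Qed.

Lemma sym_tree_graph : sym_graph T.
Proof. by move=> u v x; rewrite !mem_tree_graph inst_sym tree_sym. Qed.

Lemma conn_tree_graph : conn_graph T.
Proof.
move=> u v; have /connectP[p + ->] := tree_connect u v.
elim: p u => [|w p IH] u /=; first by exists 0; apply: walk_nil.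
move=> /andP[uw /IH[l wl]]; exists (c u w + l).
by apply: walk_cons wl; apply: tree_graph_edge.
Qed.

Lemma tree_dist_ge0 u v : 0 <= dist T u v.
Proof. exact/dist_ge0/nonneg_tree_graph. Qed.

Lemma tree_distxx u : dist T u u = 0.
Proof. exact/distxx/nonneg_tree_graph. Qed.

Lemma tree_dist_sym u v : dist T u v = dist T v u.
Proof. exact/dist_sym/sym_tree_graph. Qed.

Lemma tree_dist_triangle u v w : dist T u w <= dist T u v + dist T v w.
Proof.
by apply: dist_triangle; [exact: nonneg_tree_graph | exact: conn_tree_graph..].
Qed.

Lemma tree_dist_edge u v : e u v -> dist T u v <= c u v.
Proof. by move=> uv; apply: dist_edge; [exact: nonneg_tree_graph | exact: tree_graph_edge]. Qed.

Section AddShortcuts.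
Context {S : {set {set V}}}.
Hypothesis pS : proper_pairs S.
Local Notation TS := (add_shortcuts c T S).

Lemma nonneg_TS : nonneg_graph TS.
Proof. by apply: nonneg_add_shortcuts; [exact: inst_ge0|exact: nonneg_tree_graph|]. Qed.

Lemma sym_TS : sym_graph TS.
Proof. by apply: sym_add_shortcuts; [exact: inst_sym | exact: sym_tree_graph]. Qed.

Lemma conn_TS : conn_graph TS.
Proof. exact/conn_add_shortcuts/conn_tree_graph. Qed.

Lemma TS_triangle u v w : dist TS u w <= dist TS u v + dist TS v w.
Proof. by apply: dist_triangle; [exact: nonneg_TS | exact: conn_TS..]. Qed.

Lemma TS_sym u v : dist TS u v = dist TS v u.
Proof. exact/dist_sym/sym_TS. Qed.

Lemma TS_le_T u v : dist TS u v <= dist T u v.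
Proof.
apply: dist_ge => [|l w]; first exact: conn_tree_graph.
apply: dist_le_walk; first exact: nonneg_TS.
by apply: walk_mono w => a b x xG; rewrite mem_add_shortcuts xG.
Qed.

End AddShortcuts.

Lemma TS_add S a b u v : proper_pairs S -> a != b ->
  let d := dist (add_shortcuts c T S) in
  dist (add_shortcuts c T ([set a; b] |: S)) u v =
  Num.min (d u v) (Num.min (d u a + c a b + d b v) (d u b + c a b + d a v)).
Proof.
move=> pS ab; apply: dist_add_shortcut => //.
- exact: inst_sym.
- exact: inst_ge0.
- exact: nonneg_tree_graph.
- exact: sym_tree_graph.
- exact: conn_tree_graph.
Qed.

Lemma TS0 u v : dist (add_shortcuts c T finset.set0) u v = dist T u v.
Proof.
congr inf; apply/seteqP; split=> l /=; apply: walk_mono => a b x.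
  by rewrite mem_add_shortcuts finset.in_set0 orbF.
by rewrite mem_add_shortcuts => ->.
Qed.

(** * Distances in the reduced instance *)

Section Reduction.
Context {A : {set V}} {S : {set {set V}}}.
Hypothesis SA : S \subset shortcuts A.
Let T' := reduced_tree e c A.

(* Cut a walk of [T + S] at its visits of [A]: each piece costs at least the
   distance in [T] between its ends. *)
Lemma reduced_walk u v l : walk (add_shortcuts c T S) u v l -> v \in A ->
  forall a p, a \in A -> path e a p -> last a p = u -> (forall w, w \in p -> w \notin A) ->
  exists2 l', walk (add_shortcuts c T' S) a v l' & l' <= dist T a u + l.
Proof.
elim=> {u v l} [u|u w v x l xuw _ IH] vA a p aA ep lp pA.
  case/lastP: p ep lp pA => [_ /= <- _|p z _].
    by exists 0; [exact: walk_nil | rewrite tree_distxx addr0].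
  rewrite last_rcons => -> /(_ u); rewrite mem_rcons inE eqxx => /(_ isT).
  by rewrite vA.
move: xuw; rewrite mem_add_shortcuts mem_tree_graph => /orP[/andP[uw /eqP xE]|/andP[uwS /eqP xE]].
  have epw : path e a (rcons p w) by rewrite rcons_path ep lp.
  have daw : dist T a w <= dist T a u + x.
    by rewrite xE (le_trans (tree_dist_triangle a u w)) // lerD2l tree_dist_edge.
  have [wA|wA] := boolP (w \in A); last first.
    have [|l' wl' l'le] := IH vA a (rcons p w) aA epw (last_rcons _ _ _).
      by move=> z; rewrite mem_rcons inE => /predU1P[->//|/pA].
    by exists l' => //; lra.
  have [l' wl' l'le] := IH vA w [::] wA isT erefl (fun z => ltac:(by [])).
  rewrite tree_distxx add0r in l'le.
  have [aw|aw] := eqVneq a w.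
    by exists l'; [rewrite aw | have := tree_dist_ge0 a w; lra].
  exists (dist T a w + l'); last lra.
  apply: walk_cons wl'; rewrite mem_add_shortcuts /T' /reduced_tree mem_nseq aA wA aw /= eqxx.
  rewrite andbT lt0n eqb0 negbK; apply/orP; left; apply/asboolP.
  case/shortenP: epw (last_rcons a p w) => p' ep' up' sp' lp'.
  exists p'; split=> // z /sp'; rewrite mem_rcons inE => /predU1P[//|/pA/negP //].
have [uA wA] : u \in A /\ w \in A.
  have := fintype.subsetP SA _ uwS; rewrite inE => /andP[/fintype.subsetP sA _].
  by split; apply: sA; rewrite !inE eqxx ?orbT.
have [l' wl' l'le] := IH vA w [::] wA isT erefl (fun z => ltac:(by [])).
rewrite tree_distxx add0r in l'le.
(* The ends of a shortcut lie in [A], so the walk is at a visit of [A] and the current tree piece is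
   empty. *)
have au : a = u.
  case/lastP: p ep lp pA => [_ /= <- //|p z _].
  rewrite last_rcons => -> /(_ u); rewrite mem_rcons inE eqxx => /(_ isT).
  by rewrite uA.
exists (x + l'); last by rewrite au tree_distxx add0r lerD2l.
by apply: walk_cons wl'; rewrite mem_add_shortcuts au uwS xE eqxx orbT.
Qed.

Lemma nonneg_reduced : nonneg_graph (add_shortcuts c T' S).
Proof.
apply: nonneg_add_shortcuts; [exact: inst_ge0 | |exact: shortcuts_proper SA].
move=> u v x; rewrite /T' /reduced_tree mem_nseq => /andP[_ /eqP->].
exact: tree_dist_ge0.
Qed.

(** Walks of [T + S] are shortcut into the reduced graph by [reduced_walk]. Conversely no edge of
    the reduced graph is cheaper than the distance in [T + S] between its ends, so the latter is a
    potential. *)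
Lemma reduced_dist u v : u \in A -> v \in A ->
  dist (add_shortcuts c T' S) u v = dist (add_shortcuts c T S) u v.
Proof.
move=> uA vA; have pS := shortcuts_proper SA.
have red l : walk (add_shortcuts c T S) u v l ->
    exists2 l', walk (add_shortcuts c T' S) u v l' & l' <= l.
  move=> w; have [l' ? ?] := reduced_walk w vA uA (isT : path e u [::]) erefl (fun z => ltac:(by [])).
  by exists l'; rewrite // -[l]add0r -(tree_distxx u).
have [l0 w0] := conn_TS (S := S) u v.
apply/le_anti/andP; split.
  apply: dist_ge; first by exists l0.
  move=> l /red[l' w' l'l]; apply: le_trans l'l; apply: dist_le_walk w'.
  exact: nonneg_reduced.
rewrite -[leLHS]subr0 -(distxx v (nonneg_TS pS)).
apply: (lipschitz_dist (f := dist (add_shortcuts c T S) ^~ v)).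
  by have [l' ? _] := red _ w0; exists l'.
move=> x y z; rewrite mem_add_shortcuts => H.
have h : dist (add_shortcuts c T S) x y <= z.
  case/orP: H => [|/andP[xyS /eqP->]].
    rewrite /T' /reduced_tree mem_nseq => /andP[_ /eqP->].
    exact: TS_le_T.
  apply: dist_edge; first exact: nonneg_TS.
  by rewrite mem_add_shortcuts xyS eqxx orbT.
by have := TS_triangle pS x y v; lra.
Qed.

Lemma reduced_diam :
  diam A (add_shortcuts c T' S) = diam A (add_shortcuts c T S).
Proof.
by apply: eq_bigr => u uA; apply: eq_bigr => v vA; apply: reduced_dist.
Qed.

End Reduction.

(** * Moving the optimal shortcuts to the centers *)

Section Snap.
Hypothesis mc : metric c.
Context (A : {set V}) (r : R) (f : V -> V).
Hypotheses (fA : forall v, f v \in A) (fr : forall v, dist T v (f v) <= r).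

(** Extended by 0 on the diagonal, a metric cost satisfies the triangle inequality without
    distinctness conditions, so [c0^~ v] is a potential on the tree. *)
Lemma cost_le_dist u v : u != v -> c u v <= dist T u v.
Proof.
move=> uv; pose c0 x y := if x == y then 0 else c x y.
have c00 : c0 v v = 0 by rewrite /c0 eqxx.
have -> : c u v = c0 u v - c0 v v by rewrite c00 subr0 /c0 (negbTE uv).
apply: (lipschitz_dist (f := c0^~ v)); first exact: conn_tree_graph.
move=> x y z; rewrite mem_tree_graph => /andP[exy /eqP->].
have xy : x != y by apply: contraTneq exy => ->; rewrite tree_irr.
rewrite /c0; case: eqVneq => [_|xv]; case: eqVneq => [yv|yv].
- by rewrite add0r inst_ge0.
- by rewrite addr_ge0 // inst_ge0.
- by rewrite -yv add0r.
- by rewrite addrC mc // eq_sym.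
Qed.

Lemma snap_cost a b : a != b -> f a != f b -> c (f a) (f b) <= c a b + 2 * r.
Proof.
move=> ab fab; pose c0 x y := if x == y then 0 else c x y.
have c0tri x y z : c0 x z <= c0 x y + c0 y z.
  rewrite /c0; case: eqVneq => [->|xz].
    by case: eqVneq => yz; rewrite ?addr0 // addr_ge0 ?inst_ge0 // eq_sym.
  case: eqVneq => [<-|xy]; first by rewrite (negbTE xz) add0r.
  case: eqVneq => [<-|yz]; first by rewrite addr0.
  by apply: mc => //; rewrite eq_sym.
have c0d x y : c0 x y <= dist T x y.
  rewrite /c0; case: eqVneq => [->|xy]; first by rewrite tree_distxx.
  exact: cost_le_dist.
have -> : c (f a) (f b) = c0 (f a) (f b) by rewrite /c0 (negbTE fab).
have -> : c a b = c0 a b by rewrite /c0 (negbTE ab).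
have := c0tri (f a) a (f b); have := c0tri a b (f b).
have := c0d (f a) a; have := c0d b (f b); rewrite (tree_dist_sym (f a)).
by have := fr a; have := fr b; lra.
Qed.

(** Induction on the number of shortcuts. By [dist_add_shortcut] a distance with one more shortcut
    is the sum of its cost and of two earlier distances, so the error [E] doubles; walking from [a]
    and [b] to their centers adds [2 * r], and the cost of the moved shortcut another [2 * r]. The
    recurrence [2 * E + 4 * r] starting from 0 has the solution [4 * r] times [2 ^ m - 1] after [m]
    shortcuts. *)
Lemma snap_shortcuts (S : {set {set V}}) : S \subset shortcuts [set: V] ->
  exists S' : {set {set V}}, [/\ S' \subset shortcuts A, (#|S'| <= #|S|)%N
    & forall u v, dist (add_shortcuts c T S') u v
        <= dist (add_shortcuts c T S) u v + 4 * r * (2 ^+ #|S| - 1)].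
Proof.
have [m] := ubnP #|S|; elim: m S => // m IH S cS sS.
have [S0|/finset.set0Pn[p pS]] := eqVneq S finset.set0.
  rewrite S0; exists finset.set0; rewrite finset.sub0set leqnn; split=> // u v.
  by rewrite cards0 expr0 subrr mulr0 addr0.
have := fintype.subsetP sS _ pS; rewrite inE => /andP[_ /cards2P[a [b [ab pE]]]].
have cSD : #|S| = (#|S :\ p|).+1 by rewrite (cardsD1 p S) pS.
have sSD : S :\ p \subset shortcuts [set: V] by rewrite (fintype.subset_trans _ sS) // subD1set.
have [|S1 [S1A cS1 dS1]] := IH (S :\ p) _ sSD; first by rewrite -cSD -ltnS.
have pS1 := shortcuts_proper S1A; have pSD := shortcuts_proper sSD.
have r0 : 0 <= r by apply: le_trans (fr a); apply: tree_dist_ge0.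
have dS u v := TS_add u v pSD ab; rewrite -pE finset.setD1K // /= in dS.
have [P P1 PE] : exists2 P : R, 1 <= P & 2 ^+ #|S :\ p| = P.
  by exists (2 ^+ #|S :\ p|); rewrite // exprn_ege1 // ler1n.
have -> : 2 ^+ #|S| = 2 * P by rewrite cSD exprS PE.
rewrite {}PE in dS1; pose E : R := 4 * r * (P - 1).
have E0 : 0 <= E by rewrite mulr_ge0 ?mulr_ge0 // subr_ge0.
have EE : 4 * r * (2 * P - 1) = 2 * E + 4 * r by rewrite /E; lra.
pose d1 := dist (add_shortcuts c T S1); pose d0 := dist (add_shortcuts c T (S :\ p)).
have t1 x y z : d1 x z <= d1 x y + d1 y z by apply: TS_triangle.
have d10 x y : d1 x y <= d0 x y + E by apply: dS1.
have d1f x : d1 x (f x) <= r by apply: le_trans (fr x); apply: TS_le_T.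
have d1s x y : d1 x y = d1 y x by apply: TS_sym.
(* If both ends move to the same center, no shortcut is added: [a] and [b] are then within [2 * r]
   of each other. *)
have [fab|fab] := eqVneq (f a) (f b).
  exists S1; split; [by []|by rewrite cSD ltnW|].
  move=> u v; rewrite dS EE -/d0 -/d1 -lerBlDr !le_min !lerBlDr.
  have cab := inst_ge0 ab.
  have := t1 (f b) b v; have := d1f a; have := d1f b; rewrite (d1s b).
  have := t1 a (f b) v; have := t1 b (f b) v; have := d10 u v.
  have := t1 a (f a) b; rewrite fab.
  have := t1 u a v; have := d10 u a; have := d10 b v.
  have := t1 u b v; have := d10 u b; have := d10 a v.
  have := t1 a b v; have := t1 b a v; rewrite (d1s b a) (d1s b (f b)).
  by move=> *; apply/and3P; split; lra.
exists ([set f a; f b] |: S1); split.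
- apply/fintype.subsetP => q; rewrite !inE => /predU1P[->|/(fintype.subsetP S1A)]; last by rewrite inE.
  by rewrite cards2 fab andbT finset.subUset !finset.sub1set !fA.
- by rewrite cardsU1 cSD (leq_add (leq_b1 _)).
move=> u v; rewrite dS EE TS_add // -/d0 -/d1 -lerBlDr !le_min !lerBlDr.
have cf := snap_cost ab fab.
apply/and3P; split.
- by apply: le_trans (ge_min_l _ _) _; have := d10 u v; lra.
- apply: le_trans (ge_min_r _ _) _; apply: le_trans (ge_min_l _ _) _.
  have := t1 u a (f a); have := t1 (f b) b v; rewrite (d1s (f b) b).
  by have := d1f a; have := d1f b; have := d10 u a; have := d10 b v; lra.
- apply: le_trans (ge_min_r _ _) _; apply: le_trans (ge_min_r _ _) _.
  have := t1 u b (f b); have := t1 (f a) a v; rewrite (d1s (f a) a).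
  by have := d1f a; have := d1f b; have := d10 u b; have := d10 a v; lra.
Qed.

(** The moved optimal shortcuts compete with [S'] on [A]. Passing from pairs in [A] to all pairs
    costs [2 * r] more, which is covered by the [- 1] in [snap_shortcuts]. *)
Lemma reduction_diam k (S' Sopt : {set {set V}}) :
  optimal_shortcuts A (reduced_tree e c A) c k S' ->
  Sopt \subset shortcuts [set: V] -> (#|Sopt| <= k)%N ->
  diam [set: V] (add_shortcuts c T S')
    <= diam [set: V] (add_shortcuts c T Sopt) + 4 * 2 ^+ k * r.
Proof.
move=> [S'A cS' optS'] sS cS.
have [S1 [S1A cS1 dS1]] := snap_shortcuts sS.
have := optS' _ S1A (leq_trans cS1 cS); rewrite !reduced_diam // => opt.
have pS' := shortcuts_proper S'A.
have r0 : 0 <= r.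
  case: (inst) => -[/card_gt0P[v _] _ _ _ _] _ _.
  exact: le_trans (tree_dist_ge0 _ _) (fr v).
have D0 := @diam_ge0 R V [set: V] (add_shortcuts c T Sopt).
have kS : 2 ^+ #|Sopt| <= 2 ^+ k :> R by rewrite ler_weXn2l // ler1n.
have [P P1 PE] : exists2 P : R, 1 <= P & 2 ^+ k = P.
  by exists (2 ^+ k); rewrite // exprn_ege1 // ler1n.
rewrite {}PE in kS *.
have rk : 0 <= r * (P - 1) by rewrite mulr_ge0 // subr_ge0.
have dA : diam A (add_shortcuts c T S1) <= diam [set: V] (add_shortcuts c T Sopt) + 4 * r * (P - 1).
  apply: diam_le => [|u v _ _]; first by clear kS dS1; lra.
  apply: le_trans (dS1 u v) _; apply: lerD; first by apply: dist_le_diam; rewrite inE.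
  by rewrite ler_wpM2l ?mulr_ge0 // lerD2r.
clear kS; apply: diam_le => [|u v _ _]; first by lra.
have := TS_triangle pS' u (f u) v; have := TS_triangle pS' (f u) (f v) v.
have := le_trans (TS_le_T pS' u (f u)) (fr u).
have := le_trans (TS_le_T pS' v (f v)) (fr v); rewrite (TS_sym v).
have := dist_le_diam (G := add_shortcuts c T S') (fA u) (fA v).
by lra.
Qed.

End Snap.

End Instance.

(** * Edge lists of a tree *)

Section SpanningEdges.
Context {V : finType} {e : rel V}.
Hypothesis te : is_tree e.

(** [pr v] is a neighbour of [v] that is reached from [r] by fewer edges, so that iterating [pr]
    ends at [r]. *)
Lemma bfs_parents (r : V) : exists pr : V -> V,
  (forall v, v != r -> e v (pr v)) /\
  (forall v, connect [rel x y | (x != r) && (pr x == y)] v r).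
Proof.
case: te => _ _ _ cn _.
have ex v : exists m, `[< exists p, [/\ path e v p, last v p = r & size p = m] >].
  by have /connectP[p ep lp] := cn v r; exists (size p); apply/asboolP; exists p.
pose D v := ex_minn (ex v).
have Dmin v p : path e v p -> last v p = r -> (D v <= size p)%N.
  by move=> ep lp; rewrite /D; case: ex_minnP => m _; apply; apply/asboolP; exists p.
have step v : v != r -> exists w, e v w && (D w < D v)%N.
  move=> vr; have : `[< exists p, [/\ path e v p, last v p = r & size p = D v] >].
    by rewrite /D; case: ex_minnP.
  move=> /asboolP[[|w p] [/= + + <-]]; first by move=> _ vE; rewrite vE eqxx in vr.
  by move=> /andP[vw ep] lp; exists w; rewrite vw ltnS Dmin.
pose pr v := odflt r [pick w | e v w && (D w < D v)%N].
have prP v : v != r -> e v (pr v) && (D (pr v) < D v)%N.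
  move=> /step[w vw]; rewrite /pr; case: pickP => [//|/(_ w)].
  by rewrite vw.
exists pr; split=> [v /prP/andP[]//|v].
have [m] := ubnP (D v); elim: m v => // m IH v Dv.
have [->|vr] := eqVneq v r; first exact: connect0.
have /andP[vp Dp] := prP _ vr.
apply: connect_trans (IH (pr v) (leq_trans Dp Dv)).
by apply: connect1; rewrite /= vr eqxx.
Qed.

(* A tree edge outside the BFS tree would close a cycle. *)
Lemma bfs_edges (r : V) (pr : V -> V) :
  (forall v, v != r -> e v (pr v)) ->
  (forall v, connect [rel x y | (x != r) && (pr x == y)] v r) ->
  forall x y, e x y -> (x != r) && (pr x == y) || (y != r) && (pr y == x).
Proof.
case: te => _ sy ir _ cyc epr cpr x y exy.
set up := [rel x y | (x != r) && (pr x == y)] in cpr.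
pose tr := [rel x y | up x y || up y x].
have tr_sym : symmetric tr by move=> a b; rewrite /= orbC.
have tr_e : subrel tr e.
  move=> a b /= /orP[] /andP[/epr + /eqP<- //].
  by rewrite sy.
have up_tr a b : connect up a b -> connect tr a b.
  by apply: connect_sub => u v uv; apply: connect1; apply/orP; left.
have xy : connect tr x y.
  apply: connect_trans (up_tr _ _ (cpr x)) _.
  by rewrite (sym_connect_sym tr_sym); apply: up_tr (cpr y).
have [//|ntr] := boolP (tr x y).
have /connectP[p0 ep0 lp0] := xy; case/shortenP: ep0 lp0 => p ep up_ _ lp.
have := cyc (x :: p); rewrite /ucycle /= rcons_path (sub_path tr_e) // -lp sy exy => /(_ up_).
case: p ep up_ lp => [|z [|w p]] //=.
  by move=> _ _ yx; rewrite yx ir in exy.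
by rewrite andbT => xz _ yz; move: ntr; rewrite yz /= xz.
Qed.

End SpanningEdges.

(** The approximation bound is stated without an edge list, whereas a tree order is obtained by
    running [prepare] on one. *)
Lemma tree_edge_list n (e : rel 'I_n) : is_tree e -> exists es, edge_list e es.
Proof.
move=> te; have [/card_gt0P[r _] sy _ _ _] := te.
have [pr [epr cpr]] := bfs_parents te r.
exists [seq (v, pr v) | v <- enum [set v | v != r]]; split.
  by rewrite size_map -cardE cardsE cardC1 card_ord.
move=> u v.
have mem_es a b : ((a, b) \in [seq (v, pr v) | v <- enum [set v | v != r]]) = (a != r) && (pr a == b).
  apply/mapP/andP => [[x]|[ar /eqP<-]]; last by exists a; rewrite ?mem_enum ?inE.
  by rewrite mem_enum inE => xr [-> ->].
rewrite !mem_es; apply/idP/idP; first exact: bfs_edges.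
by move=> /orP[] /andP[/epr + /eqP<-] //; rewrite sy.
Qed.

(** * Orders of a tree that follow its chains *)

(* [vx i] is the vertex at position [i], [ps] its inverse and [pa i] the
   position of the parent; the root has position 0.  The last field says that
   the order follows a path downwards until it reaches a leaf. *)
Record tree_order n (e : rel 'I_n) (vx : nat -> 'I_n) (ps : 'I_n -> nat)
    (pa : nat -> nat) : Prop := TreeOrder {
  to_ps : forall v, (ps v < n)%N;
  to_vxK : forall v, vx (ps v) = v;
  to_psK : forall i, (i < n)%N -> ps (vx i) = i;
  to_pa : forall i, (0 < i < n)%N -> (pa i < i)%N /\ e (vx i) (vx (pa i));
  to_edge : forall i j, (i < n)%N -> (j < n)%N -> e (vx i) (vx j) ->
    (0 < i)%N && (pa i == j) || (0 < j)%N && (pa j == i);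
  to_break : forall i, (0 < i < n)%N -> i.+1 = n \/ pa i.+1 <> i ->
    degree e (vx i) = 1%N }.

Section TreeOrder.
Context {n : nat} {e : rel 'I_n} {vx : nat -> 'I_n} {ps : 'I_n -> nat} {pa : nat -> nat}.
Hypothesis to : tree_order e vx ps pa.
Hypothesis e_sym : symmetric e.

(** The order runs straight through such a position. A vertex of degree 2 whose parent is not at the
    preceding position begins a new run and does not count as [inner]. *)
Definition inner i := [&& 0 < i, pa i == i.-1 & degree e (vx i) == 2]%N.

Lemma card_positions (P : pred 'I_n) : #|[set v | P v]| = (\sum_(i < n) P (vx i))%N.
Proof.
rewrite -sum1dep_card big_mkcond /= (reindex (fun i : 'I_n => vx i)) /=.
  by apply: eq_bigr => i _; case: (P _).
exists (fun v => Ordinal (to_ps to v)) => [i _|v _] /=; last exact: (to_vxK to).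
by apply: val_inj => /=; rewrite (to_psK to).
Qed.

Lemma edgeE i j : (i < n)%N -> (j < n)%N ->
  e (vx i) (vx j) = ((0 < i)%N && (pa i == j)) || ((0 < j)%N && (pa j == i)).
Proof.
move=> ilt jlt; apply/idP/idP; first exact: (to_edge to).
case/orP=> /andP[i0 /eqP<-].
  by have [] := to_pa to (i := i); rewrite ?i0.
by rewrite e_sym; have [] := to_pa to (i := j); rewrite ?i0.
Qed.

Definition children i : nat := (\sum_(j < n) ((0 < j) && (pa j == i)))%N.

Lemma degreeE i : (i < n)%N -> degree e (vx i) = ((0 < i) + children i)%N.
Proof.
move=> ilt; rewrite /degree card_positions /children.
have -> : ((0 < i) = \sum_(j < n) ((0 < i) && (pa i == j)) :> nat)%N.
  case: ltnP => i0 /=; last by rewrite big1.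
  have [pi _] := to_pa to (i := i) ltac:(by rewrite i0).
  rewrite (bigD1 (Ordinal (ltn_trans pi ilt))) //= eqxx big1 // => j.
  by rewrite -val_eqE /= eq_sym => /negbTE->.
rewrite -big_split /=; apply: eq_bigr => j _; rewrite edgeE //.
case: ltnP => //= i0; case: eqVneq => //= pij.
case: ltnP => //= j0; case: eqVneq => //= pji.
have [] := to_pa to (i := i) ltac:(by rewrite i0).
have [] := to_pa to (i := j) ltac:(by rewrite j0 ltn_ord).
by rewrite pij pji => /ltnW; rewrite leqNgt => /negP.
Qed.

Lemma children_sum : (0 < n)%N -> (\sum_(i < n) children i = n.-1)%N.
Proof.
move=> n0; rewrite exchange_big /= (eq_bigr (fun j : 'I_n => (0 < j)%N : nat)).
  have -> : (n.-1 = \sum_(1 <= i < n) 1)%N by rewrite sum_nat_const_nat muln1 subn1.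
  rewrite -(big_mkord xpredT (fun j => (0 < j)%N : nat)) big_ltn // add0n.
  by rewrite !big_nat; apply: eq_bigr => i /andP[->].
move=> j _; case: ltnP => j0 /=; last by rewrite big1.
have [pj _] := to_pa to (i := j) ltac:(by rewrite j0 ltn_ord).
rewrite (bigD1 (Ordinal (ltn_trans pj (ltn_ord j)))) //= eqxx big1 // => i.
by rewrite -val_eqE /= eq_sym => /negbTE->.
Qed.

Lemma degree_gt0 i : (0 < i < n)%N -> (0 < degree e (vx i))%N.
Proof. by case/andP=> i0 ilt; rewrite degreeE // i0. Qed.

(** At every vertex, [2 + [deg >= 3] <= deg + [deg = 1]], and the degrees sum to [2 * n.-1]. The
    pointwise bound fails only for degree 0, that is, for a single vertex. *)
Lemma branch_le_leaves : (#|branch_vertices e| <= #|leaves e|)%N.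
Proof.
rewrite !card_positions.
have [n1|n1] := leqP n 1.
  have deg0 (i : 'I_n) : degree e (vx i) = 0%N.
    rewrite degreeE //; have i0 : (i = 0 :> nat)%N by have := ltn_ord i; lia.
    rewrite i0 /= add0n /children big1 // => j _.
    by have := ltn_ord j; case: (nat_of_ord j) => // m; lia.
  by rewrite big1 // => i _; rewrite deg0.
have n0 := ltnW n1.
have : (\sum_(i < n) degree e (vx i) <= 2 * n.-1)%N.
  rewrite (eq_bigr (fun i : 'I_n => ((0 < i) + children i)%N)); last first.
    by move=> i _; rewrite degreeE.
  rewrite big_split /= children_sum // mul2n -addnn leq_add2r.
  rewrite -(big_mkord xpredT (fun j => (0 < j)%N : nat)) big_ltn // add0n.
  rewrite (leq_trans (n := \sum_(1 <= i < n) 1)%N) //; last by rewrite sum_nat_const_nat muln1 subn1.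
  by apply: leq_sum => i _; apply: leq_b1.
have deg_gt0 (i : 'I_n) : (0 < degree e (vx i))%N.
  case: (posnP i) => i0; last by rewrite degree_gt0 // i0 ltn_ord.
  rewrite i0 degreeE //= add0n /children (bigD1 (Ordinal n1)) //=.
  have [] := to_pa to (i := 1) ltac:(by rewrite n1).
  by case: (pa 1).
have : (\sum_(i < n) (2 + (3 <= degree e (vx i))) <= \sum_(i < n) (degree e (vx i) + (degree e (vx i) == 1)))%N.
  by apply: leq_sum => i _; have := deg_gt0 i; case: (degree _ _) => [|[|[|m]]].
by rewrite !big_split /= sum_nat_const card_ord; lia.
Qed.

(** By [to_break] the order can only be interrupted after a leaf, and an [inner] vertex has degree
    2. *)
Lemma inner_next i : (i < n)%N -> inner i -> (i.+1 < n)%N /\ pa i.+1 = i.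
Proof.
move=> ilt /and3P[i0 _ d2].
have br := to_break to (i := i) ltac:(by rewrite i0).
have [il|il] := ltnP i.+1 n; last first.
  have : i.+1 = n by lia.
  by move=> E; rewrite br in d2 => //; left.
split=> //; apply/eqP; apply: contraLR d2 => /eqP pn.
by rewrite br //; right.
Qed.

Lemma inner_child i j : (i < n)%N -> inner i -> (0 < j < n)%N -> pa j = i -> j = i.+1.
Proof.
move=> ilt ini /andP[j0 jlt] pji; have [il pi] := inner_next ilt ini.
have /and3P[i0 _ ] := ini; rewrite degreeE // i0 add1n eqSS.
apply: contraTeq => ji; rewrite /children (bigD1 (Ordinal jlt)) //= j0 pji eqxx.
rewrite (bigD1 (Ordinal il)) /= ?pi ?eqxx //.
by rewrite -val_eqE /= eq_sym.
Qed.

Lemma not_inner_last : (0 < n)%N -> ~~ inner n.-1.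
Proof. by move=> n0; apply/negP => /inner_next; rewrite prednK // ltnn => -[]. Qed.

(** Consequently a tree edge between positions that are not consecutive joins two positions that are
    not [inner]. *)
Lemma not_inner_parent i : (0 < i < n)%N -> pa i != i.-1 -> ~~ inner (pa i).
Proof.
move=> ib pi; have [plt _] := to_pa to ib.
apply: contra pi => ini; have /andP[_ ilt] := ib.
by have := inner_child (ltn_trans plt ilt) ini ib erefl; lia.
Qed.

(** A position fails to be [inner] if it is the root, if the order was interrupted just before it,
    if it is a leaf or if it is a branch vertex. An interruption is charged to the leaf that
    precedes it, and branch vertices are at most as many as leaves. *)
Lemma card_not_inner : (\sum_(i < n) ~~ inner i <= 1 + 3 * #|leaves e|)%N.
Proof.
pose lf i := degree e (vx i) == 1%N.
have bnd i : (i < n)%N -> (~~ inner i <= (i == 0) + ((1 < i) && lf i.-1) + lf i + (3 <= degree e (vx i)))%N.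
  move=> ilt; rewrite /inner /lf; case: (posnP i) => [->//|i0 /=].
  have dg := degree_gt0 (i := i) ltac:(by rewrite i0).
  case: eqP => [_|pi] /=; last first.
    have [plt _] := to_pa to (i := i) ltac:(by rewrite i0).
    have i1 : (1 < i)%N by case: (i) i0 pi plt => [|[|m]] // _; case: (pa 1).
    rewrite i1 (to_break to (i := i.-1)) ?eqxx //; first by lia.
    by right; rewrite prednK.
  by case: (degree _ _) dg => [|[|[|m]]] // _; rewrite ?orbT; lia.
apply: (@leq_trans (\sum_(i < n) ((i == 0 :> nat) + ((1 < i) && lf i.-1) + lf i + (3 <= degree e (vx i))))%N).
  by apply: leq_sum => i _; apply: bnd.
have lfE : (\sum_(i < n) lf i)%N = #|leaves e| by rewrite card_positions.
have brE : (\sum_(i < n) (3 <= degree e (vx i)))%N = #|branch_vertices e| by rewrite card_positions.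
rewrite !big_split /= lfE brE.
have := branch_le_leaves.
have : (\sum_(i < n) (i == 0 :> nat) <= 1)%N.
  rewrite -(big_mkord xpredT (fun j => (j == 0)%N : nat)); case: (n) => [|m]; first by rewrite big_geq.
  by rewrite big_ltn // big_nat big1 // => -[].
have : (\sum_(i < n) ((1 < i) && lf i.-1) <= #|leaves e|)%N.
  rewrite -lfE -(big_mkord xpredT (fun j => lf j : nat)) -(big_mkord xpredT (fun j => ((1 < j) && lf j.-1)%N : nat)).
  case: (n) => [|m]; first by rewrite !big_geq.
  rewrite big_ltn // add0n big_add1 /= big_nat_recr //= .
  by apply: leq_trans (leq_addr _ _); apply: leq_sum => i _; case: (1 < i.+1)%N.
have arith a b l br : (b <= l -> a <= 1 -> br <= l -> a + b + l + br <= 1 + 3 * l)%N by lia.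
exact: arith.
Qed.

End TreeOrder.

(** * Depth, marks and packing *)

Section Depth.
Context {R : realType} {n : nat} {e : rel 'I_n} {c : 'I_n -> 'I_n -> R}.
Context {vx : nat -> 'I_n} {ps : 'I_n -> nat} {pa : nat -> nat} {dp : nat -> R}.
Hypothesis inst : doat_instance e c.
Hypothesis to : tree_order e vx ps pa.
Local Notation T := (tree_graph e c).
Local Notation d i j := (dist T (vx i) (vx j)).
Local Notation inner := (inner (e := e) (vx := vx) (pa := pa)).

Definition is_depth := dp 0%N = 0 /\
  forall i, (0 < i < n)%N -> dp i = dp (pa i) + c (vx i) (vx (pa i)).

Hypothesis hdp : is_depth.

Lemma dist_parent i : (0 < i < n)%N -> d i (pa i) <= dp i - dp (pa i).
Proof.
move=> ib; have [_ eip] := to_pa to ib; rewrite hdp.2 // addrAC subrr add0r.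
exact: tree_dist_edge.
Qed.

Lemma depth_parent i : (0 < i < n)%N -> dp (pa i) <= dp i.
Proof. by move=> /dist_parent h; rewrite -subr_ge0 (le_trans _ h) // tree_dist_ge0. Qed.

Lemma dist_root i : (i < n)%N -> d i 0 <= dp i.
Proof.
have [m] := ubnP i; elim: m i => // m IH [_ _|i im ilt]; first by rewrite tree_distxx // hdp.1.
have ib : (0 < i.+1 < n)%N by [].
have [plt _] := to_pa to ib; have dpar := dist_parent ib.
have h := IH (pa i.+1) (leq_trans plt im) (ltn_trans plt ilt).
by have := tree_dist_triangle inst (vx i.+1) (vx (pa i.+1)) (vx 0); lra.
Qed.

(** Each tree edge joins a position to its parent and costs their difference in depth, so potentials
    need only be checked between positions and their parents. *)
Lemma position_lipschitz (f : nat -> R) u v x :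
  (forall i, (0 < i < n)%N -> `|f i - f (pa i)| <= dp i - dp (pa i)) ->
  x \in T u v -> f (ps u) <= f (ps v) + x.
Proof.
move=> fL; rewrite mem_tree_graph => /andP[euv /eqP->].
rewrite -{2}(to_vxK to u) -{2}(to_vxK to v).
rewrite -(to_vxK to u) -(to_vxK to v) in euv.
case/orP: (to_edge to (to_ps to u) (to_ps to v) euv) => /andP[i0 /eqP pE].
  have ib : (0 < ps u < n)%N by rewrite i0 (to_ps to).
  by have := fL _ ib; rewrite pE hdp.2 // pE ler_norml => /andP[_]; lra.
have ib : (0 < ps v < n)%N by rewrite i0 (to_ps to).
have := fL _ ib; rewrite pE hdp.2 // pE (inst_sym inst (vx (ps v))) ler_norml.
by move=> /andP[+ _]; lra.
Qed.

Definition chain p q := forall i, (p <= i < q)%N -> pa i.+1 = i.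

(** When no position lies strictly between [p] and [q], the [inner] positions say nothing about the
    edge from [p] to [q]; hence the last hypothesis. *)
Lemma inner_chain p q : (p < q < n)%N -> (forall i, (p < i < q)%N -> inner i) ->
  (p.+1 < q)%N \/ pa q = p -> chain p q.
Proof.
move=> /andP[pq qn] inn h i /andP[]; rewrite leq_eqVlt => /predU1P[<- _|pi iq].
  have [pq1|] := ltnP p.+1 q.
    by have /and3P[_ /eqP-> _] := inn p.+1 ltac:(by rewrite ltnSn).
  by case: h => [|h]; [lia | move=> ?; have -> : p.+1 = q by lia].
by have [] := inner_next to (ltn_trans iq qn) (inn i ltac:(by rewrite pi)).
Qed.

Lemma chain_depth p q i j : (q < n)%N -> chain p q -> (p <= i)%N -> (i <= j)%N -> (j <= q)%N ->
  dp i <= dp j /\ d j i <= dp j - dp i.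
Proof.
move=> qn ch pi; elim: j => [|j IH] ij jq.
  by have -> : i = 0%N by [case: (i) ij]; rewrite subrr tree_distxx.
move: ij; rewrite leq_eqVlt => /predU1P[->|ij]; first by rewrite subrr tree_distxx.
have [dij dd] := IH ij (ltnW jq).
have pj : pa j.+1 = j by apply: ch; lia.
have jb : (0 < j.+1 < n)%N by lia.
have := dist_parent jb; have := depth_parent jb; rewrite pj => h1 h2; split; first lra.
by have := tree_dist_triangle inst (vx j.+1) (vx j) (vx i); lra.
Qed.

Lemma chain_dist p q i j : (q < n)%N -> chain p q ->
  (p <= i <= q)%N -> (p <= j <= q)%N -> d i j <= `|dp i - dp j|.
Proof.
move=> qn ch /andP[pi iq] /andP[pj jq].
have [ij|/ltnW ij] := leqP i j.
  have [dij dd] := chain_depth qn ch pi ij jq.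
  by rewrite distrC ger0_norm ?subr_ge0 // tree_dist_sym.
have [dij dd] := chain_depth qn ch pj ij iq.
by rewrite ger0_norm ?subr_ge0.
Qed.

(* Sorted marked positions, possibly repeated, that include the ends of all
   the maximal chains of degree-2 vertices. *)
Record marks (mk : nat -> nat) (M : nat) : Prop := Marks {
  mk_gt0 : (0 < M)%N;
  mk_first : mk 0%N = 0%N;
  mk_last : mk M.-1 = n.-1;
  mk_step : forall j, (j.+1 < M)%N -> (mk j <= mk j.+1)%N;
  mk_inner : forall j i, (j.+1 < M)%N -> (mk j < i < mk j.+1)%N -> inner i }.

(** The parent of a mark in the tree contracted to the marks. If the preceding position is the
    parent, the chain leads up to the previous mark; otherwise the parent is not [inner], hence
    itself a mark. *)
Definition mparent (mk : nat -> nat) j :=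
  if (pa (mk j)).+1 == mk j then mk j.-1 else pa (mk j).

(** Labels that are 1-Lipschitz on the contracted tree, whose edges have the differences of depth as
    lengths. *)
Definition relaxed mk M (X : nat -> R) := forall j, (0 < j < M)%N ->
  `|X (mk j) - X (mparent mk j)| <= dp (mk j) - dp (mparent mk j).

Section Marks.
Context {mk : nat -> nat} {M : nat}.
Hypothesis mP : marks mk M.

Lemma mk_mono i j : (i <= j)%N -> (j < M)%N -> (mk i <= mk j)%N.
Proof.
elim: j => [|j IH]; first by case: i.
rewrite leq_eqVlt => /predU1P[->//|ij] jM.
exact: leq_trans (IH ij (ltnW jM)) (mk_step mP jM).
Qed.

Lemma mk_lt i : (0 < n)%N -> (i < M)%N -> (mk i < n)%N.
Proof.
move=> n0 iM; have := mk_gt0 mP => M0.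
by rewrite -(ltn_predK n0) ltnS -(mk_last mP) mk_mono //; lia.
Qed.

Lemma mk_cover i : (0 < i < n)%N -> exists j, (j.+1 < M)%N /\ (mk j < i <= mk j.+1)%N.
Proof.
move=> /andP[i0 ilt].
have ex : exists j, (i <= mk j)%N && (j < M)%N.
  by exists M.-1; rewrite (mk_last mP); have := mk_gt0 mP; lia.
case: (ex_minnP ex) => -[|j] /andP[ij jM] jmin.
  by rewrite (mk_first mP) in ij; lia.
exists j; rewrite jM ij andbT ltnNge; split=> //; apply/negP => ij'.
by have := jmin j; rewrite ij' (ltnW jM) ltnn => /(_ isT).
Qed.

Lemma mk_not_inner i : (i < n)%N -> ~~ inner i -> exists j, (j < M)%N /\ mk j = i.
Proof.
move=> ilt ni; case: (posnP i) => [->|i0].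
  by exists 0%N; rewrite (mk_gt0 mP) (mk_first mP).
have [j [jM /andP[ji ij]]] := mk_cover (i := i) ltac:(by rewrite i0).
exists j.+1; split=> //; apply/eqP; rewrite eqn_leq ij andbT leqNgt.
by apply/negP => ij'; move: ni; rewrite (mk_inner mP jM) // ji.
Qed.

Lemma mk_uniq j j' i : (j.+1 < M)%N -> (j'.+1 < M)%N ->
  (mk j < i <= mk j.+1)%N -> (mk j' < i <= mk j'.+1)%N -> j = j'.
Proof.
move=> jM j'M /andP[a1 a2] /andP[b1 b2].
have [jj|jj|//] := ltngtP j j'.
  by have := mk_mono jj (ltnW j'M); lia.
by have := mk_mono jj (ltnW jM); lia.
Qed.

Lemma mk_not_between i j j' : (j.+1 < M)%N -> (j' < M)%N ->
  (mk j < i < mk j.+1)%N -> mk j' <> i.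
Proof.
move=> jM j'M /andP[a1 a2] E.
have [jj|jj] := leqP j' j; first by have := mk_mono jj (ltnW jM); lia.
by have := mk_mono jj j'M; lia.
Qed.

(** An interior position of a segment can only be reached through one of the two ends. *)
Definition segment_min (X : nat -> R) j i :=
  Num.min (X (mk j) + (dp i - dp (mk j))) (X (mk j.+1) + (dp (mk j.+1) - dp i)).

Lemma relaxed_chain X j : (0 < n)%N -> relaxed mk M X -> (j.+1 < M)%N ->
  (mk j < mk j.+1)%N -> ((mk j).+1 < mk j.+1)%N \/ pa (mk j.+1) = mk j ->
  chain (mk j) (mk j.+1) /\ `|X (mk j.+1) - X (mk j)| <= dp (mk j.+1) - dp (mk j).
Proof.
move=> n0 rX jM jj h.
have ch : chain (mk j) (mk j.+1).
  by apply: inner_chain => // [|i]; [rewrite jj mk_lt | apply: (mk_inner mP)].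
split=> //; have := rX j.+1 ltac:(by rewrite jM); rewrite /mparent.
have -> : (pa (mk j.+1)).+1 == mk j.+1; last by [].
by rewrite -[X in pa X](ltn_predK jj) (ch (mk j.+1).-1) ?(ltn_predK jj) //; lia.
Qed.

(** Inside a segment the minimum of a function of slope 1 and one of slope -1 is 1-Lipschitz in the
    depth, and it agrees with [X] at both ends because [X] is relaxed. The edges between positions
    that are not consecutive join two marks. *)
Lemma relaxed_extension X : (0 < n)%N -> relaxed mk M X -> exists f : nat -> R,
  [/\ forall j, (j < M)%N -> f (mk j) = X (mk j),
      forall j i, (j.+1 < M)%N -> (mk j < i < mk j.+1)%N -> f i = segment_min X j i
    & forall i, (0 < i < n)%N -> `|f i - f (pa i)| <= dp i - dp (pa i)].
Proof.
move=> n0 rX.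
pose f i := if i \in [seq mk j | j <- iota 0 M] then X i
  else if [pick j : 'I_M | (j.+1 < M)%N && (mk j < i < mk j.+1)%N] is Some j
  then segment_min X j i else 0.
have fmk j : (j < M)%N -> f (mk j) = X (mk j).
  by move=> jM; rewrite /f map_f // mem_iota.
have fin j i : (j.+1 < M)%N -> (mk j < i < mk j.+1)%N -> f i = segment_min X j i.
  move=> jM ib; rewrite /f ifF; last first.
    by apply/negP => /mapP[j']; rewrite mem_iota => j'M /esym; apply: mk_not_between ib.
  case: pickP => [l /andP[lM lb] | /(_ (Ordinal (ltnW jM)))]; last by rewrite /= jM ib.
  congr segment_min; apply: (mk_uniq (i := i)) => //; lia.
exists f; split=> // i ib; have /andP[i0 ilt] := ib.
have [plt _] := to_pa to ib.
have [pi|pi] := eqVneq (pa i) i.-1; last first.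
  have ni : ~~ inner i by apply: contra pi => /and3P[].
  have [j [jM ji]] := mk_not_inner ilt ni.
  have [j' [j'M j'i]] := mk_not_inner (ltn_trans plt ilt) (not_inner_parent to (tree_sym inst) ib pi).
  have j0 : (0 < j)%N by case: (j) ji i0 => //; rewrite (mk_first mP) => <-.
  have := rX j ltac:(by rewrite j0); rewrite /mparent ji ifF; last by lia.
  by rewrite -{1}j'i -(fmk _ j'M) j'i -{1}ji -(fmk _ jM) ji.
have [j [jM /andP[ji ij]]] := mk_cover ib.
have jj : (mk j < mk j.+1)%N by apply: leq_trans ij.
have [|ch Xc] := relaxed_chain n0 rX jM jj.
  have [|qp] := ltnP (mk j).+1 (mk j.+1); [by left | right].
  by have E : mk j.+1 = i by [lia]; rewrite E pi; lia.
have qn := mk_lt n0 jM.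
move: Xc; rewrite ler_norml => /andP[Xc1 Xc2].
have fseg k : (mk j <= k <= mk j.+1)%N -> f k = segment_min X j k.
  move=> /andP[]; rewrite leq_eqVlt => /predU1P[<-|jk].
    rewrite (fmk _ (ltnW jM)) /segment_min subrr addr0 => _.
    by apply/esym/min_idPl; lra.
  rewrite leq_eqVlt => /predU1P[->|kj]; last by rewrite (fin j) // jk.
  by rewrite (fmk _ jM) /segment_min subrr addr0; apply/esym/min_idPr; lra.
rewrite !fseg; [|lia..].
have := depth_parent ib; rewrite /segment_min ler_norml => ?.
by rewrite !minElt; repeat case: ifPn; rewrite -?leNgt => *; apply/andP; split; lra.
Qed.

End Marks.

(** * Packing of separated vertices *)

Section Packing.
Context (S : {set {set 'I_n}}) (D r : R) (m : nat) (y : 'I_m -> 'I_n).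
Hypothesis Sok : S \subset shortcuts [set: 'I_n].
Hypothesis hD : forall u v, dist (add_shortcuts c T S) u v <= D.
Hypothesis r_gt0 : 0 < r.
Hypothesis ysep : forall i j, i != j -> r <= dist T (y i) (y j).

(** Strictly between successive special positions, [T + S] is a bare path. *)
Definition special i := ~~ inner i || (vx i \in finset.cover S).

Lemma card_special : (#|[set i : 'I_n | special i]| <= 1 + 3 * #|leaves e| + 2 * #|S|)%N.
Proof.
have cS : (#|finset.cover S| <= 2 * #|S|)%N.
  apply: leq_trans (leq_card_cover S) _.
  rewrite mulnC -sum_nat_const; apply: leq_sum => p pS.
  by have := fintype.subsetP Sok _ pS; rewrite inE => /andP[_ /eqP->].
have cN := card_not_inner to (tree_sym inst).
apply: leq_trans (_ : #|[set i : 'I_n | ~~ inner i]| + #|[set i : 'I_n | vx i \in finset.cover S]| <= _)%N.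
  rewrite (_ : [set i : 'I_n | special i] = [set i : 'I_n | ~~ inner i] :|: [set i : 'I_n | vx i \in finset.cover S]) ?leq_card_setU //.
  by apply/setP => i; rewrite !inE.
apply: leq_add.
  by rewrite -sum1dep_card big_mkcond /=; apply: leq_trans cN; apply: leq_sum => i _; case: (~~ _).
apply: leq_trans cS; rewrite -(card_in_imset (f := fun i : 'I_n => vx i)).
  by apply/subset_leq_card/fintype.subsetP => v /imsetP[i]; rewrite inE => + ->.
move=> i j _ _ /(congr1 ps); rewrite !(to_psK to) // => ?; exact: val_inj.
Qed.

(** Positions 0 and [n.-1] are never [inner], so there is a special position on either side. *)
Lemma special_window i : (i < n)%N -> exists p q, [/\ (p <= i <= q)%N, (q < n)%N,
  special p, special q & p = q \/ (p.+1 < q)%N /\ forall j, (p < j < q)%N -> ~~ special j].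
Proof.
move=> ilt; have n0 : (0 < n)%N by apply: leq_trans ilt.
have [si|nsi] := boolP (special i).
  by exists i, i; rewrite leqnn; split=> //; left.
have exp : exists p, special p && (p <= i)%N by exists 0%N; rewrite leq0n.
have exq : exists q, [&& special q, i <= q & q < n]%N.
  by exists n.-1; rewrite /special (not_inner_last to n0) /=; lia.
have pb p : special p && (p <= i)%N -> (p <= i)%N by case/andP.
case: (ex_maxnP exp pb) => p /andP[sp pi] pmax.
case: (ex_minnP exq) => q /and3P[sq iq qn] qmin.
have pi' : p != i by apply: contraNneq nsi => <-.
have iq' : i != q by apply: contraNneq nsi => ->.
exists p, q; rewrite pi iq; split=> //; right; split=> [|j /andP[pj jq]]; first by lia.
apply/negP => sj.
have [ji|ij] := leqP j i.
  by have := pmax j; rewrite sj ji => /(_ isT); lia.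
by have := qmin j; rewrite sj (ltnW ij) (ltn_trans jq qn) => /(_ isT); lia.
Qed.

(** The potential is [g], the distance along the window to its nearer end, and 0 elsewhere. It
    vanishes at the ends of all shortcuts, so it is 1-Lipschitz on [T + S], and its value at [i] is
    at most the distance from [i] to [p]. *)
Lemma window_depth p q i : (p <= i <= q)%N -> (q < n)%N -> special p -> special q ->
  p = q \/ (p.+1 < q)%N /\ (forall j, (p < j < q)%N -> ~~ special j) ->
  Num.min (dp i - dp p) (dp q - dp i) <= D.
Proof.
move=> /andP[pi iq] qn sp sq nsp.
have pS := shortcuts_proper Sok.
have D0 : 0 <= D.
  by apply: le_trans (hD (vx 0) (vx 0)); apply: dist_ge0; apply: nonneg_TS.
have [->|pi'] := eqVneq p i; first by rewrite subrr (le_trans (ge_min_l _ _)).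
have [->|iq'] := eqVneq i q; first by rewrite subrr (le_trans (ge_min_r _ _)).
case: nsp => [?|[pq nsp]]; first by lia.
have ch : chain p q.
  apply: inner_chain; [lia | |by left] => j /nsp.
  by rewrite negb_or negbK => /andP[].
pose g j := if (p <= j <= q)%N then Num.min (dp j - dp p) (dp q - dp j) else 0.
have dm a b : (p <= a)%N -> (a <= b)%N -> (b <= q)%N -> dp a <= dp b.
  by move=> pa' ab bq; have [] := chain_depth qn ch pa' ab bq.
have g0 j : ~~ (p < j < q)%N -> g j = 0.
  rewrite /g; case: ifP => // /andP[pj jq] nj.
  have dpq := dm p q ltac:(lia) ltac:(lia) ltac:(lia).
  have [->|->] : j = p \/ j = q by lia.
    by rewrite subrr; apply/min_idPl; lra.
  by rewrite subrr; apply/min_idPr; lra.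
have gL j : (0 < j < n)%N -> `|g j - g (pa j)| <= dp j - dp (pa j).
  move=> jb; have dj := depth_parent jb; have [plt _] := to_pa to jb.
  have [jin|jout] := boolP (p < j <= q)%N.
    have pj : pa j = j.-1 by have := ch j.-1 ltac:(lia); rewrite prednK //; lia.
    rewrite /g !ifT ?pj; [|lia..]; rewrite pj in dj.
    by rewrite ler_norml !minElt; repeat case: ifPn; rewrite -?leNgt => *; apply/andP; split; lra.
  rewrite !g0 ?subrr ?normr0 ?subr_ge0 //; last by lia.
  (* No edge leaves the interior of the window sideways: the only child of an [inner] position is
     the next one. *)
  apply/negP => /andP[pj jq].
  have inj : inner (pa j) by have := nsp (pa j) ltac:(lia); rewrite negb_or negbK => /andP[].
  have := inner_child to (tree_sym inst) (i := pa j) (j := j) ltac:(lia) inj jb erefl.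
  by lia.
have gv u v x : x \in add_shortcuts c T S u v -> g (ps u) <= g (ps v) + x.
  rewrite mem_add_shortcuts => /orP[|/andP[uvS /eqP->]]; first exact: position_lipschitz.
  have uv : u != v by apply: contraNneq (pS u) => uv; rewrite {2}uv.
  have sps w : w \in [set u; v] -> g (ps w) = 0.
    move=> wuv; apply: g0; apply/negP => /nsp /negP; apply.
    by rewrite /special (to_vxK to); apply/orP; right; apply/bigcupP; exists [set u; v].
  by rewrite !sps ?inE ?eqxx ?orbT // add0r (inst_ge0 inst).
have := lipschitz_dist (f := g \o ps) (conn_TS inst (S := S) (vx i) (vx p)) gv.
rewrite /= !(to_psK to); [|lia..].
rewrite (g0 p) ?subr0; last by lia.
rewrite /g ifT; last by lia.
by move=> h; apply: le_trans (hD (vx i) (vx p)).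
Qed.

Lemma window_chain p q : (q < n)%N ->
  p = q \/ (p.+1 < q)%N /\ (forall j, (p < j < q)%N -> ~~ special j) -> chain p q.
Proof.
move=> qn [->|[pq nsp]] j; first by lia.
by apply: (@inner_chain p q) => [|i /nsp|]; [lia | rewrite negb_or negbK => /andP[] | left].
Qed.

Lemma truncn_close x z : 0 <= x -> 0 <= z ->
  Num.truncn (x / r) = Num.truncn (z / r) -> `|x - z| < r.
Proof.
move=> x0 z0 xz; have xr : 0 <= x / r by rewrite divr_ge0 // ltW.
have zr : 0 <= z / r by rewrite divr_ge0 // ltW.
have /andP[x1 x2] := truncn_itv xr; have /andP[z1 z2] := truncn_itv zr.
rewrite -xz in z1 z2; move: x1 x2 z1 z2.
rewrite !ler_pdivlMr // !ltr_pdivrMr // -addn1 natrD.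
by rewrite ltr_norml => *; apply/andP; split; lra.
Qed.

(* Two separated vertices cannot have the same code, made of the special end of
   their window that is at distance at most [D] and of that distance divided by
   [r] and truncated. *)
Lemma packing : (m <= 2 * (1 + 3 * #|leaves e| + 2 * #|S|) * (Num.truncn (D / r)).+1)%N.
Proof.
have D0 : 0 <= D.
  by apply: le_trans (hD (vx 0) (vx 0)); apply: dist_ge0; apply: nonneg_TS => //; apply: shortcuts_proper Sok.
pose N := Num.truncn (D / r).
pose code i z (b : bool) (t : nat) := exists p q,
  [/\ (p <= ps (y i) <= q)%N && (q < n)%N, special z,
   p = q \/ (p.+1 < q)%N /\ (forall j, (p < j < q)%N -> ~~ special j)
   & if b then z = p /\ t = Num.truncn ((dp (ps (y i)) - dp p) / r)
     else z = q /\ t = Num.truncn ((dp q - dp (ps (y i))) / r)].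
have ex i : exists zbt : 'I_n * bool * 'I_N.+1, code i zbt.1.1 zbt.1.2 zbt.2.
  have [p [q [piq qn sp sq nsp]]] := special_window (to_ps to (y i)).
  have := window_depth piq qn sp sq nsp; have /andP[pi iq] := piq.
  have tr x : x <= D -> (Num.truncn (x / r) < N.+1)%N.
    by move=> xD; rewrite ltnS le_truncn // ler_pM2r // invr_gt0.
  rewrite ge_min => /orP[/tr lt|/tr lt].
    exists (Ordinal (leq_ltn_trans pi (leq_ltn_trans iq qn)), true, Ordinal lt).
    by exists p, q; rewrite piq; split.
  by exists (Ordinal qn, false, Ordinal lt); exists p, q; rewrite piq; split.
have [F hF] := choice ex.
have Finj : injective F.
  move=> i j Fij; apply/eqP/negPn/negP => /ysep; apply/negP; rewrite -ltNge.
  have [p [q [/andP[piq qn] sz nsp]]] := hF i.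
  have [p' [q' [/andP[piq' qn'] sz' nsp']]] := hF j.
  have close p0 q0 a b : (q0 < n)%N -> chain p0 q0 ->
      (p0 <= ps (y i) <= q0)%N -> (p0 <= ps (y j) <= q0)%N ->
      a - b = dp (ps (y i)) - dp (ps (y j)) \/ b - a = dp (ps (y i)) - dp (ps (y j)) ->
      0 <= a -> 0 <= b -> Num.truncn (a / r) = Num.truncn (b / r) ->
      dist T (y i) (y j) < r.
    move=> q0n ch yi yj ab a0 b0 tE; have := chain_dist q0n ch yi yj.
    rewrite !(to_vxK to) => /le_lt_trans; apply.
    by case: ab => <-; rewrite 1?distrC; apply: truncn_close => //; rewrite 1?distrC.
  have ch := window_chain qn nsp; have ch' := window_chain qn' nsp'.
  have mono := chain_depth qn ch; have mono' := chain_depth qn' ch'.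
  have dpi : dp p <= dp (ps (y i)) /\ dp (ps (y i)) <= dp q.
    by split; [have [] := mono p (ps (y i)) | have [] := mono (ps (y i)) q] => //; lia.
  have dpj : dp p' <= dp (ps (y j)) /\ dp (ps (y j)) <= dp q'.
    by split; [have [] := mono' p' (ps (y j)) | have [] := mono' (ps (y j)) q'] => //; lia.
  case: dpi => dpi dqi; case: dpj => dpj dqj.
  rewrite -Fij; case: (F i).1.2 => -[zE ->] [zE' tE]; rewrite zE in zE'.
    rewrite zE' in nsp' ch' piq' tE dpj.
    (* The two windows share the end of the code but may differ in the other one; the longer of the
       two contains both positions. *)
    have [q0 [q0n ch0 yi yj]] : exists q0, [/\ (q0 < n)%N, chain p q0,
        (p <= ps (y i) <= q0)%N & (p <= ps (y j) <= q0)%N].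
      have [qq|qq] := leqP q q'; [exists q' | exists q]; split=> //; clear -piq piq' qq; lia.
    by apply: (close _ _ _ _ q0n ch0 yi yj _ _ _ tE); [right; lra | lra..].
  rewrite zE' in nsp' ch' qn' piq' tE dqj.
  have [p0 [ch0 yi yj]] : exists p0, [/\ chain p0 q,
      (p0 <= ps (y i) <= q)%N & (p0 <= ps (y j) <= q)%N].
    have [pp|pp] := leqP p p'; [exists p | exists p']; split=> //; clear -piq piq' pp; lia.
  by apply: (close _ _ _ _ qn ch0 yi yj _ _ _ tE); [left; lra | lra..].
rewrite -[leqLHS]card_ord -(card_imset _ Finj).
apply: leq_trans (_ : #|finset.setX (finset.setX [set i : 'I_n | special i] [set: bool]) [set: 'I_N.+1]| <= _)%N.
  apply/subset_leq_card/fintype.subsetP => z /imsetP[i _ ->].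
  by have [p [q [_ sz _ _]]] := hF i; rewrite !inE !andbT.
rewrite !finset.cardsX !cardsT card_bool card_ord leq_mul2r orbC.
by rewrite mulnC leq_mul2l card_special.
Qed.

End Packing.

End Depth.

Arguments is_depth {R n} c vx pa dp.

(** * Separation of the centers *)

Section Gonzalez.
Context {R : realType} {V : finType} {G : wgraph R V} {h : nat} {x : nat -> V}.
Hypothesis G_sym : sym_graph G.
Hypothesis gx : gonzalez G h x.
Hypothesis h_gt0 : (0 < h)%N.

Definition mindist i v := \big[Num.min/dist G v (x 0%N)]_(j < i) dist G v (x j).

Lemma mindist_le i j v : (j < i)%N -> mindist i v <= dist G v (x j).
Proof. by move=> ji; apply: (bigmin_le _ (Ordinal ji)). Qed.

Lemma mindist_attained i v : (0 < i)%N -> exists2 j, (j < i)%N & mindist i v = dist G v (x j).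
Proof.
move=> i0; apply: (big_ind (fun m => exists2 j, (j < i)%N & m = dist G v (x j))).
- by exists 0%N.
- move=> a b [j ji ->] [j' ji' ->]; rewrite minElt.
  by case: ifP => _; [exists j | exists j'].
- by move=> j _; exists j.
Qed.

(** Here [r] is the covering radius after [h] rounds, attained at [w]. When a center is picked it is
    at least as far from the earlier ones as [w] is at that moment, and this distance of [w] only
    decreases later. *)
Lemma gonzalez_packing (v0 : V) : exists r : R,
  (forall v, exists2 i, (i < h)%N & dist G v (x i) <= r) /\
  exists y : 'I_h.+1 -> V, forall i j, i != j -> r <= dist G (y i) (y j).
Proof.
pose w := [arg max_(v > v0) mindist h v]%O.
have wmax v : mindist h v <= mindist h w.
  by rewrite /w; case: arg_maxP => // z _; apply.
exists (mindist h w); split=> [v|].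
  have [i ih E] := mindist_attained v h_gt0.
  by exists i => //; rewrite -E.
pose y (i : 'I_h.+1) := if (i < h)%N then x i else w.
have ylt (i j : 'I_h.+1) : (i < j)%N -> mindist h w <= dist G (y j) (y i).
  move=> ij; have ih : (i < h)%N by have := ltn_ord j; lia.
  rewrite /y ih; case: ltnP => jh; last exact: mindist_le.
  apply: le_trans (mindist_le (x j) ij).
  apply: le_trans (gx (i := j) _ w); last by rewrite jh andbT; lia.
  rewrite -/(mindist j w); have [l lj ->] := mindist_attained (i := j) w ltac:(lia).
  by apply: mindist_le; apply: ltn_trans lj jh.
exists y => i j; rewrite -val_eqE /= neq_ltn => /orP[/ylt|/ylt //].
by rewrite (dist_sym _ _ G_sym).
Qed.

End Gonzalez.

(** * The approximation ratio *)

Section Approximation.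
Context {R : realType} {n : nat} {e : rel 'I_n} {c : 'I_n -> 'I_n -> R}.
Context {vx : nat -> 'I_n} {ps : 'I_n -> nat} {pa : nat -> nat} {dp : nat -> R}.
Hypothesis inst : doat_instance e c.
Hypothesis mc : metric c.
Hypothesis to : tree_order e vx ps pa.
Hypothesis hdp : is_depth c vx pa dp.
Local Notation T := (tree_graph e c).

(** If the error [4 * 2 ^ k * r] exceeded [eps * D], then [D / r] would be below [4 * 2 ^ k / eps],
    and [packing] would allow fewer than [h + 1] separated vertices. *)
Lemma approximation (eps : R) k (S' Sopt : {set {set 'I_n}}) : 0 < eps ->
  2 * (1 + 3 * #|leaves e| + 2 * k)%N%:R * (4 * 2 ^+ k / eps + 1)
    < (Defs.eta R n k - #|branch_vertices e|)%N.+1%:R :> R ->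
  reduction_output e c k S' ->
  optimal_shortcuts [set: 'I_n] T c k Sopt ->
  diam [set: 'I_n] (add_shortcuts c T S') <= (1 + eps) * diam [set: 'I_n] (add_shortcuts c T Sopt).
Proof.
move=> eps0 hbig [hB [x gx opt]] [sS cS _].
set h := (Defs.eta R n k - #|branch_vertices e|)%N in hbig gx opt.
have h0 : (0 < h)%N by rewrite subn_gt0.
have sT := sym_tree_graph inst.
have [r [cov [y ysep]]] := gonzalez_packing sT gx h0 (vx 0).
set A := _ :|: _ in opt.
have [f hf] : {f : 'I_n -> 'I_n & forall v, f v \in A /\ dist T v (f v) <= r}.
  apply: (@choice _ _ (fun v w => w \in A /\ dist T v w <= r)) => v; have [i ih xi] := cov v; exists (x i); split=> //.
  by rewrite inE; apply/orP; right; apply/imsetP; exists (Ordinal ih).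
have := reduction_diam inst mc (fun v => (hf v).1) (fun v => (hf v).2) opt sS cS.
move=> /le_trans; apply; rewrite [leRHS]mulrDl mul1r lerD2l.
set D := diam _ _.
have pS := shortcuts_proper sS.
have hD u v : dist (add_shortcuts c T Sopt) u v <= D by apply: dist_le_diam; rewrite inE.
have D0 : 0 <= D by apply: diam_ge0.
rewrite leNgt; apply/negP => Dr.
have k0 : 0 < 4 * 2 ^+ k :> R by rewrite mulr_gt0 // exprn_gt0.
have r0 : 0 < r.
  rewrite -(pmulr_rgt0 _ k0); apply: le_lt_trans Dr; exact: mulr_ge0 (ltW eps0) D0.
have := packing inst to hdp sS hD r0 ysep.
apply/negP; rewrite -ltnNge -(ltr_nat R); apply: le_lt_trans hbig.
rewrite natrM; apply: ler_pM => //.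
  rewrite natrM ler_wpM2l // ler_nat; lia.
rewrite -natr1 lerD2r.
have Dr0 : 0 <= D / r by rewrite divr_ge0 // ltW.
have /andP[+ _] := truncn_itv Dr0; move=> /le_trans; apply.
rewrite ler_pdivrMr // mulrAC ler_pdivlMr // mulrC; exact: ltW.
Qed.

End Approximation.

(** * Two relaxation sweeps over the marks *)

Section Relax.
Context {R : realType} {n : nat} {e : rel 'I_n} {c : 'I_n -> 'I_n -> R}.
Context {vx : nat -> 'I_n} {ps : 'I_n -> nat} {pa : nat -> nat} {dp : nat -> R}.
Hypothesis inst : doat_instance e c.
Hypothesis to : tree_order e vx ps pa.
Hypothesis hdp : is_depth c vx pa dp.
Hypothesis pa0 : pa 0%N = 0%N.
Hypothesis n_gt0 : (0 < n)%N.
Local Notation T := (tree_graph e c).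
Local Notation d i j := (dist T (vx i) (vx j)).
Local Notation inner := (inner (e := e) (vx := vx) (pa := pa)).
Local Notation marks := (marks (e := e) (vx := vx) (pa := pa)).
Local Notation mparent := (mparent (pa := pa)).
Implicit Types (mk : nat -> nat) (M : nat) (X : nat -> R).

Definition mweight mk j := dp (mk j) - dp (mparent mk j).

Lemma relaxedP mk M X : relaxed (dp := dp) (pa := pa) mk M X <->
  forall j, (0 < j < M)%N -> X (mparent mk j) <= X (mk j) + mweight mk j /\
    X (mk j) <= X (mparent mk j) + mweight mk j.
Proof.
split=> h j jb; have := h j jb; rewrite /mweight ler_norml.
  by move=> /andP[]; split; lra.
by move=> []; move=> *; apply/andP; split; lra.
Qed.

Lemma marks_eq mk mk' M : (forall j, (j < M)%N -> mk j = mk' j) -> marks mk M -> marks mk' M.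
Proof.
move=> E mP; have M0 := mk_gt0 mP; split=> //.
- by rewrite -E ?(mk_first mP).
- by rewrite -E ?(mk_last mP) // prednK.
- by move=> j jM; rewrite -(E j) ?(ltnW jM) // -(E j.+1) //; apply: (mk_step mP jM).
- by move=> j i jM; rewrite -(E j) ?(ltnW jM) // -(E j.+1) //; apply: (mk_inner mP jM).
Qed.

Lemma marks_filter (a : pred nat) : a 0%N -> a n.-1 ->
  (forall i, (i < n)%N -> ~~ a i -> inner i) ->
  let l := [seq i <- iota 0 n | a i] in marks (nth 0%N l) (size l).
Proof.
move=> a0 an ha l.
have sl : sorted ltn l by apply: sorted_filter (iota_ltn_sorted 0 n); exact: ltn_trans.
have l0 : l = 0%N :: behead l by rewrite /l -(ltn_predK n_gt0) /= a0.
have sz : (0 < size l)%N by rewrite l0.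
split=> //.
- by rewrite l0.
- rewrite nth_last /l -(ltn_predK n_gt0) -addn1 iotaD filter_cat /= add0n an last_cat /=.
  by rewrite addn1.
- by move=> j jl; rewrite ltnW // (sorted_ltn_nth ltn_trans) // inE ltnW.
move=> j i jl /andP[ji ij].
have iln : (i < n)%N.
  apply: (ltn_trans ij); have : nth 0%N l j.+1 \in l by apply: mem_nth.
  by rewrite mem_filter mem_iota => /andP[_].
apply: ha => //; apply/negP => ai.
have il : i \in l by rewrite mem_filter ai mem_iota.
have il' : (index i l < size l)%N by rewrite index_mem.
have lt k k' : (k < k')%N -> (k' < size l)%N -> (nth 0%N l k < nth 0%N l k')%N.
  by move=> kk k'l; apply: (sorted_ltn_nth ltn_trans) => //; rewrite inE // (ltn_trans kk).
have iE : nth 0%N l (index i l) = i by apply: nth_index.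
have [h|h] := leqP (index i l) j.
  move: h; rewrite leq_eqVlt => /predU1P[E|h]; first by rewrite -E iE ltnn in ji.
  by have := lt _ _ h (ltnW jl); rewrite iE; lia.
move: h; rewrite leq_eqVlt => /predU1P[E|h]; first by rewrite E iE ltnn in ij.
by have := lt _ _ h il'; rewrite iE; lia.
Qed.

Section Step.
Context {mk : nat -> nat} {M : nat}.
Hypothesis mP : marks mk M.
Local Notation cp := (mparent mk).
Local Notation w := (mweight mk).

Lemma marks_chain j : (j.+1 < M)%N -> (mk j < mk j.+1)%N -> ((pa (mk j.+1)).+1 = mk j.+1) ->
  chain (pa := pa) (mk j) (mk j.+1).
Proof.
move=> jM jj pj; apply: (inner_chain to) => [|i|].
- by rewrite jj (mk_lt mP).
- exact: (mk_inner mP).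
have [|jj'] := ltnP (mk j).+1 (mk j.+1); first by left.
by right; lia.
Qed.

(** What the sweeps need to know of the contracted tree. As marks may be repeated, a mark can be its
    own parent at weight 0. *)
Lemma mparent_cases j : (0 < j < M)%N ->
  [/\ (cp j <= mk j)%N, 0 <= w j, d (mk j) (cp j) <= w j,
      exists2 j', (j' < M)%N & mk j' = cp j
    & (cp j < mk j)%N -> cp j = pa (mk j) \/ (pa (mk j)).+1 = mk j /\ cp j = mk j.-1].
Proof.
case: j => // j jM; have qn := mk_lt mP n_gt0 jM.
rewrite /mweight /mparent; case: eqP => [pj|pj] /=.
  split; [exact: (mk_step mP) | | | by exists j => //; exact: ltnW | by right].
    move: (mk_step mP jM); rewrite leq_eqVlt => /predU1P[->|jj]; first by rewrite subrr.
    have [h _] := chain_depth inst to hdp qn (marks_chain jM jj pj) (leqnn _) (ltnW jj) (leqnn _).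
    by rewrite subr_ge0.
  move: (mk_step mP jM); rewrite leq_eqVlt => /predU1P[->|jj]; first by rewrite subrr tree_distxx.
  by have [_ h] := chain_depth inst to hdp qn (marks_chain jM jj pj) (leqnn _) (ltnW jj) (leqnn _).
(* A later mark may again be position 0; thanks to [pa 0 = 0] it is its own parent. *)
case: (posnP (mk j.+1)) => [->|q0].
  by rewrite pa0 subrr tree_distxx //; split=> //; exists 0%N; [exact: mk_gt0 mP | exact: mk_first mP].
have qb : (0 < mk j.+1 < n)%N by rewrite q0.
have [plt _] := to_pa to qb; split.
- exact: ltnW.
- by rewrite subr_ge0 (depth_parent inst to hdp).
- exact: (dist_parent inst to hdp).
- have [||j' [j'M E]] := mk_not_inner mP (i := pa (mk j.+1)); last by exists j'.
    exact: ltn_trans plt qn.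
  by apply: (not_inner_parent to (tree_sym inst)) => //; apply/eqP => E; apply: pj; lia.
- by left.
Qed.

(** On a chain, only the first of several equal marks has a parent at a smaller position. *)
Lemma mparent_same j j' : (0 < j < M)%N -> (0 < j' < M)%N -> mk j = mk j' ->
  (cp j < mk j)%N -> (cp j' < mk j')%N -> cp j = cp j'.
Proof.
move=> jb jb' E cj cj'.
have [pq|pq] := eqVneq (pa (mk j)).+1 (mk j); last first.
  by rewrite /mparent -E (negbTE pq).
move: cj cj'; rewrite /mparent -E pq eqxx.
have key i i' : (0 < i < M)%N -> (0 < i' < M)%N -> mk i = mk i' -> (mk i.-1 < mk i)%N -> (i <= i')%N.
  move=> ib ib' E' lt; rewrite leqNgt; apply/negP => i'i.
  by have := mk_mono mP (i := i') (j := i.-1) ltac:(lia) ltac:(lia); lia.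
move=> h1 h2; have -> // : j = j'; apply/eqP; rewrite eqn_leq.
by rewrite (key j j') ?(key j' j) // -E.
Qed.

(** The sweep goes from the last mark to the first. Step [j] changes no label at position [mk j] or
    beyond except by keeping it, so the child side of the inequalities already established stays the
    same, while the parent side can only decrease. *)
Lemma relax_up X X' j : (0 < j < M)%N ->
  (forall i, X' i = if i == cp j then Num.min (X i) (X (mk j) + w j) else X i) ->
  (forall j', (j < j' < M)%N -> X (cp j') <= X (mk j') + w j') ->
  forall j', (j <= j' < M)%N -> X' (cp j') <= X' (mk j') + w j'.
Proof.
move=> jb hX h j' /andP[jj' j'M].
have [cj w0 _ _ _] := mparent_cases jb.
have jb' : (0 < j' < M)%N by lia.
have [cj' w0' _ _ _] := mparent_cases jb'.
have mjj : (mk j <= mk j')%N by apply: (mk_mono mP).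
have le i : X' i <= X i by rewrite hX; case: ifP => // _; apply: ge_min_l.
have same i : (mk j <= i)%N -> X' i = X i.
  move=> ji; rewrite hX; case: eqVneq => // iE.
  have E : cp j = mk j by lia.
  by apply/min_idPl; rewrite iE E lerDl.
rewrite (same _ mjj); have [E|jne] := eqVneq j j'.
  by rewrite -E hX eqxx ge_min_r.
by apply: le_trans (le _) (h _ _); lia.
Qed.

(** The sweep goes from the first mark to the last. The labels of the parents of earlier marks are
    already final, and lowering a label to that of its parent plus a non-negative weight cannot
    break the inequality established upwards. *)
Lemma relax_down X X' j : (0 < j < M)%N ->
  (forall i, X' i = if i == mk j then Num.min (X i) (X (cp j) + w j) else X i) ->
  (forall j', (0 < j' < M)%N -> X (cp j') <= X (mk j') + w j') ->
  (forall j', (0 < j' < j)%N -> X (mk j') <= X (cp j') + w j') ->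
  (forall j', (0 < j' < M)%N -> X' (cp j') <= X' (mk j') + w j') /\
  (forall j', (0 < j' <= j)%N -> X' (mk j') <= X' (cp j') + w j').
Proof.
move=> jb hX up dn.
have [cj w0 _ _ _] := mparent_cases jb.
have le i : X' i <= X i by rewrite hX; case: ifP => // _; apply: ge_min_l.
have lt_same i : (i < mk j)%N -> X' i = X i.
  by move=> h; rewrite hX ifF //; lia.
split=> j' jb'.
  have [cj' w0' _ _ _] := mparent_cases jb'.
  have [qE|qE] := eqVneq (mk j') (mk j); last first.
    by apply: le_trans (le _) _; rewrite (hX (mk j')) (negbTE qE) up.
  move: cj'; rewrite leq_eqVlt => /predU1P[->|cj']; first by rewrite lerDl.
  rewrite lt_same -?qE // (hX (mk j')) qE eqxx -{1}qE.
  have := up j' jb'; rewrite qE => upj'.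
  rewrite -lerBlDr le_min !lerBlDr -?qE qE upj' /=.
  move: (cj); rewrite leq_eqVlt => /predU1P[cE|cj2].
    by rewrite cE; have := upj'; lra.
  by rewrite (mparent_same jb' jb qE cj') //; lra.
have jM : (j' < M)%N by lia.
have jb2 : (0 < j' < M)%N by lia.
have [cj' w0' _ _ _] := mparent_cases jb2.
have mjj : (mk j' <= mk j)%N by apply: (mk_mono mP); lia.
have [cE|cE] := eqVneq (cp j') (mk j).
  have -> : mk j' = cp j' by lia.
  by rewrite lerDl.
have cpE : X' (cp j') = X (cp j') by rewrite hX (negbTE cE).
rewrite cpE; have [E|jne] := eqVneq j' j.
  by rewrite E hX eqxx ge_min_r.
by apply: le_trans (le _) (dn _ _); lia.
Qed.

(** Since [x = mk j] is allowed, a center that is already marked does not have to be detected. *)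
Lemma marks_insert j x : (j < M)%N -> (mk j <= x < n)%N -> ((j.+1 < M)%N -> (x <= mk j.+1)%N) ->
  marks (fun i => if (i <= j)%N then mk i else if i == j.+1 then x else mk i.-1) M.+1.
Proof.
move=> jM /andP[jx xn] xj; have M0 := mk_gt0 mP.
have last_case : j.+1 = M -> x = n.-1.
  by move=> jE; have := mk_last mP; rewrite -jE /=; lia.
split=> //.
- exact: mk_first mP.
- rewrite /= ifF; last by lia.
  case: eqP => [E|ne]; first by apply: last_case.
  exact: mk_last mP.
- move=> i iM; have [ij|ij] := leqP i.+1 j.
    by rewrite (ltnW ij) (mk_step mP) //; lia.
  have [->|ine] := eqVneq i j; first by rewrite leqnn eqxx.
  rewrite (_ : (i <= j)%N = false); last by lia.
  rewrite (_ : (i.+1 == j.+1) = false); last by lia.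
  case: eqP => [E|ij']; first by rewrite /= E xj //; lia.
  have := mk_step mP (j := i.-1) ltac:(lia).
  by rewrite prednK //; lia.
move=> i y iM; have [ij|ij] := leqP i.+1 j.
  by rewrite (ltnW ij) => h; apply: (mk_inner mP) h; lia.
have [->|ine] := eqVneq i j.
  rewrite leqnn eqxx => h; have [jM'|jM'] := ltnP j.+1 M.
    by apply: (mk_inner mP (j := j)) => //; have := xj jM'; lia.
  have E : j.+1 = M by lia.
  by have := last_case E; have := mk_last mP; rewrite -E /=; lia.
rewrite (_ : (i <= j)%N = false); last by lia.
rewrite (_ : (i.+1 == j.+1) = false); last by lia.
case: eqP => [->|ij'] /= h; first by apply: (mk_inner mP (j := j)) => //; lia.
by apply: (mk_inner mP (j := i.-1)) => //; rewrite ?prednK //; lia.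
Qed.

End Step.

End Relax.

(** * Growth of the number of centers *)

Section Growth.
Context {R : realType} {kbound : nat -> nat}.
Hypothesis hk : (fun n => (kbound n)%:R : R) =o_eventually (fun n => Num.sqrt (ln n%:R) : R).

Lemma log_dominates (a : R) : 0 < a -> exists n0 : nat, forall n k : nat,
  (n0 <= n)%N -> (k <= kbound n)%N -> a * ((2 * k + 2) ^ 2)%N%:R <= ln n%:R.
Proof.
(* As [(2k + 2)^2 <= 8 k^2 + 8], each of the two terms may use half of [ln n]: [8 * a * b] is one
   half, and [16 * a <= ln n] handles the constant term. *)
move=> a0; set b := (16 * a)^-1 : R.
have b0 : 0 < b by rewrite invr_gt0 mulr_gt0.
have sb0 : 0 < Num.sqrt b by rewrite sqrtr_gt0.
have /eqoP/(_ _ sb0)[n1 _ h1] := hk.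
exists (maxn n1 (Num.truncn (expR (16 * a))).+1) => n k.
rewrite geq_max => /andP[nn1 nn2] kn.
have l16 : 16 * a <= ln n%:R.
  rewrite -[leLHS](expRK (R := R)) ler_ln ?posrE ?expR_gt0 //.
    apply/ltW/(lt_le_trans (truncnS_gt _)); by rewrite ler_nat.
  by rewrite ltr0n; apply: leq_trans nn2.
have l0 : 0 <= ln n%:R :> R by apply: le_trans l16; rewrite mulr_ge0 // ltW.
have /= := h1 n nn1; rewrite ger0_norm ?ler0n // ger0_norm ?sqrtr_ge0 // => h2.
have k2 : (k ^ 2)%N%:R <= b * ln n%:R.
  rewrite natrX -(sqr_sqrtr (ltW b0)) -(sqr_sqrtr l0) -exprMn lerXn2r ?nnegrE ?mulr_ge0 ?sqrtr_ge0 ?ler0n //.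
  by apply: le_trans h2; rewrite ler_nat.
have : ((2 * k + 2) ^ 2 <= 8 * k ^ 2 + 8)%N by rewrite -!mulnn; nia.
rewrite -(ler_nat R) natrD natrM => h3.
have ab : a * (8 * b) = 2^-1 by rewrite /b; field; rewrite gt_eqF.
have := ler_wpM2l (ltW a0) h3.
have := ler_wpM2l (ltW a0) (ler_wpM2l (ler0n R 8) k2).
by rewrite !mulrDr !mulrA -[a * 8 * b]mulrA ab; lra.
Qed.

End Growth.

Section EtaBounds.
Context {R : realType} (n k : nat).
Hypothesis n_gt0 : (0 < n)%N.
Local Notation q := (2 * k + 2)%N.
Local Notation y := (n%:R `^ ((q ^ 2)%N%:R^-1) : R).
Local Notation E := (Defs.eta R n k).

Lemma root_exp : y ^+ (q ^ 2)%N = n%:R.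
Proof.
by rewrite -powR_mulrn ?powR_ge0 // -powRrM mulVf ?powRr1 // pnatr_eq0.
Qed.

Lemma root_eta : n%:R `^ (q%:R^-1) = y ^+ q :> R.
Proof.
rewrite -powR_mulrn ?powR_ge0 // -powRrM; congr powR.
have q0 : q%:R != 0 :> R by rewrite pnatr_eq0 addn2.
by rewrite natrX; field.
Qed.

Lemma eta_bounds : E%:R <= 2 * y ^+ q < E.+1%:R.
Proof.
by rewrite /Defs.eta root_eta truncn_itv // mulr_ge0 ?exprn_ge0 ?powR_ge0.
Qed.

(** This describes [eta] by integer powers only, which is what the program can test. *)
Lemma eta_pow : (E ^ q <= n * 2 ^ q < E.+1 ^ q)%N.
Proof.
have := eta_bounds; move: E => w /andP[h1 h2].
have nE : (n * 2 ^ q)%N%:R = (2 * y ^+ q) ^+ q :> R.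
  by rewrite exprMn -exprM mulnn root_exp natrM natrX mulrC.
have y0 : 0 <= 2 * y ^+ q by rewrite mulr_ge0 ?exprn_ge0 ?powR_ge0.
move: (2 * y ^+ q) h1 h2 nE y0 => z h1 h2 nE y0.
rewrite -(ler_nat R) -(ltr_nat R) nE !natrX; apply/andP; split.
  by apply: lerXn2r; rewrite ?nnegrE ?ler0n.
by rewrite ltrXn2r ?addn2.
Qed.

Lemma root_ge (a : R) : a * (q ^ 2)%N%:R <= ln n%:R -> 1 + a <= y.
Proof.
move=> h; have n0 : n%:R != 0 :> R by rewrite pnatr_eq0 -lt0n.
apply: le_trans (expR_ge1Dx _) _; rewrite /powR (negbTE n0) ler_expR.
by rewrite mulrC ler_pdivlMr // ltr0n expn_gt0 addn2.
Qed.

End EtaBounds.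

(** Let [q = 2k + 2] and let [y] be the [q^2]-th root of [n]. There are at most [C1 * y] leaves, and
    [eta] is about [2 * y^q = 2 * y^2 * y^(2k)]. As [y] exceeds any given constant, [y^(2k)] absorbs
    the factor [4^k], one of the remaining factors [y] absorbs the leaves and the other one the
    constants. *)
Lemma eta_large (R : realType) (eps C : R) (kbound : nat -> nat) : 0 < eps ->
  (fun n => (kbound n)%:R : R) =o_eventually (fun n => Num.sqrt (ln n%:R) : R) ->
  exists n0 : nat, forall n k l : nat, (n0 <= n)%N -> (k <= kbound n)%N -> (0 < n)%N ->
    l%:R <= C * n%:R `^ (((2 * k + 2) ^ 2)%N%:R^-1) ->
    let E := Defs.eta R n k in
    [/\ (2 * k + 2 <= E)%N, (l < E)%N, (2 ^ (2 * k + 2) <= n)%N, (1 + 3 * l + E < n)%N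
      & forall b, (b <= l)%N ->
        2 * (1 + 3 * l + 2 * k)%N%:R * (4 * 2 ^+ k / eps + 1) < (E - b)%N.+1%:R :> R].
Proof.
move=> eps0 hk; set C1 := 1 + `|C|; set f := 4 / eps + 1.
have C1_1 : 1 <= C1 by rewrite /C1 lerDl.
have f1 : 1 <= f by rewrite /f lerDr divr_ge0 // ltW.
(* The terms [12 * C1 * f] and one [C1] serve the last bound, [7 * C1] makes [1 + 3 * l + E] smaller
   than [n], and 2 ensures [2 <= y]. *)
have [n0 h0] := log_dominates hk (a := 12 * C1 * f + 7 * C1 + 2) ltac:(nra).
exists n0 => n k l nn kn n_gt0 hl E.
have /andP[E1 E2] := eta_bounds (R := R) n k.
have yn := root_exp (R := R) n k.
have := root_ge n_gt0 (h0 n k nn kn).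
rewrite -/E in E1 E2; set q := (2 * k + 2)%N in hl E1 E2 yn *.
move: (n%:R `^ _) hl E1 E2 yn => y hl E1 E2 yn hy.
have C1f : 0 <= C1 * f by rewrite mulr_ge0 //; lra.
have y1 : 1 <= y by lra.
have y2 : 2 <= y by lra.
have hl' : l%:R <= C1 * y.
  by apply: le_trans hl _; rewrite ler_wpM2r //; [lra | have := ler_norm C; rewrite /C1; lra].
have yq2 : y * y <= y ^+ q.
  by rewrite -expr2; apply: ler_weXn2l => //; rewrite /q addn2.
have yqS : y * y ^+ q <= n%:R.
  rewrite -yn -exprS; apply: ler_weXn2l => //; rewrite -mulnn.
  by rewrite -[X in (X < _)%N]mul1n ltn_mul2r /q addn2.
have yq1 : 1 <= y ^+ q by exact: exprn_ege1.
have twoq : (2 ^ q)%N%:R <= y ^+ q by rewrite natrX lerXn2r ?nnegrE //; lra.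
have C1y : C1 * y <= y * y by rewrite ler_wpM2r //; lra.
have En : y ^+ q <= E%:R by rewrite -natr1 in E2; lra.
split.
- apply: (@leq_trans (2 ^ q)); first by rewrite ltnW // ltn_expl.
  by rewrite -(ler_nat R); apply: le_trans twoq En.
- rewrite -(ltr_nat R); apply: le_lt_trans hl' _; rewrite -natr1 in E2.
  suff : C1 * y < y * y by lra.
  by rewrite ltr_pM2r //; lra.
- rewrite -(ler_nat R); apply: le_trans twoq _; apply: le_trans yqS.
  by rewrite ler_peMl //; lra.
- rewrite -(ltr_nat R) natrD (natrD _ 1) natrM; apply: lt_le_trans yqS.
  have : 7 * C1 * y ^+ q < y * y ^+ q by rewrite ltr_pM2r; lra.
  have : C1 * y <= C1 * y ^+ q by rewrite ler_wpM2l //; [lra | nra].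
  have : y ^+ q <= C1 * y ^+ q by rewrite ler_peMl //; lra.
  by lra.
move=> b bl; have p1 : 1 <= 2 ^+ k :> R by apply: exprn_ege1; rewrite ler1n.
have pk : k%:R <= 2 ^+ k :> R by rewrite -natrX ler_nat ltnW // ltn_expl.
have pu : 2 ^+ k * 2 ^+ k <= y ^+ (2 * k).
  by rewrite mul2n -addnn exprD ler_pM ?exprn_ge0 // lerXn2r ?nnegrE //; lra.
have yqE : y ^+ q = y * y * y ^+ (2 * k) by rewrite /q exprD mulrC expr2.
have bE : (b <= E)%N.
  apply: leq_trans bl _; rewrite -(ler_nat R); apply: le_trans hl' _.
  by apply: le_trans C1y _; apply: le_trans yq2 En.
have EbR : (E - b)%N.+1%:R = E.+1%:R - b%:R :> R by rewrite -subSn // natrB // ltnW.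
have bR : b%:R <= l%:R :> R by rewrite ler_nat.
rewrite EbR natrD (natrD _ 1) !natrM; move: (2 ^+ k) p1 pk pu => p p1 pk pu.
have f2 : 4 * p / eps + 1 <= p * f.
  rewrite /f mulrDr mulr1 [4 * p]mulrC -mulrA; lra.
have s1 : 1 + 3 * l%:R + 2 * k%:R <= 6 * (C1 * y * p).
  have c1 : 1 <= C1 * y by nra.
  have c2 : C1 * y <= C1 * y * p by rewrite ler_peMr //; lra.
  have c3 : p <= C1 * y * p by rewrite ler_peMl //; lra.
  by lra.
have s2 : 2 * (1 + 3 * l%:R + 2 * k%:R) * (4 * p / eps + 1) <= 12 * C1 * f * (y * (p * p)).
  have -> : 12 * C1 * f * (y * (p * p)) = 2 * (6 * (C1 * y * p)) * (p * f) by ring.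
  apply: ler_pM; rewrite ?ler_wpM2l //.
  by rewrite addr_ge0 // divr_ge0 ?mulr_ge0 // ?(ltW eps0) //; lra.
have pp : 1 <= p * p by nra.
have s3 : C1 * y <= C1 * (y * (p * p)).
  by rewrite ler_wpM2l //; [lra | rewrite ler_peMr //; lra].
have s4 : (12 * C1 * f + C1) * (y * (p * p)) <= y * (y * (p * p)).
  by rewrite ler_wpM2r //; [rewrite !mulr_ge0 //; lra | lra].
have s5 : y * (y * (p * p)) <= y ^+ q by rewrite yqE mulrA ler_wpM2l // mulr_ge0 //; lra.
by rewrite mulrDl in s4; lra.
Qed.

(** * Programs *)

Section Runs.
Context {R : realType} {W : nat} {o : nat -> nat -> R}.
Implicit Types (p q : cmd) (s : state R) (Q : state R -> Prop).

(** Total correctness with a step bound. With the postcondition as a predicate on states, the rules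
    below act as symbolic execution. *)
Definition runs p s t Q := exists t' s', [/\ exec W o p s t' s', (t' <= t)%N & Q s'].

Fixpoint imods p : seq nat := match p with
  | Skip => [::] | SetI a _ _ => [:: a] | SetR _ _ _ => [::]
  | Seq p q => imods p ++ imods q | If _ p q => imods p ++ imods q
  | While _ p => imods p end.

Fixpoint rmods p : seq nat := match p with
  | Skip => [::] | SetI _ _ _ => [::] | SetR a _ _ => [:: a]
  | Seq p q => rmods p ++ rmods q | If _ p q => rmods p ++ rmods q
  | While _ p => rmods p end.

(** The frame condition: which arrays may change is read off the syntax, so facts about all the
    others are carried across a command for free. *)
Definition same p s s' :=
  (forall a, a \notin imods p -> iarr s' a = iarr s a) /\
  (forall a, a \notin rmods p -> rarr s' a = rarr s a).

Lemma update_other (T : Type) (m : nat -> nat -> T) a b i x : b != a -> update m a i x b = m b.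
Proof. by move=> /negbTE ba; apply: funext => j; rewrite /update ba. Qed.

Lemma exec_same p s t s' : exec W o p s t s' -> same p s s'.
Proof.
elim=> {p s t s'}.
- by [].
- by move=> s a i e _; split=> [b|//]; rewrite inE => ba /=; rewrite update_other.
- by move=> s a i e; split=> [//|b]; rewrite inE => ba /=; rewrite update_other.
- move=> p q s1 s2 s3 _ _ _ [h1 h2] _ [h3 h4].
  split=> a /=; rewrite mem_cat negb_or => /andP[ap aq].
    by rewrite h3 // h1.
  by rewrite h4 // h2.
- move=> b p q s1 s2 t _ [h1 h2].
  split=> a /=; rewrite mem_cat negb_or => /andP[ap aq].
    by rewrite h1 //; case: ifP.
  by rewrite h2 //; case: ifP.
- by [].
- move=> b p s1 s2 s3 _ _ _ _ [h1 h2] _ [h3 h4].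
  by split=> a ap; rewrite ?h3 ?h4 // ?h1 ?h2.
Qed.

Lemma runs_post p s t t' Q Q' : (t <= t')%N ->
  (forall s', Q s' -> same p s s' -> Q' s') -> runs p s t Q -> runs p s t' Q'.
Proof.
move=> tt' QQ' [u [s' [ex ut qs]]]; exists u, s'; split=> //.
  exact: leq_trans tt'.
by apply: QQ' => //; apply: exec_same ex.
Qed.

Lemma runs_time p s t t' Q : (t <= t')%N -> runs p s t Q -> runs p s t' Q.
Proof. by move=> tt'; apply: runs_post. Qed.

Lemma runs_skip s t Q : Q s -> runs Skip s t Q.
Proof. by move=> q; exists 0%N, s; split=> //; constructor. Qed.

Lemma runs_seti a i e s t Q : (ieval s e < W)%N ->
  Q (State (update (iarr s) a (ieval s i) (ieval s e)) (rarr s)) ->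
  runs (SetI a i e) s t.+1 Q.
Proof. by move=> eW q; exists 1%N; eexists; split; [constructor | |exact: q]. Qed.

Lemma runs_setr a i r s t Q :
  Q (State (iarr s) (update (rarr s) a (ieval s i) (reval o s r))) ->
  runs (SetR a i r) s t.+1 Q.
Proof. by move=> q; exists 1%N; eexists; split; [constructor | |exact: q]. Qed.

Lemma runs_seq p q s t1 t2 Q :
  runs p s t1 (fun s' => runs q s' t2 Q) -> runs (Seq p q) s (t1 + t2) Q.
Proof.
move=> [u1 [s1 [e1 l1 [u2 [s2 [e2 l2 qs]]]]]].
exists (u1 + u2)%N, s2; split=> //; last exact: leq_add.
exact: exec_Seq e1 e2.
Qed.

Lemma runs_seq_seti a i e q s t Q : (ieval s e < W)%N ->
  runs q (State (update (iarr s) a (ieval s i) (ieval s e)) (rarr s)) t Q ->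
  runs (Seq (SetI a i e) q) s t.+1 Q.
Proof. by move=> eW h; rewrite -add1n; apply: runs_seq; apply: runs_seti. Qed.

Lemma runs_seq_setr a i r q s t Q :
  runs q (State (iarr s) (update (rarr s) a (ieval s i) (reval o s r))) t Q ->
  runs (Seq (SetR a i r) q) s t.+1 Q.
Proof. by move=> h; rewrite -add1n; apply: runs_seq; apply: runs_setr. Qed.

Lemma runs_if b p q s t Q :
  (beval o s b -> runs p s t Q) -> (~~ beval o s b -> runs q s t Q) ->
  runs (If b p q) s t.+1 Q.
Proof.
move=> hp hq; have [u [s' [ex ut qs]]] : runs (if beval o s b then p else q) s t Q.
  by case: (boolP (beval o s b)).
by exists u.+1, s'; split=> //; constructor.
Qed.

(** The index of the invariant strictly decreases, so [N] bounds the number of iterations; the final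
    [1] pays for the failing test. *)
Lemma runs_while (I : nat -> state R -> Prop) b p s N tb : I N s ->
  (forall m s', I m s' -> same (While b p) s s' -> beval o s' b ->
     runs p s' tb (fun s'' => exists2 m', (m' < m)%N & I m' s'')) ->
  runs (While b p) s (N * tb.+1 + 1) (fun s' => (exists2 m, (m <= N)%N & I m s') /\ ~~ beval o s' b).
Proof.
move=> IN body; suff gen s1 : I N s1 -> same (While b p) s s1 ->
    runs (While b p) s1 (N * tb.+1 + 1) (fun s' => (exists2 m, (m <= N)%N & I m s') /\ ~~ beval o s' b).
  exact: gen.
elim/ltn_ind: N s1 {IN} => N IH s1 IN sm.
case: (boolP (beval o s1 b)) => [bs|nb]; last first.
  exists 1%N, s1; split; [by constructor | by rewrite addn1 | split=> //].
  by exists N.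
have [u [s2 [e2 u2 [m mN Im]]]] := body _ _ IN sm bs.
have sm2 : same (While b p) s s2.
  have [h1 h2] := exec_same e2; have [h3 h4] := sm.
  by split=> a ap; rewrite ?h1 ?h2 // ?h3 ?h4.
have [u' [s3 [e3 u3 [[m' m'm Im'] nb]]]] := IH m mN s2 Im sm2.
exists (u + u').+1, s3; split.
- exact: exec_WhileT e2 e3.
- by nia.
- by split=> //; exists m' => //; apply: leq_trans m'm (ltnW mN).
Qed.

Definition scalar a := IGet a (IConst 0).

Definition for_ v b p := Seq (SetI v (IConst 0) (IConst 0))
  (While (BNot (BLeI b (scalar v))) (Seq p (SetI v (IConst 0) (IAdd (scalar v) (IConst 1))))).

Definition set_scalar s v x := State (update (iarr s) v 0 x) (rarr s).

Lemma same_trans p s1 s2 s3 : same p s1 s2 -> same p s2 s3 -> same p s1 s3.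
Proof. by move=> [h1 h2] [h3 h4]; split=> a ap; rewrite ?h3 ?h4 // ?h1 ?h2. Qed.

Lemma same_for v b p s s1 s2 x : same (for_ v b p) s s1 -> same p s1 s2 ->
  same (for_ v b p) s (set_scalar s2 v x) /\ same (for_ v b p) s s2.
Proof.
move=> h [h1 h2].
have h12 : same (for_ v b p) s1 s2.
  split=> a /=; last by rewrite cats0; apply: h2.
  by rewrite inE mem_cat !negb_or => /and3P[_ ap _]; apply: h1.
have h3 := same_trans h h12; split=> //; apply: same_trans h3 _.
by split=> a //=; rewrite inE negb_or => /andP[av _]; rewrite update_other.
Qed.

(** Each iteration adds a test and an increment to its body; the other [2] is the initialisation and
    the failing test. The bound [b] is evaluated anew at each test, hence the hypothesis that its
    value stays [N]. *)
Lemma runs_for (I : nat -> state R -> Prop) v b p s N tb :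
  v \notin imods p -> (N < W)%N ->
  (forall s', same (for_ v b p) s s' -> ieval s' b = N) ->
  I 0%N (set_scalar s v 0) ->
  (forall j s', (j < N)%N -> same (for_ v b p) s s' -> iarr s' v 0 = j -> I j s' ->
     runs p s' tb (fun s'' => same (for_ v b p) s s'' -> I j.+1 (set_scalar s'' v j.+1))) ->
  runs (for_ v b p) s (N * (tb + 2) + 2) (fun s' => I N s').
Proof.
move=> vp NW hb I0 body.
pose J m s' := [/\ same (for_ v b p) s s', (m <= N)%N, iarr s' v 0 = (N - m)%N & I (N - m)%N s'].
rewrite addn2; apply: runs_seq_seti => /=; first exact: leq_ltn_trans NW.
rewrite -/(set_scalar s v 0).
have wh := @runs_while J (BNot (BLeI b (scalar v))) (Seq p (SetI v (IConst 0) (IAdd (scalar v) (IConst 1))))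
  (set_scalar s v 0) N (tb + 1).
apply: runs_post (wh _ _); first by rewrite !addn1 addn2.
- move=> s' [[m mN [sm _ vE Im]] /=]; rewrite negbK hb // vE => Nm _.
  by have -> : N = (N - m)%N by lia.
- split; rewrite ?subnn // /set_scalar /= ?/update ?eqxx //.
  by split=> a //=; rewrite inE negb_or => /andP[av _]; rewrite (negbTE av).
move=> m s' [sm mN vE Im] _ /=; rewrite hb // vE => mb.
apply: runs_seq; apply: runs_post (body _ _ _ sm vE Im) => //; last by lia.
move=> s2 I2 s12; have [sm2 sm3] := same_for (N - m).+1 sm s12.
have v2 : iarr s2 v 0 = (N - m)%N by rewrite -vE s12.1.
apply: runs_seti; rewrite /= v2 addn1; first by lia.
exists m.-1; first by lia.
rewrite -/(set_scalar s2 v (N - m).+1).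
have E : (N - m.-1 = (N - m).+1)%N by lia.
split; rewrite ?E //; [by lia | by rewrite /set_scalar /= /update !eqxx | exact: I2].
Qed.

End Runs.

(* Program notations and the counting of neighbours *)
Declare Scope prog_scope.
Delimit Scope prog_scope with P.
Notation "a .[ i ]" := (IGet a i) : prog_scope.
Notation "# m" := (IConst m) (at level 0, m at level 0, format "# m") : prog_scope.
Notation "$ a" := (IGet a (IConst 0)) (at level 0, a at level 0, format "$ a") : prog_scope.
Notation "x + y" := (IAdd x y) : prog_scope.
Notation "x - y" := (ISub x y) : prog_scope.
Notation "x * y" := (IMul x y) : prog_scope.
Notation "p ;; q" := (Seq p q) (at level 61, right associativity) : prog_scope.

Local Open Scope nat_scope.

Notation E1 := 1 (only parsing).
Notation E2 := 2 (only parsing).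
Notation DEG := 6 (only parsing).
Notation SUM := 7 (only parsing).
Notation ORD := 8 (only parsing).
Notation PAV := 9 (only parsing).
Notation POS := 10 (only parsing).
Notation I_ := 20 (only parsing).
Notation CUR := 21 (only parsing).
Notation VV := 22 (only parsing).
Notation CNT := 23 (only parsing).
Notation P_ := 24 (only parsing).
Notation nE := (IGet 0 (IConst 0)).

Definition init_edges : cmd := for_ I_ (nE - #1)%P (
  SetI DEG E1.[$I_] (DEG.[E1.[$I_]] + #1) ;;
  SetI SUM E1.[$I_] (SUM.[E1.[$I_]] + E2.[$I_]) ;;
  SetI DEG E2.[$I_] (DEG.[E2.[$I_]] + #1) ;;
  SetI SUM E2.[$I_] (SUM.[E2.[$I_]] + E1.[$I_]))%P.

Section Init.
Context {R : realType} {W : nat} {o : nat -> nat -> R} {n : nat}.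
Implicit Types (es : seq ('I_n * 'I_n)) (s : state R).

Definition dg es u := \sum_(p <- es) ((p.1 == u :> nat) + (p.2 == u :> nat)).
Definition sm es u := \sum_(p <- es) ((p.1 == u :> nat) * p.2 + (p.2 == u :> nat) * p.1).

Lemma dg_nil u : dg [::] u = 0.
Proof. exact: big_nil. Qed.

Lemma dg_cat es1 es2 u : dg (es1 ++ es2) u = dg es1 u + dg es2 u.
Proof. exact: big_cat. Qed.

Lemma sm_cat es1 es2 u : sm (es1 ++ es2) u = sm es1 u + sm es2 u.
Proof. exact: big_cat. Qed.

Lemma dg_seq1 p u : dg [:: p] u = (p.1 == u :> nat) + (p.2 == u :> nat).
Proof. exact: big_seq1. Qed.

Lemma sm_seq1 p u : sm [:: p] u = (p.1 == u :> nat) * p.2 + (p.2 == u :> nat) * p.1.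
Proof. exact: big_seq1. Qed.

Lemma dg_le es u : dg es u <= 2 * size es.
Proof.
rewrite /dg mulnC -sum1_size big_distrl /=; apply: leq_sum => p _.
by case: (_ == _); case: (_ == _).
Qed.

Lemma sm_le es u : sm es u <= 2 * n * size es.
Proof.
rewrite /sm -sum1_size big_distrr /=; apply: leq_sum => p _.
have := ltn_ord p.1; have := ltn_ord p.2.
by case: (_ == _); case: (_ == _); rewrite ?mul1n ?mul0n; lia.
Qed.

Hypothesis hW : (n + 2) ^ 6 <= W.
Hypothesis n_gt0 : 0 < n.

Lemma small_word x : x <= (n + 2) ^ 5 -> x < W.
Proof.
move=> xn; apply: leq_trans hW; apply: leq_ltn_trans xn _.
by rewrite ltn_exp2l // addn2.
Qed.

Lemma small2 x : x <= (n + 2) ^ 2 -> x < W.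
Proof. by move=> xn; apply: small_word; apply: leq_trans xn _; rewrite leq_exp2l // addn2. Qed.

Lemma small3 x : x <= (n + 2) ^ 3 -> x < W.
Proof. by move=> xn; apply: small_word; apply: leq_trans xn _; rewrite leq_exp2l // addn2. Qed.

Definition input_ok es s := iarr s 0 0 = n /\ (forall p i, i < size es ->
  iarr s 1 i = (nth p es i).1 /\ iarr s 2 i = (nth p es i).2).

Lemma run_init_edges es s : size es = n.-1 -> input_ok es s ->
  (forall u, iarr s DEG u = 0 /\ iarr s SUM u = 0) ->
  runs (W := W) (o := o) init_edges s (n * 6 + 2)
    (fun s' => forall u, iarr s' DEG u = dg es u /\ iarr s' SUM u = sm es u).
Proof.
move=> ses [sn sE] s0.
pose I j s' := forall u, iarr s' DEG u = dg (take j es) u /\ iarr s' SUM u = sm (take j es) u.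
have nN : n.-1 = size es by rewrite ses.
refine (runs_post (t := n.-1 * (4 + 2) + 2) _ _ (runs_for (I := I) _ _ _ _ _)) => //.
- by rewrite leq_add2r leq_mul2r leq_pred orbT.
- by move=> s' + _; rewrite /I nN take_size.
- by apply: small2; lia.
- by move=> s' [h1 _] /=; rewrite h1 // sn subn1.
- by move=> u; rewrite take0 /dg /sm !big_nil /=; apply: s0.
move=> j s' jn [sI _] vE Ij.
have js : j < size es by rewrite ses.
pose z0 := (Ordinal n_gt0, Ordinal n_gt0).
pose p := nth z0 es j.
have [e1 e2] := sE z0 j js; rewrite -/p in e1 e2.
have e1' : iarr s' 1 j = p.1 by rewrite sI // e1.
have e2' : iarr s' 2 j = p.2 by rewrite sI // e2.
have tk : take j.+1 es = rcons (take j es) p by rewrite (take_nth z0).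
have dB u : dg (take j es) u <= 2 * n.
  by apply: leq_trans (dg_le _ _) _; rewrite leq_mul2l size_take; case: ltnP => ?; lia.
have sB u : sm (take j es) u <= 2 * n * n.
  by apply: leq_trans (sm_le _ _) _; rewrite leq_mul2l size_take; case: ltnP => ?; lia.
have [p1 p2] := (ltn_ord p.1, ltn_ord p.2).
have nn : n <= n * n by rewrite leq_pmull.
apply: runs_seq_seti; rewrite /= vE e1' (Ij _).1.
  by apply: small2; have := dB p.1; lia.
apply: runs_seq_seti; rewrite /update /= vE e1' e2' (Ij _).2.
  by apply: small3; have := sB p.1; nia.
apply: runs_seq_seti; rewrite /update /= vE e2' !(Ij _).1.
  by apply: small2; case: ifP => _; [have := dB p.1 | have := dB p.2]; lia.
apply: runs_seti; rewrite /update /= vE e2' e1' !(Ij _).2.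
  by apply: small3; case: ifP => _; [have := sB p.1 | have := sB p.2]; nia.
move=> _ u; rewrite /set_scalar /update /= tk -!cats1 dg_cat sm_cat dg_seq1 sm_seq1.
rewrite !(Ij _).1 !(Ij _).2 ![u == _]eq_sym [(p.2 : nat) == p.1]eq_sym.
have [u1|u1] := eqVneq (p.1 : nat) u; have [u2|u2] := eqVneq (p.2 : nat) u; rewrite ?u1 ?u2 ?eqxx /=.
all: rewrite ?(negbTE u1) ?(negbTE u2) ?[u == _]eq_sym ?(negbTE u1) ?(negbTE u2).
all: by split; lia.
Qed.

End Init.

(** * Laying out the tree *)

(* [SUM] holds the sum of the remaining neighbours of a vertex, which is the only
   neighbour [P_] of a leaf.  Positions are assigned downwards from [n - 1]; the
   parent is stored at position [0] each time since the last one is the root. *)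
Definition peel_step : cmd := (
  SetI P_ #0 (SUM.[$CUR]) ;;
  SetI ORD $CNT $CUR ;;
  SetI ORD #0 $P_ ;;
  SetI PAV $CNT $P_ ;;
  SetI POS $CUR $CNT ;;
  SetI DEG $CUR #0 ;;
  SetI DEG $P_ (DEG.[$P_] - #1) ;;
  SetI SUM $P_ (SUM.[$P_] - $CUR) ;;
  SetI CNT #0 ($CNT - #1) ;;
  SetI CUR #0 $P_)%P.

(* Each removed leaf is followed by its neighbour if that became a leaf: this
   gives consecutive positions to the vertices of a chain. *)
Definition peel : cmd := (
  SetI CUR #0 #0 ;;
  SetI VV #0 #0 ;;
  SetI CNT #0 (nE - #1) ;;
  While (BNot (BLeI nE $VV))
    (If (BEqI (DEG.[$CUR]) #1) peel_step
       (SetI VV #0 ($VV + #1) ;; SetI CUR #0 $VV)))%P.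

Section Peel.
Context {n : nat}.
Context {e : rel 'I_n} {es : seq ('I_n * 'I_n)}.
Implicit Types (L : seq ('I_n * 'I_n)) (U : {set 'I_n}) (x y u : 'I_n).
Hypothesis n_gt0 : 0 < n.
Hypothesis e_sym : symmetric e.
Hypothesis e_irr : irreflexive e.
Hypothesis e_conn : forall x y, connect e x y.
Hypothesis hes : edge_list e es.

Lemma dg0 L x : dg L x = 0 -> forall p, p \in L -> p.1 != x /\ p.2 != x.
Proof.
elim: L => // q L IH; rewrite -cat1s dg_cat dg_seq1 => /eqP.
rewrite !addn_eq0 !eqb0 => /andP[/andP[q1 q2] /eqP h] p.
by rewrite inE => /predU1P[->|/(IH h)]; rewrite // -!val_eqE.
Qed.

Lemma sm0 L x : dg L x = 0 -> sm L x = 0.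
Proof.
move=> h; rewrite /sm big_seq big1 // => p /(dg0 h)[].
by rewrite -!val_eqE => /negbTE-> /negbTE->.
Qed.

Lemma dg1 L x : dg L x = 1 -> exists L1 L2 p y, [/\ L = L1 ++ p :: L2,
  p = (x, y) \/ p = (y, x), y != x, sm L x = y & dg L1 x = 0 /\ dg L2 x = 0].
Proof.
elim: L => [|q L IH]; first by rewrite dg_nil.
rewrite -cat1s dg_cat dg_seq1 sm_cat sm_seq1 !val_eqE.
have [q1|q1] := eqVneq q.1 x; have [q2|q2] := eqVneq q.2 x => //=.
- move=> /eqP; rewrite eqSS => /eqP h.
  exists [::], L, q, q.2; split=> //; rewrite ?dg_nil //; last by rewrite sm0 // !mul1n mul0n !addn0.
  by left; rewrite -q1; case: (q).
- move=> /eqP; rewrite eqSS => /eqP h.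
  exists [::], L, q, q.1; split=> //; rewrite ?dg_nil //; last by rewrite sm0 // !mul1n mul0n !addn0.
  by right; rewrite -q2; case: (q).
- rewrite add0n => /IH [L1 [L2 [p [y [-> pE yx -> [h1 h2]]]]]].
  exists (q :: L1), L2, p, y; split=> //; split=> //.
  by rewrite -cat1s dg_cat dg_seq1 h1 !val_eqE (negbTE q1) (negbTE q2).
Qed.

Definition inside U := [seq p <- es | (p.1 \in U) && (p.2 \in U)].

Lemma inside_gt0 U (u : nat) : 0 < dg (inside U) u -> exists2 z : 'I_n, z \in U & z = u :> nat.
Proof.
move=> h; have [/hasP[p]|/hasPn h0] := boolP (has (fun p : 'I_n * 'I_n => (p.1 == u :> nat) || (p.2 == u :> nat)) (inside U)).
  by rewrite mem_filter => /andP[/andP[p1 p2] _] /orP[] /eqP; [exists p.1 | exists p.2].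
move: h; rewrite /dg big_seq big1 // => p /h0.
by case: (_ == _) => //=; case: (_ == _).
Qed.

(** The list of remaining edges has a single entry at [x], and removing [x] deletes that entry only;
    so the two counters change only at [x] and at its neighbour. *)
Lemma inside_peel U x : dg (inside U) x = 1 -> exists y,
  [/\ x \in U, y \in U, y != x, e x y & sm (inside U) x = y] /\
  [/\ (size (inside U)) = (size (inside (U :\ x))).+1,
      forall u : nat, dg (inside (U :\ x)) u = dg (inside U) u - (u == x) - (u == y),
      forall u : nat, u != x -> sm (inside (U :\ x)) u = sm (inside U) u - (u == y) * x
    & forall z, e x z -> z \in U -> z = y].
Proof.
move=> h1; have [L1 [L2 [p [y [LE pE yx sy [h10 h20]]]]]] := dg1 h1.
have pin : p \in inside U by rewrite LE mem_cat inE eqxx orbT.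
have pes : p \in es by move: pin; rewrite mem_filter => /andP[].
have epq q : q \in es -> e q.1 q.2.
  by move=> qes; rewrite hes.2; case: (q) qes => a b ->.
have LE' : inside (U :\ x) = L1 ++ L2.
  have -> : inside (U :\ x) = [seq q <- inside U | (q.1 != x) && (q.2 != x)].
    rewrite -filter_predI; apply: eq_filter => q /=; rewrite !inE.
    by case: (q.1 != x) => //=; case: (q.2 != x); rewrite ?andbF.
  rewrite LE filter_cat /=.
  have fl L : dg L x = 0 -> [seq q <- L | (q.1 != x) && (q.2 != x)] = L.
    by move=> /dg0 h; apply/all_filterP/allP => q /h[-> ->].
  by rewrite !fl //; case: pE => -> /=; rewrite eqxx ?andbF.
have [xU yU] : x \in U /\ y \in U.
  by move: pin; rewrite mem_filter => /andP[/andP[]]; case: pE => -> /=.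
have exy : e x y by have := epq p pes; case: pE => -> //=; rewrite e_sym.
exists y; split; first by split.
split.
- by rewrite LE' LE !size_cat /= addnS.
- move=> u; rewrite LE' LE -cat1s !dg_cat dg_seq1.
  by case: pE => -> /=; rewrite ![nat_of_ord _ == u]eq_sym; lia.
- move=> u ux; rewrite LE' LE -cat1s !sm_cat sm_seq1.
  case: pE => -> /=; rewrite ![nat_of_ord _ == u]eq_sym (negbTE ux) /= ?mul0n ?add0n ?addn0.
    by case: (u == y); rewrite ?mul1n ?mul0n; lia.
  by case: (u == y); rewrite ?mul1n ?mul0n; lia.
move=> z exz zU; have : ((x, z) \in es) || ((z, x) \in es) by rewrite -hes.2.
have key q : q \in es -> q.1 \in U -> q.2 \in U -> (q.1 == x) || (q.2 == x) -> q = p.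
  move=> qes q1 q2 qx; have : q \in inside U by rewrite mem_filter q1 q2.
  rewrite LE mem_cat inE => /or3P[/(dg0 h10)|/eqP//|/(dg0 h20)] [n1 n2];
  by rewrite (negbTE n1) (negbTE n2) in qx.
case/orP => /key /= /(_ _ _ _); rewrite ?xU ?zU ?eqxx ?orbT => /(_ isT isT isT) E.
  by case: pE => E'; rewrite E' in E; case: E => // <- ->.
by case: pE => E'; rewrite E' in E; case: E => // -> <-.
Qed.

(** [U] is the set of vertices not yet removed, and [v] the position of the scan. By [pi_leaf],
    [pi_done] and [pi_cur], only [cur] can be a leaf that was not one originally, and then it was
    exposed by the vertex placed last; this yields [pi_brk], the source of [to_break]. In [pi_rho],
    the retraction [rho] sends each removed vertex to the vertex of [U] at which it hangs; it stands
    for the connectedness of what remains. *)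
Record peel_inv U (cur v cnt : nat) (deg sum ord pav pos : nat -> nat) : Prop := PeelInv {
  pi_card : #|U| = cnt.+1;
  pi_size : size (inside U) = cnt;
  pi_deg : forall u : nat, deg u = dg (inside U) u;
  pi_sum : forall u, u \in U -> sum u = sm (inside U) u;
  pi_ord : forall i, cnt < i < n -> exists x y,
    [/\ ord i = x, pav i = y, x \notin U, e x y & pos x = i /\ pos y < i];
  pi_in : forall x, x \in U -> pos x = 0;
  pi_out : forall x, x \notin U -> cnt < pos x < n /\ ord (pos x) = x;
  pi_edge : forall x y, e x y -> (x \in U /\ y \in U) \/ exists i, cnt < i < n /\
    (ord i = x /\ pav i = y \/ ord i = y /\ pav i = x);
  pi_rho : exists rho : 'I_n -> 'I_n, (forall x, x \in U -> rho x = x) /\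
    forall x y, e x y -> (x \in U /\ y \in U) \/ rho x = rho y;
  pi_leaf : forall u, u \in U -> u <> cur :> nat -> deg u = 1 -> dg es u = 1;
  pi_done : forall u, u \in U -> u <= v -> u <> cur :> nat -> deg u <> 1;
  pi_cur : deg cur = 1 -> (cnt.+1 < n /\ pav cnt.+1 = cur) \/ dg es cur = 1;
  pi_brk : forall i, cnt < i < n -> (i.+1 < n /\ pav i.+1 = ord i) \/ dg es (ord i) = 1;
  pi_root : if cnt.+1 == n then ord 0 = 0 else ord 0 = pav cnt.+1 /\ exists2 r, r \in U & ord 0 = r }.

Lemma peel_inv0 : peel_inv [set: 'I_n] 0 0 n.-1 (dg es) (sm es) (fun=> 0) (fun=> 0) (fun=> 0).
Proof.
have ins : inside [set: 'I_n] = es.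
  by apply/all_filterP/allP => p _; rewrite !inE.
split=> //; rewrite ?ins //.
- by rewrite cardsT card_ord prednK.
- by rewrite hes.1.
- by move=> i; rewrite prednK //; lia.
- by move=> x; rewrite inE.
- by move=> x y _; left; rewrite !inE.
- by exists id; split=> // x y _; left; rewrite !inE.
- by move=> u _; lia.
- by right.
- by move=> i; rewrite prednK //; lia.
- by rewrite prednK // eqxx.
Qed.

Lemma peel_inv_next U cur v cnt deg sum ord pav pos :
  peel_inv U cur v cnt deg sum ord pav pos -> deg cur <> 1 ->
  peel_inv U v.+1 v.+1 cnt deg sum ord pav pos.
Proof.
move=> [] i1 i2 i3 i4 i5 i6 i7 i8 i9 i10 i11 i12 i13 i14 dc.
have nc (u : nat) : deg u = 1 -> u <> cur :> nat by move=> du uc; apply: dc; rewrite -uc.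
split=> //.
- by move=> u uU _ du; apply: i10 => //; apply: nc.
- move=> u uU uv uv' du; apply: (i11 u uU _ (nc _ du) du); lia.
- move=> dv; right; have [z zU zE] : exists2 z : 'I_n, z \in U & z = v.+1 :> nat.
    by apply: inside_gt0; rewrite -(i3 v.+1) dv.
  rewrite -zE; apply: i10 => //; last by rewrite zE.
  by apply: nc; rewrite zE.
Qed.

Lemma peel_inv_step U (x : 'I_n) v cnt deg sum ord pav pos :
  peel_inv U x v cnt deg sum ord pav pos -> deg x = 1 -> exists y : 'I_n,
  [/\ sum x = y, y != x, 0 < cnt < n, deg y <= 2 * n /\ sum y <= 2 * n * n
    & peel_inv (U :\ x) y v cnt.-1
      (fun i => if i == y then deg y - 1 else if i == x then 0 else deg i)
      (fun i => if i == y then sum y - x else sum i)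
      (fun i => if i == 0 then nat_of_ord y else if i == cnt then nat_of_ord x else ord i)
      (fun i => if i == cnt then nat_of_ord y else pav i)
      (fun i => if i == x then cnt else pos i)].
Proof.
move=> [] i1 i2 i3 i4 i5 i6 i7 i8 i9 i10 i11 i12 i13 i14 dx.
have [y [[xU yU yx exy sxy] [szI dgI smI nbx]]] := inside_peel (etrans (esym (i3 x)) dx).
have cnt0 : 0 < cnt by rewrite -i2 szI.
have cntn : cnt < n by rewrite -i1 -[n in _ <= n]card_ord; apply: max_card.
have cU : #|U :\ x| = cnt by have := cardsD1 x U; rewrite i1 xU add1n => -[].
have yU' : y \in U :\ x by rewrite !inE yx.
have yxn : (y == x :> nat) = false by rewrite val_eqE (negbTE yx).
have inU u : u \in U :\ x -> u \in U /\ (u == x :> nat) = false.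
  by rewrite !inE val_eqE => /andP[/negbTE-> ->].
exists y; split=> //.
- by rewrite i4.
- by rewrite cnt0.
- split; first by rewrite i3 (leq_trans (dg_le _ _)) // leq_mul2l /= i2 ltnW.
  by rewrite i4 // (leq_trans (sm_le _ _)) // leq_mul2l i2 ltnW ?orbT.
have nz i : cnt.-1 < i -> (i == 0) = false by case: i.
split.
- by rewrite cU prednK.
- by apply/eqP; rewrite -eqSS -szI i2 prednK.
- move=> u; rewrite dgI !i3; case: eqVneq => [->|uy]; first by rewrite yxn subn0.
  by case: eqVneq => [->|ux]; rewrite !subn0 // -i3 dx.
- move=> u /inU[uU ux]; rewrite smI ?ux // -i4 //.
  by case: eqVneq => [<-|uy]; rewrite ?mul1n // mul0n subn0.
- move=> i /andP[ci im]; rewrite nz //; case: eqVneq => [iE|ic].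
    exists x, y; rewrite eqxx !inE eqxx yxn /= i6 //; split=> //.
    by split=> //; rewrite iE.
  have [a [b [oa pb aU eab [pa pb']]]] := i5 i ltac:(lia).
  have ax : (a == x :> nat) = false by rewrite val_eqE; apply: contraNF aU => /eqP->.
  exists a, b; rewrite !inE (negbTE aU) andbF ax; split=> //; split=> //.
  by case: eqVneq => // _; lia.
- by move=> u /inU[uU ->]; apply: i6.
- move=> u; rewrite !inE negb_and negbK => uU.
  have [->|ux] := eqVneq u x; first by rewrite eqxx nz ?eqxx; lia.
  rewrite (negbTE ux) /= in uU; rewrite val_eqE (negbTE ux).
  have [/andP[p1 p2] p3] := i7 u uU; rewrite nz; last by lia.
  by have -> : (pos u == cnt) = false by [lia]; split=> //; lia.
- move=> a b eab; case: (i8 a b eab) => [[aU bU]|[i [ic h]]].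
    have [ax|ax] := eqVneq a x.
      right; exists cnt; rewrite nz ?eqxx; last by lia.
      by split; [lia | left; rewrite ax; split=> //; rewrite (nbx b) // -ax].
    have [bx|bx] := eqVneq b x.
      right; exists cnt; rewrite nz ?eqxx; last by lia.
      by split; [lia | right; rewrite bx; split=> //; rewrite (nbx a) // e_sym -bx].
    by left; rewrite !inE ax bx.
  right; exists i; rewrite nz; last by lia.
  by have -> : (i == cnt) = false by [lia]; split=> //; lia.
(* Everything that hung at [x] now hangs at [y]. *)
- have [rho [rU re]] := i9; exists (fun z => if rho z == x then y else rho z); split.
    by move=> z /inU[zU zx]; rewrite rU // -val_eqE zx.
  move=> a b eab; case: (re a b eab) => [[aU bU]|->]; last by right.
  have [ax|ax] := eqVneq a x.
    right; rewrite !rU // ax eqxx (nbx b) //; last by rewrite -ax.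
    by rewrite (negbTE yx).
  have [bx|bx] := eqVneq b x.
    right; rewrite !rU // bx eqxx (nbx a) //; last by rewrite e_sym -bx.
    by rewrite (negbTE yx).
  by left; rewrite !inE ax bx.
- move=> u /inU[uU ux] uy; rewrite (introF eqP uy) ux; apply: i10 => //.
  by apply/eqP; rewrite ux.
- move=> u /inU[uU ux] uv uy; rewrite (introF eqP uy) ux; apply: i11 => //.
  by apply/eqP; rewrite ux.
- by move=> _; left; rewrite prednK // eqxx.
- move=> i ib; rewrite nz; last by lia.
  have -> : (i.+1 == cnt) = false by lia.
  case: eqVneq => [->|ic]; last by apply: i13; lia.
  exact: i12.
- rewrite prednK //; case: eqVneq => [|_]; first by lia.
  by rewrite !eqxx; split=> //; exists y.
Qed.

(** No remaining vertex has degree 1, and the remaining edges are one fewer than the vertices, so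
    some [u] has degree 0. By connectedness [rho] is then constantly [u], hence [U] is [[set u]]. *)
Lemma peel_inv_done U cur cnt deg sum ord pav pos :
  peel_inv U cur n cnt deg sum ord pav pos -> n <= cur ->
  cnt = 0 /\ exists r, U = [set r] /\ ord 0 = r.
Proof.
move=> [] i1 i2 i3 i4 i5 i6 i7 i8 i9 i10 i11 i12 i13 i14 nc.
have d1 u : u \in U -> deg u <> 1.
  by move=> uU; apply: (i11 u uU); have := ltn_ord u; lia.
have [u uU du] : exists2 u, u \in U & deg u = 0.
  apply: contrapT => h.
  have d2 u : u \in U -> 2 <= deg u.
    move=> uU; have := d1 u uU; case E : (deg u) => [|[|m]] // _.
    by case: h; exists u.
  have : (\sum_(u in U) deg u <= 2 * cnt).
    rewrite -i2; under eq_bigr do rewrite i3.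
    rewrite exchange_big /= mulnC -sum1_size big_distrl /=.
    have le1 (a : 'I_n) : \sum_(u in U) (a == u :> nat) <= 1.
      have [aU|aU] := boolP (a \in U); last first.
        rewrite big1 // => w wU; rewrite val_eqE.
        by case: eqP => // aw; rewrite aw wU in aU.
      rewrite (bigD1 a) //= eqxx big1 // => w /andP[_ wa].
      by rewrite val_eqE eq_sym (negbTE wa).
    by apply: leq_sum => p _; rewrite big_split /=; apply: (leq_add (le1 _) (le1 _)).
  have : (\sum_(u in U) 2 <= \sum_(u in U) deg u) by apply: leq_sum => u /d2.
  by rewrite sum_nat_const i1; lia.
have [rho [rU re]] := i9.
have nbr w : e u w -> w \in U -> False.
  move=> euw wU; have : ((u, w) \in es) || ((w, u) \in es) by rewrite -hes.2.
  have d0 := dg0 (etrans (esym (i3 u)) du).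
  by case/orP=> h; have := d0 _ _; [have := d0 (u, w) | have := d0 (w, u)];
     rewrite mem_filter /= uU wU h => /(_ isT)[]; rewrite eqxx.
have all_u w : rho w = u.
  have /connectP[p] := e_conn u w; elim/last_ind: p w => [|p z IH] w; first by move=> _ ->; apply: rU.
  rewrite rcons_path last_rcons => /andP[pp ez] ->.
  have ru : rho (last u p) = u by apply: IH.
  case: (re _ _ ez) => [[lU zU]|<- //].
  by case: (nbr z); rewrite // -[u in e u z]ru rU.
have UE : U = [set u].
  by apply/setP => w; rewrite !inE; apply/idP/eqP => [wU|-> //]; rewrite -(all_u w) rU.
have c0 : cnt = 0 by move: i1; rewrite UE cards1 => -[].
split=> //; exists u; split=> //; move: i14; rewrite c0; case: eqP => [n1 ->|_ [_ [r]]].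
  by have := ltn_ord u; lia.
by rewrite UE inE => /eqP-> .
Qed.

End Peel.

Section RunPeel.
Context {R : realType} {W : nat} {o : nat -> nat -> R} {n : nat}.
Context {e : rel 'I_n} {es : seq ('I_n * 'I_n)}.
Implicit Types (s : state R) (U : {set 'I_n}).
Hypothesis hW : (n + 2) ^ 6 <= W.
Hypothesis n_gt0 : 0 < n.
Hypothesis e_sym : symmetric e.
Hypothesis e_irr : irreflexive e.
Hypothesis e_conn : forall x y, connect e x y.
Hypothesis hes : edge_list e es.

Lemma degree_dg (x : 'I_n) : dg es x = 1 -> degree e x = 1.
Proof.
move=> /dg1[L1 [L2 [p [y [LE pE yx _ [h1 h2]]]]]].
have ey z : e x z -> z = y.
  move=> exz; have : ((x, z) \in es) || ((z, x) \in es) by rewrite -hes.2.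
  rewrite LE !mem_cat !inE.
  have no L q : dg L x = 0 -> q \in L -> (q.1 == x) || (q.2 == x) -> False.
    by move=> /dg0 h /h[/negbTE-> /negbTE->].
  have pz q : q = p -> q = (x, z) \/ q = (z, x) -> z = y.
    by move=> -> [] qE; case: pE; rewrite qE => -[] // -> ->.
  case/orP=> /or3P[/(no _ _ h1)|/eqP/pz|/(no _ _ h2)] /=; rewrite ?eqxx ?orbT.
  - by move=> /(_ isT).
  - by apply; left.
  - by move=> /(_ isT).
  - by move=> /(_ isT).
  - by apply; right.
  - by move=> /(_ isT).
rewrite /degree (_ : [set v | e x v] = [set y]) ?cards1 //.
apply/setP => z; rewrite !inE; apply/idP/eqP => [/ey//|->].
have pes : p \in es by rewrite LE mem_cat inE eqxx orbT.
by rewrite hes.2; case: pE pes => -> ->; rewrite ?orbT.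
Qed.

(** The last vertex [r] never receives a position: it stands at 0 because [POS] was 0 initially and
    [ord 0] was last set to it. *)
Lemma peel_tree_order (r : 'I_n) cur v deg sum ord pav pos :
  peel_inv (e := e) (es := es) [set r] cur v 0 deg sum ord pav pos -> ord 0 = r ->
  let vx i := insubd (Ordinal n_gt0) (ord i) in
  [/\ tree_order e vx (fun x => pos x) (fun i => pos (pav i)),
      forall i, i < n -> ord i = vx i &
      forall i, 0 < i < n -> pav i = vx (pos (pav i))].
Proof.
move=> [] i1 i2 i3 i4 i5 i6 i7 i8 i9 i10 i11 i12 i13 i14 or vx.
have oE (x : 'I_n) i : ord i = x -> vx i = x.
  by move=> oi; apply: val_inj; rewrite /vx oi val_insubd ltn_ord.
have out (x : 'I_n) : ord (pos x) = x.
  have [xr|xr] := eqVneq x r; first by rewrite xr i6 ?inE.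
  by case: (i7 x); rewrite ?inE.
have posn (x : 'I_n) : pos x < n.
  have [xr|xr] := eqVneq x r; first by rewrite xr i6 ?inE.
  by case: (i7 x); rewrite ?inE // => /andP[].
have pas i : 0 < i < n -> exists x y : 'I_n,
    [/\ ord i = x, vx i = x, pav i = y, vx (pos y) = y & e x y /\ pos x = i /\ pos y < i].
  move=> /i5[x [y [ox py _ exy [px py']]]]; exists x, y; split=> //; first exact: oE.
  exact/oE/out.
have vin i : i < n -> exists2 x : 'I_n, ord i = x & pos x = i.
  case: (posnP i) => [->|i0] ilt; first by exists r; rewrite // i6 ?inE.
  by have [x [y [ox _ _ _ [_ [px _]]]]] := pas i ltac:(lia); exists x.
split.
- split.
  + exact: posn.
  + by move=> x; apply/oE/out.
  + by move=> i /vin[x ox px]; rewrite (oE x).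
  + by move=> i /pas[x [y [ox vxx py vy [exy [px pyi]]]]]; rewrite vxx py vy.
  + move=> i j /vin[x ox px] /vin[y oy py]; rewrite (oE x) // (oE y) // => exy.
    case: (i8 _ _ exy) => [[]|[l [lb h]]].
      by rewrite !inE => /eqP xr /eqP yr; rewrite xr yr e_irr in exy.
    have [a [b [ol _ pl _ [_ [pa pb]]]]] := pas l lb.
    case: h => -[h1 h2].
      have ax : a = x by apply: val_inj; rewrite /= -ol.
      have li : l = i by rewrite -pa ax px.
      by apply/orP; left; rewrite -li h2 py eqxx; lia.
    have ay : a = y by apply: val_inj; rewrite /= -ol.
    have lj : l = j by rewrite -pa ay py.
    by apply/orP; right; rewrite -lj h2 px eqxx; lia.
  + move=> i ib hb; have [x [y [ox vxx _ _ [_ [px _]]]]] := pas i ib.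
    rewrite vxx; apply: degree_dg; rewrite -ox; case: (i13 i ib) => // -[il pil].
    by case: hb => [|]; [lia | rewrite pil ox px].
- by move=> i /vin[x ox _]; rewrite ox (oE x).
- by move=> i /pas[x [y [_ _ py vy _]]]; rewrite py vy.
Qed.

Lemma run_peel s : iarr s 0 0 = n ->
  (forall u, iarr s DEG u = dg es u /\ iarr s SUM u = sm es u) ->
  (forall i, [/\ iarr s ORD i = 0, iarr s PAV i = 0 & iarr s POS i = 0]) ->
  runs (W := W) (o := o) peel s (n * 24 + 4) (fun s' => exists vx ps pa,
    [/\ tree_order e vx ps pa, forall i, i < n -> iarr s' ORD i = vx i,
        forall i, 0 < i < n -> iarr s' PAV i = vx (pa i) &
        forall x : 'I_n, iarr s' POS x = ps x]).
Proof.
move=> sn sd s0.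
(* Each iteration advances the scan or removes a vertex. Once the scan is over, [cur] lies outside
   the range, so that [pi_done] covers every vertex of [U]. *)
pose I m s' := m = n - iarr s' VV 0 + iarr s' CNT 0 /\
  (n <= iarr s' VV 0 -> n <= iarr s' CUR 0) /\ iarr s' VV 0 <= n /\
  exists U, peel_inv (e := e) (es := es) U (iarr s' CUR 0) (iarr s' VV 0) (iarr s' CNT 0)
   (iarr s' DEG) (iarr s' SUM) (iarr s' ORD) (iarr s' PAV) (iarr s' POS).
have W1 : 1 < W by apply: small2 hW _ _; nia.
apply: (runs_time (t := (((n + n.-1) * 12 + 1).+3))); first by lia.
apply: runs_seq_seti; rewrite /update /=; first by lia.
apply: runs_seq_seti; rewrite /update /=; first by lia.
apply: runs_seq_seti; rewrite /update /= sn; first by apply: small2 hW _ _; nia.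
refine (runs_post (leqnn _) _ (runs_while (I := I) (tb := 11) _ _)).
- move=> s' [[m _ [mE [vn [vle [U inv]]]]] /= stop] sm'.
  have s'n : iarr s' 0 0 = n by rewrite sm'.1 //= sn.
  rewrite negbK s'n in stop.
  have vE : iarr s' VV 0 = n by apply/eqP; rewrite eqn_leq stop andbT.
  rewrite vE in inv; have [c0 [r [UE or]]] := peel_inv_done n_gt0 e_conn hes inv (vn stop).
  rewrite c0 UE in inv; have [to h1 h2] := peel_tree_order inv or.
  by do 3 eexists; split; [exact: to | exact: h1 | exact: h2 | ].
- split; first by rewrite /= subn0 subn1.
  split; first by move=> /=; lia.
  split=> //.
  exists [set: 'I_n] => /=; rewrite subn1.
  have -> : iarr s DEG = dg es by apply: funext => u; case: (sd u).
  have -> : iarr s SUM = sm es by apply: funext => u; case: (sd u).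
  have -> : iarr s ORD = fun=> 0 by apply: funext => u; case: (s0 u).
  have -> : iarr s PAV = fun=> 0 by apply: funext => u; case: (s0 u).
  have -> : iarr s POS = fun=> 0 by apply: funext => u; case: (s0 u).
  exact: peel_inv0.
move=> m s' [mE [_ [vn [U inv]]]] sm' /=.
have s'n : iarr s' 0 0 = n by rewrite sm'.1 //= sn.
rewrite s'n -ltnNge => vlt.
set cur := iarr s' CUR 0 in inv *; set v := iarr s' VV 0 in inv vlt mE vn *; set cnt := iarr s' CNT 0 in inv mE *.
apply: runs_if => /= [/eqP dc|/eqP dc]; last first.
  apply: runs_seq_seti; rewrite /update /= -/v addn1; first by apply: small2 hW _ _; nia.
  apply: runs_seti; rewrite /update /=; first by apply: small2 hW _ _; nia.
  exists (n - v.+1 + cnt); first by lia.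
  split=> //; split=> //; split=> //; exists U => /=.
  exact: peel_inv_next inv dc.
have [x _ xE] : exists2 x : 'I_n, x \in U & x = cur :> nat.
  by apply: (@inside_gt0 _ es); rewrite -(pi_deg inv) dc.
rewrite -/cur -xE in dc; rewrite -xE in inv.
have [y [sy yx cb [dy sumy] inv']] := peel_inv_step n_gt0 e_sym hes inv dc.
have yxn : (y == x :> nat) = false by rewrite val_eqE (negbTE yx).
have [xl yl] := (ltn_ord x, ltn_ord y).
have small i : i <= n * n -> i < W by move=> h; apply: small2 hW _ _; nia.
rewrite /peel_step.
apply: runs_seq_seti; rewrite /update /= -/cur -?xE -?/cnt ?sy; first by apply: small; nia.
apply: runs_seq_seti; rewrite /update /= -/cur -?xE -?/cnt ?sy; first by apply: small; nia.
apply: runs_seq_seti; rewrite /update /= -/cur -?xE -?/cnt ?sy; first by apply: small; nia.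
apply: runs_seq_seti; rewrite /update /= -/cur -?xE -?/cnt ?sy; first by apply: small; nia.
apply: runs_seq_seti; rewrite /update /= -/cur -?xE -?/cnt ?sy; first by apply: small; nia.
apply: runs_seq_seti; rewrite /update /= -/cur -?xE -?/cnt ?sy; first by apply: small; nia.
apply: runs_seq_seti; rewrite /update /= -/cur -?xE -?/cnt ?sy ?yxn; first by apply: small2 hW _ _; nia.
apply: runs_seq_seti; rewrite /update /= -/cur -?xE -?/cnt ?sy ?yxn.
  by apply: small3 hW _ _; nia.
apply: runs_seq_seti; rewrite /update /= -/cur -?xE -?/cnt ?sy ?yxn; first by apply: small; nia.
apply: runs_seti; rewrite /update /= -/cur -?xE -?/cnt ?sy ?yxn; first by apply: small; nia.
exists (n - v + cnt.-1); first by lia.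
split; first by rewrite /= subn1.
split; first by move=> /=; lia.
by split=> //; exists (U :\ x); rewrite /= subn1.
Qed.

End RunPeel.

(** * Parents, depths and marks *)

Notation PAR := 11 (only parsing).
Notation CH := 12 (only parsing).
Notation MK := 13 (only parsing).
Notation AA := 14 (only parsing).
Notation MC := 25 (only parsing).
Notation AC := 26 (only parsing).
Notation Q_ := 34 (only parsing).

(* Real arrays, which are numbered separately from the word arrays. *)
Notation DEP := 0 (only parsing).
Notation MU := 1 (only parsing).

(** The root serves as the first center, so the labels [MU] start as the depths. *)
Definition parents : cmd := for_ I_ (nE - #1)%P (
  SetI Q_ #0 ($I_ + #1) ;;
  SetI PAR $Q_ (POS.[PAV.[$Q_]]) ;;
  SetI CH PAR.[$Q_] (CH.[PAR.[$Q_]] + #1) ;;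
  SetR DEP $Q_ (RAdd (RGet DEP PAR.[$Q_]) (RCost ORD.[$Q_] PAV.[$Q_])) ;;
  SetR MU $Q_ (RGet DEP $Q_))%P.

(* Below the threshold [n0] every vertex is taken, so that the reduced instance
   is the given one. *)
Definition mark (n0 : nat) : cmd := for_ I_ nE (
  If (BNot (BAnd (BLeI #n0 nE) (BAnd (BLeI #1 $I_) (BAnd (BEqI (PAR.[$I_] + #1) $I_) (BEqI CH.[$I_] #1)))))
    (SetI MK $MC $I_ ;; SetI MC #0 ($MC + #1)) Skip ;;
  If (BNot (BAnd (BLeI #n0 nE) (BNot (BLeI #3 (CH.[$I_] + (#1 - (#1 - $I_)))))))
    (SetI AA $AC $I_ ;; SetI AC #0 ($AC + #1)) Skip)%P.

Section Parents.
Context {R : realType} {W : nat} {n : nat} {c : 'I_n -> 'I_n -> R}.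
Context {e : rel 'I_n} {vx : nat -> 'I_n} {ps : 'I_n -> nat} {pa : nat -> nat}.
Implicit Types (s : state R).
Hypothesis hW : (n + 2) ^ 6 <= W.
Hypothesis n_gt0 : 0 < n.
Hypothesis to : tree_order e vx ps pa.
Hypothesis e_sym : symmetric e.
Hypothesis e_irr : irreflexive e.
Local Notation o := (cost_oracle c).

Lemma cost_oracleE (x y : 'I_n) : o x y = if x != y then c x y else 0%R.
Proof. by rewrite /cost_oracle !valK. Qed.

Lemma children_nat i : children (n := n) (pa := pa) i = \sum_(1 <= l < n) (pa l == i).
Proof.
rewrite /children -(big_mkord xpredT (fun l => ((0 < l) && (pa l == i)) : nat)) big_ltn //= add0n.
by rewrite !big_nat; apply: eq_bigr => l /andP[-> _].
Qed.

Lemma run_parents s : iarr s 0 0 = n ->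
  (forall i, i < n -> iarr s ORD i = vx i) ->
  (forall i, 0 < i < n -> iarr s PAV i = vx (pa i)) ->
  (forall x : 'I_n, iarr s POS x = ps x) ->
  (forall i, [/\ iarr s PAR i = 0, iarr s CH i = 0, rarr s DEP i = 0%R & rarr s MU i = 0%R]) ->
  runs (W := W) (o := o) parents s (n * 7 + 2) (fun s' =>
    [/\ iarr s' PAR 0 = 0, forall i, 0 < i < n -> iarr s' PAR i = pa i,
        forall i, i < n -> iarr s' CH i = children (n := n) (pa := pa) i,
        is_depth c vx pa (rarr s' DEP) & forall i, i < n -> rarr s' MU i = rarr s' DEP i]).
Proof.
move=> sn sO sP sQ s0.
pose I j s' := [/\ iarr s' PAR 0 = 0, forall i, 0 < i <= j -> iarr s' PAR i = pa i,
    forall i, iarr s' CH i = \sum_(1 <= l < j.+1) (pa l == i),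
    (rarr s' DEP 0 = 0%R /\ forall i, 0 < i <= j -> rarr s' DEP i = (rarr s' DEP (pa i) + c (vx i) (vx (pa i)))%R)
    & forall i, i <= j -> rarr s' MU i = rarr s' DEP i].
refine (runs_post (t := n.-1 * (5 + 2) + 2) _ _ (runs_for (I := I) _ _ _ _ _)) => //.
- by rewrite leq_add2r leq_mul2r leq_pred orbT.
- move=> s' [i1 i2 i3 [i4 i4'] i5] _; split=> //.
  + by move=> i ib; apply: i2; lia.
  + by move=> i ilt; rewrite i3 prednK // children_nat.
  + by split=> // i ib; apply: i4'; lia.
  + by move=> i ilt; apply: i5; lia.
- by apply: (small2 hW); nia.
- by move=> s' [h1 _] /=; rewrite h1 // sn subn1.
- split=> /=.
  + by case: (s0 0).
  + by move=> i; lia.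
  + by move=> i; rewrite big_geq //; case: (s0 i).
  + by split; [case: (s0 0) | move=> i; lia].
  + by move=> i _; case: (s0 i) => _ _ -> ->.
move=> j s' jn [sI _] vE [i1 i2 i3 [i4 i4'] i5].
have jb : 0 < j.+1 < n by lia.
have [plt epj] := to_pa to jb.
have pn : pa j.+1 < n by lia.
have s1 : iarr s' 9 j.+1 = vx (pa j.+1) by rewrite sI // sP.
have s2 : iarr s' 10 (vx (pa j.+1)) = pa j.+1 by rewrite sI // sQ (to_psK to).
have s3 : iarr s' 8 j.+1 = vx j.+1 by rewrite sI // sO //; lia.
have ne : vx j.+1 != vx (pa j.+1) by apply: contraTneq epj => <-; rewrite e_irr.
have chB i : iarr s' 12 i <= j.
  rewrite i3 (@leq_trans (\sum_(1 <= l < j.+1) 1)) //; last by rewrite sum_nat_const_nat; lia.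
  by apply: leq_sum => l _; apply: leq_b1.
apply: runs_seq_seti; rewrite /= vE addn1; first by apply: (small2 hW); nia.
apply: runs_seq_seti; rewrite /update /= s1 s2; first by apply: (small2 hW); nia.
apply: runs_seq_seti; rewrite /update /= eqxx /=; first by apply: (small2 hW); have := chB (pa j.+1); nia.
apply: runs_seq_setr; rewrite /update /= eqxx s3 s1 cost_oracleE ne.
apply: runs_setr; rewrite /update /= eqxx /set_scalar /update /= => _; split=> /=.
- by [].
- move=> i /andP[i0 ij]; case: eqVneq => [->//|ne']; apply: i2; lia.
- move=> i; rewrite big_nat_recr //= -i3; by case: eqVneq => [->|ni]; rewrite ?addn0.
- split=> // i /andP[i0 ij].
  have [iE|ni] := eqVneq i j.+1.
    by rewrite iE ifF //; lia.
  by have -> : (pa i == j.+1) = false; [have := (to_pa to (i := i)) ltac:(lia); lia | apply: i4'; lia].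
- by move=> i ij; case: eqVneq => [//|ni]; apply: i5; lia.
Qed.

Definition arr_list (f : nat -> nat) (l : seq nat) := forall t, t < size l -> f t = nth 0 l t.

Lemma arr_list_rcons f l x : arr_list f l ->
  arr_list (fun t => if t == size l then x else f t) (rcons l x).
Proof.
move=> fl t; rewrite size_rcons ltnS nth_rcons; case: ltngtP => //= tl _.
exact: fl.
Qed.

Definition marked n0 i := (n < n0) || ~~ inner (e := e) (vx := vx) (pa := pa) i.
Definition chosen n0 i := (n < n0) || (3 <= degree e (vx i)).

Lemma run_mark n0 s : iarr s 0 0 = n -> iarr s MC 0 = 0 -> iarr s AC 0 = 0 ->
  (forall i, 0 < i < n -> iarr s PAR i = pa i) ->
  (forall i, i < n -> iarr s CH i = children (n := n) (pa := pa) i) ->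
  let lm := [seq i <- iota 0 n | marked n0 i] in let la := [seq i <- iota 0 n | chosen n0 i] in
  runs (W := W) (o := o) (mark n0) s (n * 8 + 2) (fun s' =>
    [/\ iarr s' MC 0 = size lm, arr_list (iarr s' MK) lm,
        iarr s' AC 0 = size la & arr_list (iarr s' AA) la]).
Proof.
move=> sn sm sa sP sC lm la.
pose I j s' := [/\ iarr s' MC 0 = size ([seq i <- iota 0 j | marked n0 i]),
  arr_list (iarr s' MK) ([seq i <- iota 0 j | marked n0 i]),
  iarr s' AC 0 = size ([seq i <- iota 0 j | chosen n0 i]) &
  arr_list (iarr s' AA) ([seq i <- iota 0 j | chosen n0 i])].
refine (runs_post (t := n * (6 + 2) + 2) _ _ (runs_for (I := I) _ _ _ _ _)) => //.
- by apply: (small2 hW); nia.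
- by move=> s' [h1 _] /=; rewrite h1 // sn.
move=> j s' jn [sI _] vE [i1 i2 i3 i4].
have s1 : iarr s' 0 0 = n by rewrite sI.
have s2 : 0 < j -> iarr s' 11 j = pa j by move=> j0; rewrite sI // sP // j0.
have s3 : iarr s' 12 j = children (n := n) (pa := pa) j by rewrite sI // sC.
have deg : degree e (vx j) = (0 < j) + children (n := n) (pa := pa) j by rewrite (degreeE to).
have szl a : size ([seq i <- iota 0 j | a i]) <= j by rewrite size_filter (leq_trans (count_size _ _)) ?size_iota.
have small i : i <= j.+1 -> i < W by move=> h; apply: (small2 hW); nia.
have iS a : [seq i <- iota 0 j.+1 | a i] = if a j then rcons ([seq i <- iota 0 j | a i]) j else [seq i <- iota 0 j | a i].
  by rewrite -addn1 iotaD add0n filter_cat /=; case: (a j); rewrite ?cats0 ?cats1.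
have condm : ~~ [&& n0 <= n, 0 < j, iarr s' 11 j + 1 == j & iarr s' 12 j == 1] = marked n0 j.
  rewrite /marked /inner [n < n0]ltnNge negb_and s3 deg; case: (n0 <= n) => //=.
  case: (posnP j) => //= j0.
  by rewrite s2 // add1n eqSS; congr (~~ (_ && _)); lia.
(* In truncated subtraction [1 - (1 - j)] is 1 for [0 < j] and 0 otherwise: the share of the parent
   in the degree. *)
have condc : ~~ ((n0 <= n) && ~~ (2 < iarr s' 12 j + (1 - (1 - j)))) = chosen n0 j.
  rewrite /chosen [n < n0]ltnNge negb_and negbK s3 deg; congr (_ || (_ < _)).
  by rewrite addnC; congr (_ + _); case: (j) => [|[]].
apply: (runs_seq (t1 := 3) (t2 := 3)).
apply: (@runs_post _ _ _ _ _ 3 3 (fun s2 => iarr s2 25 0 = size [seq i <- iota 0 j.+1 | marked n0 i] /\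
  arr_list (iarr s2 13) [seq i <- iota 0 j.+1 | marked n0 i])) => //; last first.
  rewrite iS; apply: runs_if; rewrite /= s1 vE condm => mj; rewrite ?(negbTE mj) ?mj.
    apply: runs_seq_seti; rewrite /update /= ?vE; first exact: small.
    apply: runs_seti; rewrite /update /= i1; first by apply: small; rewrite addn1 ltnS.
    by rewrite size_rcons addn1; split=> //; apply: arr_list_rcons.
  exact: runs_skip.
move=> s4 [m1 m2] [sm4 _].
have [q1 q2 q3 q4] : [/\ iarr s4 0 0 = n, iarr s4 20 0 = j, iarr s4 12 = iarr s' 12 & iarr s4 26 0 = iarr s' 26 0].
  by rewrite !sm4.
have q5 : iarr s4 14 = iarr s' 14 by rewrite sm4.
apply: runs_if; rewrite /= q1 q2 q3 condc => mj.
  apply: runs_seq_seti; rewrite /update /= ?q2; first exact: small.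
  apply: runs_seti; rewrite /update /= q4 i3; first by apply: small; rewrite addn1 ltnS.
  move=> _; rewrite /I !(iS (chosen n0)) mj; split; rewrite /set_scalar /update //= ?size_rcons ?addn1 //.
  by rewrite q5; apply: arr_list_rcons.
apply: runs_skip => _; rewrite /I !(iS (chosen n0)) (negbTE mj).
by split; rewrite /set_scalar /update //= ?q5 ?q4.
Qed.

End Parents.

(** * Gonzalez' algorithm *)

Notation C_ := 33 (only parsing).
Notation J_ := 32 (only parsing).

Definition set_parent : cmd := (
  SetI Q_ #0 MK.[$J_] ;;
  If (BEqI (PAR.[$Q_] + #1) $Q_) (SetI C_ #0 MK.[$J_ - #1]) (SetI C_ #0 PAR.[$Q_]))%P.

Definition relax_up_code (X : nat) : cmd :=
  let via := RSub (RAdd (RGet X $Q_%P) (RGet DEP $Q_%P)) (RGet DEP $C_%P) in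
  Seq set_parent (If (BLeR via (RGet X $C_%P)) (SetR X $C_%P via) Skip).

Definition relax_down_code (X : nat) : cmd :=
  let via := RSub (RAdd (RGet X $C_%P) (RGet DEP $Q_%P)) (RGet DEP $C_%P) in
  Seq set_parent (If (BLeR via (RGet X $Q_%P)) (SetR X $Q_%P via) Skip).

(* In a tree, one sweep towards the root and one away from it suffice. *)
Definition relax (X : nat) : cmd := (
  for_ I_ ($MC - #1) (SetI J_ #0 ($MC - #1 - $I_) ;; relax_up_code X) ;;
  for_ I_ ($MC - #1) (SetI J_ #0 ($I_ + #1) ;; relax_down_code X))%P.

Section RunRelax.
Context {R : realType} {W n : nat} {e : rel 'I_n} {c : 'I_n -> 'I_n -> R} {o : nat -> nat -> R}.
Context {vx : nat -> 'I_n} {ps : 'I_n -> nat} {pa : nat -> nat} {dp : nat -> R}.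
Implicit Types (s : state R).
Hypothesis hW : (n + 2) ^ 6 <= W.
Hypothesis n_gt0 : 0 < n.
Hypothesis inst : doat_instance e c.
Hypothesis to : tree_order e vx ps pa.
Hypothesis hdp : is_depth c vx pa dp.
Hypothesis pa0 : pa 0 = 0.
Local Notation runs := (runs (W := W) (o := o)).
Local Notation marks := (marks (e := e) (vx := vx) (pa := pa)).

Lemma run_set_parent s mk M j : iarr s PAR = pa -> iarr s MK = mk -> marks mk M ->
  0 < j < M -> iarr s J_ 0 = j ->
  runs set_parent s 3 (fun s' => iarr s' Q_ 0 = mk j /\ iarr s' C_ 0 = mparent (pa := pa) mk j).
Proof.
move=> sP sM mP jb sj.
have nW : n < W by apply: (small2 hW); nia.
have mn i : i < M -> mk i < W by move=> iM; apply: ltn_trans nW; exact: (mk_lt mP).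
apply: runs_seq_seti; rewrite /= sM sj; first by apply: mn; lia.
apply: runs_if; rewrite /update /= sP addn1 => h.
  apply: runs_seti; rewrite /update /= sM sj subn1; first by apply: mn; lia.
  by split=> //=; rewrite /mparent h.
have [_ _ _ [j' j'M jE] _] := mparent_cases inst to hdp pa0 n_gt0 mP jb.
have cE : mparent (pa := pa) mk j = pa (mk j) by rewrite /mparent (negbTE h).
apply: runs_seti; rewrite /update /= sP; first by rewrite -cE -jE; apply: mn.
by rewrite cE.
Qed.

(** The last conclusion bounds the result from below: no relaxation step pushes a label under a
    relaxed function [L] that was below all labels before. It is applied to the true distances and
    to 0. *)
Lemma run_relax X s mk M : X != 0 -> iarr s PAR = pa -> iarr s MK = mk -> marks mk M ->
  rarr s DEP = dp -> iarr s MC 0 = M -> M < W ->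
  runs (relax X) s (M * 16 + 4) (fun s' => [/\ relaxed (dp := dp) (pa := pa) mk M (rarr s' X),
    forall i, (rarr s' X i <= rarr s X i)%R &
    forall L : nat -> R,
      (forall j, 0 < j < M -> (L (mparent (pa := pa) mk j) <= L (mk j) + mweight (dp := dp) (pa := pa) mk j)%R /\
         (L (mk j) <= L (mparent (pa := pa) mk j) + mweight (dp := dp) (pa := pa) mk j)%R) ->
      (forall j, j < M -> (L (mk j) <= rarr s X (mk j))%R) ->
      forall j, j < M -> (L (mk j) <= rarr s' X (mk j))%R]).
Proof.
move=> X0 sP sM mP sD sC MW.
have M0 := mk_gt0 mP.
have X0' : (0 == X) = false by rewrite eq_sym (negbTE X0).
pose w := mweight (dp := dp) (pa := pa) mk; pose cp := mparent (pa := pa) mk.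
pose good (Y : nat -> R) := (forall i, (Y i <= rarr s X i)%R) /\
  forall L : nat -> R, (forall j, 0 < j < M -> (L (cp j) <= L (mk j) + w j)%R /\ (L (mk j) <= L (cp j) + w j)%R) ->
  (forall j, j < M -> (L (mk j) <= rarr s X (mk j))%R) -> forall j, j < M -> (L (mk j) <= Y (mk j))%R.
have min_if (a b : R) : (if (a <= b)%R then a else b) = Num.min b a.
  by rewrite minElt; case: ltgtP => // ->.
have up s' j : 0 < j < M -> iarr s' PAR = pa -> iarr s' MK = mk -> rarr s' DEP = dp -> iarr s' J_ 0 = j ->
    runs (relax_up_code X) s' 5 (fun s'' => forall i, rarr s'' X i =
      if i == cp j then Num.min (rarr s' X i) (rarr s' X (mk j) + w j)%R else rarr s' X i).
  move=> jb sP' sM' sD' sj'.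
  apply: (runs_seq (t1 := 3) (t2 := 2)).
  apply: runs_post (run_set_parent sP' sM' mP jb sj') => // s2 [sQ sCc] [sm1 sm2].
  have sX : rarr s2 X = rarr s' X by rewrite sm2.
  have sD2 : rarr s2 0 = dp by rewrite sm2.
  apply: runs_if; rewrite /= sQ sCc sX sD2 => h.
    apply: runs_setr; rewrite /update /= sQ sCc sX sD2 eqxx /= => i.
    case: eqVneq => [->|//]; rewrite /cp -min_if /w /mweight addrA h //.
  apply: runs_skip => i; rewrite sX; case: eqVneq => [->|//].
  by rewrite /cp -min_if /w /mweight addrA (negbTE h).
have down s' j : 0 < j < M -> iarr s' PAR = pa -> iarr s' MK = mk -> rarr s' DEP = dp -> iarr s' J_ 0 = j ->
    runs (relax_down_code X) s' 5 (fun s'' => forall i, rarr s'' X i =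
      if i == mk j then Num.min (rarr s' X i) (rarr s' X (cp j) + w j)%R else rarr s' X i).
  move=> jb sP' sM' sD' sj'.
  apply: (runs_seq (t1 := 3) (t2 := 2)).
  apply: runs_post (run_set_parent sP' sM' mP jb sj') => // s2 [sQ sCc] [sm1 sm2].
  have sX : rarr s2 X = rarr s' X by rewrite sm2.
  have sD2 : rarr s2 0 = dp by rewrite sm2.
  apply: runs_if; rewrite /= sQ sCc sX sD2 => h.
    apply: runs_setr; rewrite /update /= sQ sCc sX sD2 eqxx /= => i.
    case: eqVneq => [->|//]; rewrite /cp -min_if /w /mweight addrA h //.
  apply: runs_skip => i; rewrite sX; case: eqVneq => [->|//].
  by rewrite /cp -min_if /w /mweight addrA (negbTE h).
have goodU (Y Y' : nat -> R) j : 0 < j < M -> good Y ->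
    (forall i, Y' i = if i == cp j then Num.min (Y i) (Y (mk j) + w j)%R else Y i) -> good Y'.
  move=> jb [g1 g2] hY; split=> [i|L hL Ls j' j'M].
    by rewrite hY; apply: le_trans (g1 i); case: ifP => // _; apply: ge_min_l.
  rewrite hY; case: eqP => [E|_]; last exact: g2.
  rewrite le_min g2 //= E; have [h _] := hL j jb; apply: le_trans h _.
  by rewrite lerD2r g2 //; lia.
have goodD (Y Y' : nat -> R) j : 0 < j < M -> good Y ->
    (forall i, Y' i = if i == mk j then Num.min (Y i) (Y (cp j) + w j)%R else Y i) -> good Y'.
  move=> jb [g1 g2] hY; split=> [i|L hL Ls j' j'M].
    by rewrite hY; apply: le_trans (g1 i); case: ifP => // _; apply: ge_min_l.
  rewrite hY; case: eqP => [E|_]; last exact: g2.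
  rewrite le_min g2 //= E; have [_ h] := hL j jb; apply: le_trans h _.
  have [_ _ _ [k kM kE] _] := mparent_cases inst to hdp pa0 n_gt0 mP jb.
  by rewrite lerD2r -/cp in kE *; rewrite -kE g2.
pose I1 j s' := good (rarr s' X) /\ forall j', M - j <= j' < M -> 0 < j' ->
  (rarr s' X (cp j') <= rarr s' X (mk j') + w j')%R.
pose I2 j s' := [/\ good (rarr s' X),
  forall j', 0 < j' < M -> (rarr s' X (cp j') <= rarr s' X (mk j') + w j')%R &
  forall j', 0 < j' <= j -> (rarr s' X (mk j') <= rarr s' X (cp j') + w j')%R].
apply: (runs_time (t := (M.-1 * (6 + 2) + 2) + (M.-1 * (6 + 2) + 2))); first by lia.
apply: runs_seq.
refine (runs_post (leqnn _) _ (runs_for (I := I1) (N := M.-1) _ _ _ _ _)) => //; last first.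
- move=> j s' jM [sm1 sm2] vE [g h].
  apply: runs_seq_seti; rewrite /= sm1 // sC vE subn1; first by lia.
  have jb : 0 < M.-1 - j < M by lia.
  have [E1 E2] : iarr s' PAR = pa /\ iarr s' MK = mk by rewrite !sm1.
  have E3 : rarr s' DEP = dp by rewrite sm2 // inE /= X0'.
  refine (runs_post (leqnn _) _ (up _ (M.-1 - j) jb _ _ _ _)); [|exact: E1|exact: E2|exact: E3|by []].
  move=> s2 hY _ _.
  split; first exact: goodU _ _ _ jb g hY.
  by move=> j' jb' j0'; apply: (relax_up inst to hdp pa0 n_gt0 mP jb hY); [move=> k kb; apply: h; lia | lia].
- split=> /=; last by move=> j'; lia.
  by split.
- by move=> s' [sm1 _] /=; rewrite sm1 // sC subn1.
- exact: leq_ltn_trans (leq_pred _) MW.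
move=> s1 [g1 h1] [sm1 sm2].
refine (runs_post (leqnn _) _ (runs_for (I := I2) (N := M.-1) _ _ _ _ _)) => //; last first.
- move=> j s' jM [sm1' sm2'] vE [g hu hd].
  apply: runs_seq_seti; rewrite /= vE addn1; first by lia.
  have jb : 0 < j.+1 < M by lia.
  have [E1 E2] : iarr s' PAR = pa /\ iarr s' MK = mk by rewrite !sm1' // !sm1.
  have E3 : rarr s' DEP = dp by rewrite sm2' ?sm2 // inE /= X0'.
  refine (runs_post (leqnn _) _ (down _ j.+1 jb _ _ _ _)); [|exact: E1|exact: E2|exact: E3|by []].
  move=> s2 hY _ _.
  have [r1 r2] := relax_down inst to hdp pa0 n_gt0 mP jb hY hu (fun j' jb' => hd j' ltac:(lia)).
  by split=> //=; exact: goodD _ _ _ jb g hY.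
- split=> //=; last by move=> j'; lia.
  by move=> j' jb'; apply: h1; lia.
- by move=> s' [sm1' _] /=; rewrite sm1' // sm1 // sC subn1.
- exact: leq_ltn_trans (leq_pred _) MW.
move=> s2 [[g1' g2'] hu hd] _; split=> //.
by apply/relaxedP => j jb; split; [apply: hu | apply: hd; lia].
Qed.

End RunRelax.

(** * Search for a farthest vertex *)

Notation LO := 28 (only parsing).
Notation HI := 29 (only parsing).
Notation MID := 30 (only parsing).
Notation BP := 31 (only parsing).
Notation BV := 10 (only parsing).
Notation TMP := 13 (only parsing).

Definition from_left (i : iexp) : rexp :=
  (RSub (RAdd (RGet MU MK.[$I_]) (RGet DEP i)) (RGet DEP MK.[$I_]))%P.
Definition from_right (i : iexp) : rexp :=
  (RSub (RAdd (RGet MU MK.[$I_ + #1]) (RGet DEP MK.[$I_ + #1])) (RGet DEP i))%P.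

(* Along a chain [from_left] increases and [from_right] decreases, and the
   distance to the centers is their minimum: its maximum is at their crossing. *)
Definition search : cmd := (
  SetI LO #0 MK.[$I_] ;;
  SetI HI #0 MK.[$I_ + #1] ;;
  While (BNot (BLeI $HI ($LO + #1))) (
    SetI MID #0 (IDiv ($LO + $HI) #2) ;;
    If (BLeR (from_left $MID) (from_right $MID)) (SetI LO #0 $MID) (SetI HI #0 $MID)))%P.

Definition improve (p : iexp) (v : rexp) : cmd := (
  SetR TMP #0 v ;;
  If (BLeR (RGet TMP #0) (RGet BV #0)) Skip (SetR BV #0 (RGet TMP #0) ;; SetI BP #0 p))%P.

Definition argmax : cmd := (
  SetR BV #0 (RGet MU #0) ;;
  SetI BP #0 #0 ;;
  for_ I_ ($MC - #1) (
    search ;; improve $LO (from_left $LO) ;; improve $HI (from_right $HI)))%P.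

Section RunArgmax.
Context {R : realType} {W n : nat} {e : rel 'I_n} {c : 'I_n -> 'I_n -> R} {o : nat -> nat -> R}.
Context {vx : nat -> 'I_n} {ps : 'I_n -> nat} {pa : nat -> nat} {dp : nat -> R}.
Implicit Types (s : state R).
Hypothesis hW : (n + 2) ^ 6 <= W.
Hypothesis n_gt0 : 0 < n.
Hypothesis inst : doat_instance e c.
Hypothesis to : tree_order e vx ps pa.
Hypothesis hdp : is_depth c vx pa dp.
Local Notation runs := (runs (W := W) (o := o)).
Local Notation marks := (marks (e := e) (vx := vx) (pa := pa)).
Context {mk : nat -> nat} {M : nat} {X f : nat -> R}.
Hypothesis mP : marks mk M.
Hypothesis rX : relaxed (dp := dp) (pa := pa) mk M X.
Hypothesis fmk : forall j, j < M -> f (mk j) = X (mk j).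
Hypothesis fin : forall j i, j.+1 < M -> mk j < i < mk j.+1 -> f i = segment_min (dp := dp) (mk := mk) X j i.

Lemma segment_min_between j : j.+1 < M -> (mk j).+1 < mk j.+1 ->
  chain (pa := pa) (mk j) (mk j.+1) /\
  forall i, mk j <= i <= mk j.+1 -> f i = segment_min (dp := dp) (mk := mk) X j i.
Proof.
move=> jM jj; have jj' : mk j < mk j.+1 by exact: ltn_trans jj.
have [ch] := relaxed_chain to mP n_gt0 rX jM jj' (or_introl jj).
rewrite ler_norml => /andP[Xc1 Xc2]; split=> // i /andP[].
rewrite leq_eqVlt => /predU1P[<-|ji].
  rewrite (fmk (ltnW jM)) /segment_min subrr addr0 => _.
  by apply/esym/min_idPl; lra.
rewrite leq_eqVlt => /predU1P[->|ij]; last by apply: fin => //; rewrite ji.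
by rewrite (fmk jM) /segment_min subrr addr0; apply/esym/min_idPr; lra.
Qed.

Definition found j lo hi := [/\ mk j <= lo <= mk j.+1, mk j <= hi <= mk j.+1,
  f lo = (X (mk j) + (dp lo - dp (mk j)))%R, f hi = (X (mk j.+1) + (dp (mk j.+1) - dp hi))%R &
  forall i, mk j <= i <= mk j.+1 -> (f i <= f lo)%R \/ (f i <= f hi)%R].

(** Bisection keeps [F <= G] at [LO] and [G <= F] at [HI]. When the two are neighbours, [f]
    increases up to [LO] and decreases from [HI] on, in the weak sense. *)
Lemma run_search s j L : n <= 2 ^ L -> iarr s MK = mk -> rarr s MU = X -> rarr s DEP = dp ->
  j.+1 < M -> iarr s I_ 0 = j ->
  runs search s (L * 4 + 3) (fun s' => found j (iarr s' LO 0) (iarr s' HI 0)).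
Proof.
move=> nL sM sX sD jM sj.
have nW : n < W by apply: (small2 hW); nia.
have mn i : i < M -> mk i < n by move=> iM; exact: (mk_lt mP).
have [pn qn] := (mn _ (ltnW jM), mn _ jM).
rewrite addn3.
apply: runs_seq_seti; rewrite /= sM sj; first exact: ltn_trans nW.
apply: runs_seq_seti; rewrite /update /= sM sj addn1; first exact: ltn_trans nW.
set s1 := State _ _.
have pq := mk_step mP jM.
(* Equal or neighbouring marks need not lie on a common chain, but then no position lies strictly
   between them and the loop does not start. *)
have [small|big] := leqP (mk j.+1) (mk j).+1.
  pose I (m : nat) s' := iarr s' LO 0 = mk j /\ iarr s' HI 0 = mk j.+1.
  refine (runs_post _ _ (runs_while (I := I) (N := 0) (tb := 0) _ _)) => //.
  - have [fp fq] := (fmk (ltnW jM), fmk jM).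
    move=> s' [[m _ [-> ->]] _] _; split; rewrite ?leqnn ?pq ?fp ?fq ?subrr ?addr0 // => i ib.
    by have [->|->] : i = mk j \/ i = mk j.+1 by [lia]; [left; rewrite fp | right; rewrite fq].
  - by move=> m s' [l h] _ /=; rewrite l h addn1 small.
have [ch fs] := segment_min_between jM big.
have mono a b : mk j <= a -> a <= b -> b <= mk j.+1 -> (dp a <= dp b)%R.
  by move=> ja ab bj; have [] := chain_depth inst to hdp qn ch ja ab bj.
pose F i := (X (mk j) + (dp i - dp (mk j)))%R.
pose G i := (X (mk j.+1) + (dp (mk j.+1) - dp i))%R.
have fE i : mk j <= i <= mk j.+1 -> f i = Num.min (F i) (G i) by apply: fs.
pose I m s' := [/\ mk j <= iarr s' LO 0, iarr s' LO 0 < iarr s' HI 0, iarr s' HI 0 <= mk j.+1,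
   iarr s' HI 0 - iarr s' LO 0 <= 2 ^ m &
   (F (iarr s' LO 0) <= G (iarr s' LO 0) /\ G (iarr s' HI 0) <= F (iarr s' HI 0))%R].
refine (runs_post _ _ (runs_while (I := I) (N := L) (tb := 3) _ _)) => //.
- by lia.
- move=> s' [[m _ [l1 l2 l3 _ [l4 l5]]] /= stop] _.
  rewrite negbK addn1 in stop.
  have hiE : iarr s' HI 0 = (iarr s' LO 0).+1 by lia.
  set lo := iarr s' LO 0 in l1 l2 l4 hiE *; rewrite hiE in l2 l3 l5 *.
  have flo : f lo = F lo by rewrite fE; [apply/min_idPl | lia].
  have fhi : f lo.+1 = G lo.+1 by rewrite fE; [apply/min_idPr | lia].
  split=> //; [by lia | by lia |].
  move=> i /andP[pi iq]; have [il|li] := leqP i lo; [left|right].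
    rewrite flo fE ?pi //; apply: le_trans (ge_min_l _ _) _.
    by rewrite /F; have := mono i lo pi il ltac:(lia); lra.
  rewrite fhi fE ?pi //; apply: le_trans (ge_min_r _ _) _.
  by rewrite /G; have := mono lo.+1 i ltac:(lia) li iq; lra.
- have := relaxed_chain to mP n_gt0 rX jM (ltnW big) (or_introl big).
  rewrite ler_norml => -[_ /andP[Xc1 Xc2]].
  split=> /=; [by [] | exact: ltnW | by [] | | ].
    by apply: leq_trans nL; apply: leq_trans (leq_subr _ _) (ltnW qn).
  by rewrite /F /G !subrr !addr0; split; lra.
move=> m s' [l1 l2 l3 l4 [l5 l6]] [sm1 sm2] /= stop.
rewrite addn1 -ltnNge in stop.
have [q1 q2 q3 q4] : [/\ iarr s' MK = mk, iarr s' I_ 0 = j, rarr s' MU = X & rarr s' DEP = dp].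
  by rewrite !sm1 // !sm2.
set lo := iarr s' LO 0 in l1 l2 l4 l5 stop *; set hi := iarr s' HI 0 in l2 l3 l4 l6 stop *.
set mid := (lo + hi) %/ 2.
have [m1 m2] : lo < mid /\ mid < hi by rewrite /mid; split; lia.
have m0 : 0 < m by case: (m) l4 => //; rewrite expn0; lia.
have m2m : 2 ^ m = 2 * 2 ^ m.-1 by rewrite -expnS prednK.
apply: runs_seq_seti; rewrite /= -/lo -/hi -/mid; first by lia.
apply: runs_if; rewrite /update /= q1 q2 q3 q4 addn1 -!addrA => FG.
  apply: runs_seti; rewrite /update /=; first by lia.
  exists m.-1; first by lia.
  by split=> //=; rewrite -?/hi; [lia | rewrite /mid; lia].
apply: runs_seti; rewrite /update /=; first by lia.
exists m.-1; first by lia.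
split=> //=; rewrite -?/lo; [lia | rewrite /mid; lia | ].
by split=> //; rewrite ltW // ltNge.
Qed.

Lemma run_improve s p v (g : nat -> R) t x : t < W -> g (iarr s BP 0) = rarr s BV 0 ->
  ieval s p = t -> reval o s v = x -> g t = x -> p = scalar LO \/ p = scalar HI ->
  runs (improve p v) s 4 (fun s' => [/\ g (iarr s' BP 0) = rarr s' BV 0,
    iarr s' BP 0 = iarr s BP 0 \/ iarr s' BP 0 = t,
    (rarr s BV 0 <= rarr s' BV 0)%R & (x <= rarr s' BV 0)%R]).
Proof.
move=> tW gE pE vE gt pp.
apply: runs_seq_setr; rewrite /= vE; apply: runs_if; rewrite /update /= => h.
  by apply: runs_skip; split=> //; left.
have h' : (rarr s BV 0 <= x)%R by rewrite ltW // ltNge.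
apply: runs_seq_setr; rewrite /update /=.
apply: runs_seti; rewrite /update /=.
  by case: pp pE => -> /= ->.
by case: pp pE => -> /= ->; split=> //; right.
Qed.

Lemma run_argmax s L : n <= 2 ^ L -> iarr s MK = mk -> rarr s MU = X -> rarr s DEP = dp ->
  iarr s MC 0 = M -> M < W ->
  runs argmax s (M * (L * 4 + 13) + 4) (fun s' => iarr s' BP 0 < n /\
    forall i, i < n -> (f i <= f (iarr s' BP 0))%R).
Proof.
move=> nL sM sX sD sC MW.
have nW : n < W by apply: (small2 hW); nia.
have M0 := mk_gt0 mP.
pose I j s' := [/\ iarr s' BP 0 < n, f (iarr s' BP 0) = rarr s' BV 0 &
  forall i, i <= mk j -> (f i <= rarr s' BV 0)%R].
apply: (runs_time (t := (M.-1 * ((L * 4 + 11) + 2) + 2).+2)); first by nia.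
apply: runs_seq_setr; apply: runs_seq_seti; rewrite /=; first by lia.
set s1 := State _ _.
refine (runs_post (leqnn _) _ (runs_for (I := I) (N := M.-1) _ _ _ _ _)) => //.
- move=> s' [b1 b2 b3] _; split=> // i ilt; rewrite b2; apply: b3.
  by rewrite (mk_last mP); lia.
- exact: leq_ltn_trans (leq_pred _) MW.
- by move=> s' [sm1 _] /=; rewrite sm1 // /s1 /update /= sC subn1.
- have f0 : f 0 = X 0 by have := fmk M0; rewrite (mk_first mP).
  split; rewrite /= /update //= ?sX //.
  by move=> i; rewrite (mk_first mP) leqn0 => /eqP->; rewrite f0.
move=> j s' jM [sm1 sm2] vE [b1 b2 b3].
have jM' : j.+1 < M by lia.
have [q1 q3 q4] : [/\ iarr s' MK = mk, rarr s' MU = X & rarr s' DEP = dp].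
  by rewrite !sm1 // !sm2 // /s1 /update /=.
apply: (runs_time (t := (L * 4 + 3) + (4 + 4))); first by lia.
apply: runs_seq; apply: runs_post (run_search nL q1 q3 q4 jM' vE) => // s2 [lo_b hi_b flo fhi fall] [sm3 sm4].
have [r1 r2 r3 r4] : [/\ iarr s2 MK = mk, rarr s2 MU = X, rarr s2 DEP = dp & iarr s2 I_ 0 = j].
  by rewrite !sm3 // !sm4.
have [r5 r6] : iarr s2 BP = iarr s' BP /\ rarr s2 BV = rarr s' BV by rewrite sm3 // sm4.
have qn := mk_lt mP n_gt0 jM'.
set lo := iarr s2 LO 0 in lo_b flo fall; set hi := iarr s2 HI 0 in hi_b fhi fall.
apply: runs_seq.
apply: runs_post (run_improve (g := f) (t := lo) (x := f lo) _ _ _ _ _ _) => //.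
- move=> s3 [e1 e2 e3 e4] [sm5 sm6].
  have [t1 t2 t3 t4] : [/\ iarr s3 MK = mk, rarr s3 MU = X, rarr s3 DEP = dp & iarr s3 I_ 0 = j].
    by rewrite !sm5 // !sm6.
  have t5 : iarr s3 HI 0 = hi by rewrite sm5.
  apply: runs_post (run_improve (g := f) (t := hi) (x := f hi) _ _ _ _ _ _) => //.
  + move=> s4 [e1' e2' e3' e4'] _ _.
    have bn : iarr s4 BP 0 < n.
      case: e2' => ->; last by lia.
      by case: e2 => ->; [rewrite r5 | lia].
    split=> //= i ij; have [ij'|ij'] := leqP i (mk j).
      by apply: le_trans (b3 i ij') _; rewrite -r6 (le_trans e3).
    case: (fall i) => [|h|h]; first by lia.
      by apply: le_trans h (le_trans e4 e3').
    exact: le_trans h e4'.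
  + by lia.
  + by rewrite /= t1 t2 t3 t4 addn1 t5 fhi addrA.
  + by right.
- by lia.
- by rewrite r5 r6 b2.
- by rewrite /= r1 r2 r3 r4 -/lo flo addrA.
- by left.
Qed.

End RunArgmax.

(** * Centers and their labels *)

Notation ETA := 27 (only parsing).

Definition insert : cmd := (
  SetI J_ #0 $MC ;;
  While (BNot (BLeI MK.[$J_ - #1] $BP)) (SetI MK $J_ MK.[$J_ - #1] ;; SetI J_ #0 ($J_ - #1)) ;;
  SetI MK $J_ $BP ;;
  SetI MC #0 ($MC + #1))%P.

Definition pick_center : cmd := (
  argmax ;;
  insert ;;
  SetR MU $BP RZero ;;
  SetI AA $AC $BP ;;
  SetI AC #0 ($AC + #1) ;;
  relax MU)%P.

Definition gonz : cmd := (
  SetI AA $AC #0 ;;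
  SetI AC #0 ($AC + #1) ;;
  While (BNot (BLeI $ETA $AC)) pick_center)%P.

Section MindistExt.
Context {R : realType} {V : finType} {G : wgraph R V}.
Implicit Types (x : nat -> V).

Lemma mindist_ext x x' i v : 0 < i -> (forall t, t < i -> x t = x' t) ->
  mindist (G := G) (x := x) i v = mindist (G := G) (x := x') i v.
Proof.
move=> i0 xx; rewrite /mindist xx //; apply: eq_bigr => t _.
by rewrite xx.
Qed.

End MindistExt.

Section RunGonz.
Context {R : realType} {W n : nat} {e : rel 'I_n} {c : 'I_n -> 'I_n -> R} {o : nat -> nat -> R}.
Context {vx : nat -> 'I_n} {ps : 'I_n -> nat} {pa : nat -> nat} {dp : nat -> R}.
Implicit Types (s : state R).
Hypothesis hW : (n + 2) ^ 6 <= W.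
Hypothesis n_gt0 : 0 < n.
Hypothesis inst : doat_instance e c.
Hypothesis to : tree_order e vx ps pa.
Hypothesis hdp : is_depth c vx pa dp.
Hypothesis pa0 : pa 0 = 0.
Local Notation runs := (runs (W := W) (o := o)).
Local Notation marks := (marks (e := e) (vx := vx) (pa := pa)).
Local Notation relaxed := (relaxed (dp := dp) (pa := pa)).
Local Notation T := (tree_graph e c).
Local Notation d i j := (dist T (vx i) (vx j)).
Local Notation md x := (@mindist R _ T x).

Lemma run_insert s mk M x : iarr s MK = mk -> marks mk M -> iarr s MC 0 = M -> M.+1 < W ->
  iarr s BP 0 = x -> x < n ->
  runs insert s (M * 3 + 5) (fun s' => [/\ marks (iarr s' MK) M.+1, iarr s' MC 0 = M.+1,
    exists2 j, j < M.+1 & iarr s' MK j = x &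
    (forall j, j < M -> exists2 j', j' < M.+1 & iarr s' MK j' = mk j) /\
    (forall j', j' < M.+1 -> iarr s' MK j' = x \/ exists2 j, j < M & iarr s' MK j' = mk j)]).
Proof.
move=> sM mP sC MW sB xn; have M0 := mk_gt0 mP.
have nW : n < W by apply: (small2 hW); nia.
pose I m s' := [/\ iarr s' J_ 0 = m.+1, m < M, forall i, i <= m -> iarr s' MK i = mk i,
  forall i, m.+1 < i <= M -> iarr s' MK i = mk i.-1 & m.+1 < M -> x < mk m.+1].
apply: (runs_time (t := ((M.-1 * 3 + 1) + 2).+1)); first by lia.
apply: runs_seq_seti; rewrite /= sC; first by lia.
apply: runs_seq.
refine (runs_post (leqnn _) _ (runs_while (I := I) (N := M.-1) (tb := 2) _ _)) => //; last first.
- move=> m s' [i1 i2 i3 i4 i5] [sm1 _] /=.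
  have sB' : iarr s' 31 0 = x by rewrite sm1 //= sB.
  rewrite i1 subn1 /= i3 // sB' -ltnNge => xm.
  (* The shifting ends at index 1 at the latest, as the first mark is position 0. *)
  have m0 : 0 < m by case: (m) xm => //; rewrite (mk_first mP).
  have mn : mk m < W by apply: ltn_trans nW; apply: (mk_lt mP).
  apply: runs_seq_seti; rewrite /= i1 subn1 /= i3 //.
  apply: runs_seti; rewrite /update /= i1 subn1 /=; first by lia.
  exists m.-1; first by lia.
  split=> /=; rewrite ?prednK //; first by lia.
  + by move=> i im; rewrite ifF ?i3 //; lia.
  + move=> i ib; case: eqVneq => [->//|ni].
    by apply: i4; lia.
- rewrite /I /update /=; split; [by lia | by lia | by move=> i _; rewrite sM | by move=> i; lia | by lia].
move=> s' [[m _ [i1 i2 i3 i4 i5]] /= stop] [sm1 _].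
have sB' : iarr s' 31 0 = x by rewrite sm1 //= sB.
have sC' : iarr s' 25 0 = M by rewrite sm1.
rewrite negbK i1 subn1 /= i3 // sB' in stop.
apply: runs_seq_seti; rewrite /= sB' ?i1; first by lia.
apply: runs_seti; rewrite /update /= sC' addn1 ?i1 //.
have mE j : j < M.+1 -> (if j <= m then mk j else if j == m.+1 then x else mk j.-1) =
    (if j == m.+1 then x else iarr s' MK j).
  move=> jM; case: leqP => jm; first by rewrite ifF ?i3 //; lia.
  by case: eqP => // ne; rewrite i4 //; lia.
split=> //=.
- refine (marks_eq mE (marks_insert pa0 n_gt0 mP i2 _ _)); first by rewrite stop.
  by move=> /i5/ltnW.
- by exists m.+1; rewrite ?eqxx //; lia.
split=> j jM.
  have [jm|jm] := leqP j m; [exists j | exists j.+1]; rewrite -?mE ?jm //; try lia.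
  rewrite (_ : (j.+1 <= m) = false); last by lia.
  by rewrite ifF //; lia.
rewrite -mE //; case: leqP => jm; first by right; exists j => //; lia.
by case: eqP => ne; [left | right; exists j.-1 => //; lia].
Qed.

Lemma md_lipschitz x i u v : 0 < i -> (md x i u <= md x i v + dist T u v)%R.
Proof.
move=> i0; have [t ti ->] := mindist_attained (G := T) (x := x) v i0.
apply: le_trans (mindist_le (G := T) (x := x) u ti) _.
by rewrite addrC tree_dist_triangle.
Qed.

(* The [relaxed_extension] of the computed labels is the distance to the set of
   centers: it vanishes on the centers and is Lipschitz. *)
Lemma extension_mindist mk M X f cnt x : marks mk M -> relaxed mk M X ->
  (forall j, j < M -> f (mk j) = X (mk j)) ->
  (forall j i, j.+1 < M -> mk j < i < mk j.+1 -> f i = segment_min (dp := dp) (mk := mk) X j i) ->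
  (forall i, 0 < i < n -> (`|f i - f (pa i)| <= dp i - dp (pa i))%R) ->
  0 < cnt -> (forall t, t < cnt -> f (ps (x t)) = 0%R) ->
  (forall j, j < M -> (md x cnt (vx (mk j)) <= X (mk j))%R) ->
  forall i, i < n -> f i = md x cnt (vx i).
Proof.
move=> mP rX fmk fin fL c0 f0 mX i ilt; apply/le_anti/andP; split.
  have [t tc ->] := mindist_attained (G := T) (x := x) (vx i) c0.
  have := lipschitz_dist (f := f \o ps) (conn_tree_graph inst (vx i) (x t))
    (fun u v z => position_lipschitz inst to hdp fL).
  by rewrite /= f0 // (to_psK to) // subr0.
have onmk j : j < M -> (md x cnt (vx (mk j)) <= f (mk j))%R by move=> jM; rewrite fmk ?mX.
case: (posnP i) => [->|i0].
  by have := onmk 0 (mk_gt0 mP); rewrite (mk_first mP).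
have [j [jM /andP[ji]]] := mk_cover mP (i := i) ltac:(by rewrite i0).
rewrite leq_eqVlt => /predU1P[->|ij]; first exact: onmk.
have [ch _] := segment_min_between n_gt0 to mP rX fmk fin jM (leq_ltn_trans ji ij).
have qn := mk_lt mP n_gt0 jM.
rewrite (fin j i) ?ji // le_min; apply/andP; split.
  have [_ h] := chain_depth inst to hdp qn ch (leqnn _) (ltnW ji) (ltnW ij).
  apply: le_trans (md_lipschitz x (vx i) (vx (mk j)) c0) _.
  by apply: lerD => //; apply: mX; exact: ltnW.
have [_ h] := chain_depth inst to hdp qn ch (ltnW ji) (ltnW ij) (leqnn _).
apply: le_trans (md_lipschitz x (vx i) (vx (mk j.+1)) c0) _.
by apply: lerD; [apply: mX | rewrite (tree_dist_sym inst)].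
Qed.

(** [AA] begins with the [b] branch vertices; the centers come after them. *)
Definition centers b s t := vx (iarr s AA (b + t)).

(** There are [M0 + cnt.-1] marks because the first center, position 0, is marked from the start.
    The labels are only required to be relaxed, to vanish at the centers and not to fall below the
    distance: by [extension_mindist] this determines them. *)
Record gonz_inv (b M0 : nat) (mk0 : nat -> nat) (cnt : nat) s : Prop := GonzInv {
  gi_cnt : 0 < cnt;
  gi_ac : iarr s AC 0 = b + cnt;
  gi_mc : iarr s MC 0 = M0 + cnt.-1;
  gi_marks : marks (iarr s MK) (M0 + cnt.-1);
  gi_old : forall j, j < M0 -> exists2 j', j' < M0 + cnt.-1 & iarr s MK j' = mk0 j;
  gi_relaxed : relaxed (iarr s MK) (M0 + cnt.-1) (rarr s MU);
  gi_center : forall t, t < cnt -> [/\ iarr s AA (b + t) < n, rarr s MU (iarr s AA (b + t)) = 0%R &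
     exists2 j, j < M0 + cnt.-1 & iarr s MK j = iarr s AA (b + t)];
  gi_le : forall j, j < M0 + cnt.-1 ->
     (md (centers b s) cnt (vx (iarr s MK j)) <= rarr s MU (iarr s MK j))%R;
  gi_gonz : forall t, 0 < t < cnt -> forall v, (md (centers b s) t v <= md (centers b s) t (centers b s t))%R }.

Lemma run_pick_center b M0 mk0 cnt L s : n <= 2 ^ L -> b + cnt < n -> M0 + cnt < n ->
  iarr s PAR = pa -> rarr s DEP = dp -> gonz_inv b M0 mk0 cnt s ->
  runs pick_center s ((M0 + cnt) * (L * 4 + 32) + 16) (fun s' => gonz_inv b M0 mk0 cnt.+1 s' /\
    forall t, t < b -> iarr s' AA t = iarr s AA t).
Proof.
move=> nL bn Mn sP sD [c0 ac mc mP old rX cen cle gz].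
have nW : n < W by apply: (small2 hW); nia.
set M := M0 + cnt.-1 in mc mP old rX cen cle.
have MM : M.+1 = M0 + cnt by rewrite /M; lia.
have [f [fmk fin fL]] := relaxed_extension inst to hdp mP n_gt0 rX.
set x := centers b s in cle gz.
have f0 t : t < cnt -> f (ps (x t)) = 0%R.
  move=> tc; have [h1 h2 [j jM jE]] := cen t tc.
  by rewrite /x /centers (to_psK to) // -jE fmk // jE.
have fE := extension_mindist mP rX fmk fin fL c0 f0 cle.
apply: (runs_time (t := (M * (L * 4 + 13) + 4) + ((M * 3 + 5) + (M.+1 * 16 + 4).+3))); first by nia.
apply: runs_seq.
apply: runs_post (run_argmax hW n_gt0 inst to hdp mP rX fmk fin nL erefl erefl sD mc _) => //; last by lia.
move=> s1 [bpn bpmax] [sm1 sm2].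
have [q1 q2 q3 q4] : [/\ iarr s1 MK = iarr s MK, iarr s1 MC 0 = M, iarr s1 AA = iarr s AA & iarr s1 PAR = pa].
  by rewrite !sm1.
have [q5 q6 q7] : [/\ rarr s1 MU = rarr s MU, rarr s1 DEP = dp & iarr s1 AC 0 = b + cnt].
  by rewrite !sm2 // sm1.
set y := iarr s1 BP 0 in bpn bpmax.
apply: runs_seq.
apply: runs_post (run_insert q1 mP q2 _ erefl bpn) => //; last by lia.
move=> s2 [mP2 mc2 [jy jyM jyE] [old2 new2]] [sm3 sm4].
have [r1 r2 r3 r4] : [/\ iarr s2 AA = iarr s AA, iarr s2 BP 0 = y, iarr s2 AC 0 = b + cnt & iarr s2 PAR = pa].
  by rewrite !sm3.
have [r5 r6] : rarr s2 MU = rarr s MU /\ rarr s2 DEP = dp by rewrite !sm4.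
rewrite -/y in jyE new2.
apply: runs_seq_setr; rewrite /= r2.
apply: runs_seq_seti; rewrite /= r2; first exact: ltn_trans bpn nW.
apply: runs_seq_seti; rewrite /update /= r3 addn1; first by lia.
set s3 := State _ _.
pose x' t := if t == cnt then vx y else x t.
have xx' t : t < cnt -> x t = x' t by rewrite /x' => h; rewrite ifF //; lia.
have mdc v : md x' cnt v = md x cnt v by apply/esym/mindist_ext.
have mdS v : (md x' cnt.+1 v <= md x cnt v)%R.
  rewrite -mdc; have [t tc ->] := mindist_attained (G := T) (x := x') v c0.
  by apply: mindist_le; exact: ltnW.
have relax_ok := @run_relax R W n e c o vx ps pa dp hW n_gt0 inst to hdp pa0 MU s3 (iarr s2 MK) M.+1 isT r4 erefl mP2 r6 mc2 _.
apply: runs_post (relax_ok _) => //; last by lia.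
move=> s4 [rX4 le4 low4] [sm5 sm6].
have [t1 t2 t3 t4] : [/\ iarr s4 MK = iarr s2 MK, iarr s4 MC 0 = M.+1,
    forall t, iarr s4 AA t = (if t == b + cnt then y else iarr s AA t) & iarr s4 AC 0 = b + cnt.+1].
  by rewrite !sm5 // /s3 /= addnS; split=> // t; rewrite r1.
have xE t : t <= cnt -> centers b s4 t = x' t.
  by move=> tc; rewrite /centers t3 /x' eqn_add2l; case: eqP.
have mdE t v : 0 < t -> t <= cnt.+1 -> md (centers b s4) t v = md x' t v.
  by move=> t0 tc; apply: mindist_ext => // u ut; apply: xE; lia.
have s3mu i : rarr s3 MU i = if i == y then 0%R else rarr s MU i by rewrite /s3 /= /update /= r5.
have wpos j : 0 < j < M.+1 -> (0 <= mweight (dp := dp) (pa := pa) (iarr s2 MK) j)%R.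
  by move=> jb; have [_ h _ _ _] := mparent_cases inst to hdp pa0 n_gt0 mP2 jb.
have fge0 i : i < n -> (0 <= f i)%R.
  move=> ilt; rewrite fE //; have [t _ ->] := mindist_attained (G := T) (x := x) (vx i) c0.
  exact: tree_dist_ge0.
(* The constant 0 is relaxed and below the starting labels, so no label becomes negative and the
   centers keep the label 0. *)
have mu_ge0 j : j < M.+1 -> (0 <= rarr s4 MU (iarr s2 MK j))%R.
  apply: (low4 (fun=> 0%R)) => [k kb|k kM]; first by have := wpos k kb; lra.
  rewrite s3mu; case: eqP => // ny; case: (new2 k kM) => [/ny//|[l lM ->]].
  by rewrite -fmk // fge0 // (mk_lt mP).
have mu0 i : (exists2 j, j < M.+1 & iarr s2 MK j = i) -> rarr s3 MU i = 0%R -> rarr s4 MU i = 0%R.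
  move=> [j jM jE] h; apply/le_anti; rewrite -{2}jE mu_ge0 // andbT.
  by apply: le_trans (le4 i) _; rewrite h.
have M1 : M0 + cnt.+1.-1 = M.+1 by rewrite MM.
split; last by move=> t tb; rewrite t3 ifF //; lia.
split; rewrite ?M1 ?t1 ?t4 //.
- by move=> j /old[j' j'M <-]; have [k kM kE] := old2 j' j'M; exists k.
- move=> t tc; rewrite t3 eqn_add2l; case: eqP => [_|tn].
    split=> //; last by exists jy.
    by apply: mu0; [exists jy | rewrite s3mu eqxx].
  have [h1 h2 [j jM jE]] := cen t ltac:(lia); split=> //.
    apply: mu0; last by rewrite s3mu h2; case: ifP.
    by have [k kM kE] := old2 j jM; exists k; rewrite // kE.
  by have [k kM kE] := old2 j jM; exists k; rewrite // kE.
- move=> j jM; rewrite mdE //.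
  apply: (low4 (fun i => md x' cnt.+1 (vx i))) => // [k kb|k kM].
    have [_ _ h _ _] := mparent_cases inst to hdp pa0 n_gt0 mP2 kb.
    split; [apply: le_trans (md_lipschitz x' _ (vx (iarr s2 MK k)) (ltn0Sn _)) _ |
            apply: le_trans (md_lipschitz x' _ (vx (mparent (pa := pa) (iarr s2 MK) k)) (ltn0Sn _)) _].
      by rewrite lerD2l (tree_dist_sym inst).
    by rewrite lerD2l.
  rewrite s3mu; case: eqP => [->|ny].
    have := mindist_le (G := T) (x := x') (vx y) (ltnSn cnt).
    by rewrite /x' eqxx tree_distxx.
  case: (new2 k kM) => [/ny//|[l lM ->]]; apply: le_trans (mdS _) _.
  exact: cle.
- move=> t /andP[t0 tc] v; rewrite !mdE //; [|lia..]; rewrite xE //.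
  have [tE|tn] := eqVneq t cnt.
    rewrite tE /x' eqxx -/x' !mdc -(to_vxK to v) -!fE ?(to_ps to) //.
    exact/bpmax/(to_ps to).
  have tc' : t < cnt by lia.
  have mdt w : md x' t w = md x t w.
    by apply/esym/mindist_ext => // u ut; apply: xx'; exact: ltn_trans tc'.
  by rewrite !mdt -xx' //; apply: gz; rewrite t0.
Qed.

Lemma run_gonz b M0 mk0 h L s : n <= 2 ^ L -> b + h < n -> M0 + h < n -> 0 < h ->
  iarr s PAR = pa -> rarr s DEP = dp -> iarr s ETA 0 = b + h -> iarr s AC 0 = b ->
  iarr s MC 0 = M0 -> iarr s MK = mk0 -> marks mk0 M0 ->
  (forall i, i < n -> rarr s MU i = dp i) ->
  runs gonz s (h * ((M0 + h) * (L * 4 + 32) + 17) + 3) (fun s' => [/\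
    gonz_inv b M0 mk0 h s', iarr s' AC 0 = b + h & forall t, t < b -> iarr s' AA t = iarr s AA t]).
Proof.
move=> nL bn Mn h0 sP sD sE sA sC sM mP sU.
have nW : n < W by apply: (small2 hW); nia.
have M00 := mk_gt0 mP.
pose I m s' := m < h /\ gonz_inv b M0 mk0 (h - m) s' /\ forall t, t < b -> iarr s' AA t = iarr s AA t.
apply: (runs_time (t := ((h.-1 * ((M0 + h) * (L * 4 + 32) + 16).+1 + 1).+2))); first by nia.
apply: runs_seq_seti; rewrite /=; first by lia.
apply: runs_seq_seti; rewrite /update /= sA addn1; first by lia.
refine (runs_post (leqnn _) _ (runs_while (I := I) (N := h.-1) _ _)) => //.
- move=> s' [[m mh [mh' [gi AAb]]] /= stop] [sm1 _].
  rewrite negbK sm1 //= sE (gi_ac gi) leq_add2l in stop.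
  have E : h - m = h by lia.
  by rewrite E in gi; split=> //; rewrite (gi_ac gi).
- split; first by lia.
  have -> : h - h.-1 = 1 by lia.
  split; last by move=> t tb /=; rewrite ifF //; lia.
  have lt0 t : t < 1 -> t = 0 by lia.
  have mdp i : i < n -> (dist T (vx i) (vx 0) <= dp i)%R by apply: (dist_root inst to hdp).
  split=> //=; rewrite ?addn0 ?sM ?addn1 //.
  + by move=> j jM; exists j.
  + move=> j jb; have [cj w0 _ [j' j'M j'E] _] := mparent_cases inst to hdp pa0 n_gt0 mP jb.
    rewrite !sU ?ger0_norm // -?j'E ?(mk_lt mP) //; lia.
  + move=> t /lt0->; rewrite addn0 eqxx; split=> //; first by rewrite sU // hdp.1.
    by exists 0 => //; rewrite (mk_first mP).
  + move=> j jM; rewrite sU ?(mk_lt mP) //.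
    apply: le_trans (mindist_le (G := T) _ (ltnSn 0)) _.
    by rewrite /centers /= addn0 eqxx mdp ?(mk_lt mP).
  + by move=> t; lia.
move=> m s' [mh [gi AAb]] [sm1 sm2] /= stop.
have sE' : iarr s' ETA 0 = b + h by rewrite sm1.
rewrite sE' (gi_ac gi) leq_add2l -ltnNge in stop.
have [sP' sD'] : iarr s' PAR = pa /\ rarr s' DEP = dp by rewrite sm1 // sm2.
apply: runs_post (run_pick_center nL _ _ sP' sD' gi) => //; [| |lia|lia].
  by rewrite leq_add2r leq_mul2r; apply/orP; right; lia.
move=> s2 [gi2 AA2] _; exists m.-1; first by lia.
split; first by lia.
split; last by move=> t tb; rewrite AA2 // AAb.
by have -> : h - m.-1 = (h - m).+1 by lia.
Qed.

End RunGonz.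

(** * Computation of eta and of the distance matrix *)

Notation TGT := 37 (only parsing).
Notation POW := 38 (only parsing).
Notation RUN := 39 (only parsing).
Notation U_ := 35 (only parsing).
Notation V_ := 36 (only parsing).
Notation DD := 2 (only parsing).
Notation MAT := 3 (only parsing).
Notation kE := (IGet 0 (IConst 1)).

Definition compute_eta : cmd := (
  SetI TGT #0 nE ;;
  for_ I_ (kE * #2 + #2) (SetI TGT #0 ($TGT * #2)) ;;
  SetI ETA #0 #0 ;;
  SetI RUN #0 #1 ;;
  While (BEqI $RUN #1) (
    SetI POW #0 #1 ;;
    for_ I_ (kE * #2 + #2) (SetI POW #0 ($POW * ($ETA + #1))) ;;
    If (BLeI $POW $TGT) (SetI ETA #0 ($ETA + #1)) (SetI RUN #0 #0)))%P.

(** The length of the route through the root is a finite initial label that never undershoots the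
    distance. *)
Definition matrix_row : cmd := (
  for_ I_ $MC (SetR DD MK.[$I_] (RAdd (RGet DEP MK.[$I_]) (RGet DEP AA.[$U_]))) ;;
  SetR DD AA.[$U_] RZero ;;
  relax DD ;;
  for_ V_ $AC (SetR MAT ($U_ * $AC + $V_) (RGet DD AA.[$V_])))%P.

Definition matrix : cmd := for_ U_ ($AC)%P matrix_row.

Section RunEta.
Context {R : realType} {W n : nat} {o : nat -> nat -> R}.
Implicit Types (s : state R).
Local Notation runs := (runs (W := W) (o := o)).

Lemma run_eta s k E : iarr s 0 0 = n -> iarr s 0 1 = k -> 1 < W -> 2 * k + 2 < W -> n * 2 ^ (2 * k + 2) < W ->
  E ^ (2 * k + 2) <= n * 2 ^ (2 * k + 2) < E.+1 ^ (2 * k + 2) -> E.+1 ^ (2 * k + 2) < W -> 0 < n ->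
  runs compute_eta s (E.+2 * ((2 * k + 2) * 3 + 8)) (fun s' => iarr s' ETA 0 = E).
Proof.
move=> sn sk W1 qW tW /andP[E1 E2] EW n0; set q := 2 * k + 2 in qW tW E1 E2 EW *.
have qE : k * 2 + 2 = q by rewrite /q mulnC.
apply: (runs_time (t := ((q * (1 + 2) + 2) + (E.+1 * (1 + ((q * (1 + 2) + 2) + 2)).+1 + 1).+2).+1)).
  by rewrite /q; nia.
have nW : n < W.
  by apply: leq_ltn_trans tW; rewrite leq_pmulr // expn_gt0.
apply: runs_seq_seti; rewrite /= sn //.
apply: runs_seq.
pose I1 j s' := iarr s' TGT 0 = n * 2 ^ j.
refine (runs_post (leqnn _) _ (runs_for (I := I1) (N := q) _ _ _ _ _)) => //; last first.
- move=> j s' jq [sm1 _] vE tE; apply: runs_seti; rewrite /= tE -mulnA -expnSr.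
    by apply: leq_ltn_trans tW; rewrite leq_mul2l leq_exp2l // jq orbT.
  by move=> _; rewrite /I1 /set_scalar /update /=.
- by rewrite /I1 /= expn0 muln1.
- by move=> s' [sm1 _] /=; rewrite sm1 // /update /= sk qE.
move=> s1 tE [sm1 _].
have [k1] : iarr s1 0 1 = k by rewrite sm1.
apply: runs_seq_seti => /=; first exact: ltnW.
apply: runs_seq_seti; rewrite /update //=.
pose I m s' := (iarr s' RUN 0 = 1 /\ iarr s' ETA 0 + m = E.+1 /\ 0 < m) \/
  (m = 0 /\ iarr s' RUN 0 = 0 /\ iarr s' ETA 0 = E).
refine (runs_post (leqnn _) _ (runs_while (I := I) (N := E.+1) _ _)) => //.
- by move=> s' [[m _ [[r1 _]|[_ [_ ->]]]] /=] //; rewrite r1.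
- by left.
move=> m s' [[r1 [em m0]]|[_ [r0 _]]] [sm2 _] /= run; last by rewrite r0 in run.
have k2 : iarr s' 0 1 = k by rewrite sm2.
have t2 : iarr s' TGT 0 = n * 2 ^ q by rewrite sm2 // /update /= tE.
set E' := iarr s' ETA 0 in em.
have E'E : E' < E.+1 by lia.
rewrite add1n; apply: runs_seq_seti => //.
apply: runs_seq.
pose I2 j s2 := iarr s2 POW 0 = E'.+1 ^ j.
refine (runs_post (leqnn _) _ (runs_for (I := I2) (N := q) _ _ _ _ _)) => //; last first.
- move=> j s2 jq [sm3 _] vE pE.
  have eE : iarr s2 ETA 0 = E' by rewrite sm3.
  apply: runs_seti; rewrite /= pE eE addn1 -expnSr.
    apply: leq_ltn_trans EW; apply: (@leq_trans (E'.+1 ^ q)); first by rewrite leq_pexp2l.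
    by rewrite leq_exp2r // /q addn2.
  by move=> _; rewrite /I2 /set_scalar /update /=.
- by move=> s2 [sm3 _] /=; rewrite sm3 // /update /= k2 qE.
move=> s2 pE [sm3 _].
have [t3 eE r3] : [/\ iarr s2 TGT 0 = n * 2 ^ q, iarr s2 ETA 0 = E' & iarr s2 RUN 0 = 1].
  by rewrite !sm3.
apply: runs_if; rewrite /= pE t3 => cmp.
  apply: runs_seti; rewrite /= eE addn1.
    by apply: leq_ltn_trans E'E _; apply: leq_ltn_trans EW; rewrite -[leqLHS]expn1 leq_pexp2l // /q addn2.
  exists m.-1; first by lia.
  left; split; rewrite /= /update //=; split; first by lia.
  rewrite -subn1 subn_gt0 ltnNge; apply/negP => m1.
  have EE : E' = E by lia.
  by move: cmp; rewrite EE leqNgt E2.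
apply: runs_seti; rewrite //=; first exact: ltnW.
exists 0; first by []. right; rewrite /update /=; split=> //; split=> //.
rewrite eE; apply/eqP; rewrite eqn_leq -ltnS E'E /= leqNgt; apply/negP => EE.
move: cmp; rewrite -ltnNge ltnNge; apply/negP; rewrite negbK.
by apply: leq_trans E1; rewrite leq_exp2r // /q addn2.
Qed.

End RunEta.

Section RunMatrix.
Context {R : realType} {W n : nat} {e : rel 'I_n} {c : 'I_n -> 'I_n -> R} {o : nat -> nat -> R}.
Context {vx : nat -> 'I_n} {ps : 'I_n -> nat} {pa : nat -> nat} {dp : nat -> R}.
Implicit Types (s : state R).
Hypothesis hW : (n + 2) ^ 6 <= W.
Hypothesis n_gt0 : 0 < n.
Hypothesis inst : doat_instance e c.
Hypothesis to : tree_order e vx ps pa.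
Hypothesis hdp : is_depth c vx pa dp.
Hypothesis pa0 : pa 0 = 0.
Local Notation runs := (runs (W := W) (o := o)).
Local Notation marks := (marks (e := e) (vx := vx) (pa := pa)).
Local Notation T := (tree_graph e c).
Local Notation d i j := (dist T (vx i) (vx j)).

(** The labels stay above the distance to [A u] by the last part of [run_relax]. They are not
    larger, because their extension is 1-Lipschitz and at most 0 at [A u]. *)
Lemma run_matrix_row s mk M m A u : iarr s MK = mk -> marks mk M -> iarr s MC 0 = M ->
  M < W -> m < W -> iarr s PAR = pa -> rarr s DEP = dp -> iarr s AC 0 = m -> iarr s AA = A ->
  (forall i, i < m -> exists2 j, j < M & mk j = A i) -> iarr s U_ 0 = u -> u < m ->
  runs matrix_row s (M * 19 + m * 3 + 9) (fun s' => forall l, rarr s' MAT l =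
    if (u * m <= l) && (l < u.+1 * m) then d (A (l - u * m)) (A u) else rarr s MAT l).
Proof.
move=> sM mP sC MW mW sP sD sAC sA Amk su um.
have AN i : i < m -> A i < n by move=> /Amk[j jM <-]; apply: (mk_lt mP).
apply: (runs_time (t := (M * (1 + 2) + 2) + ((M * 16 + 4) + (m * (1 + 2) + 2)).+1)); first by lia.
apply: runs_seq.
pose I1 j s' := forall i, i < j -> rarr s' DD (mk i) = (dp (mk i) + dp (A u))%R.
refine (runs_post (leqnn _) _ (runs_for (I := I1) (N := M) _ _ _ _ _)) => //; last first.
- move=> j s' jM [sm1 sm2] vE Ij; have [q1 q2 q3] : [/\ iarr s' MK = mk, iarr s' AA = A & iarr s' U_ 0 = u].
    by rewrite !sm1.
  have q4 : rarr s' DEP = dp by rewrite sm2.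
  apply: runs_setr; rewrite /update /= vE q1 q2 q3 q4 => _ i ij /=.
  case: eqP => [->//|ne]; apply: Ij.
  by have ij' : i <> j by [move=> E; apply: ne; rewrite E]; lia.
- by move=> s' [sm1 _] /=; rewrite sm1.
move=> s1 I1M [sm1 sm2].
have [q1 q2 q3 q4] : [/\ iarr s1 MK = mk, iarr s1 AA = A, iarr s1 U_ 0 = u & iarr s1 PAR = pa].
  by rewrite !sm1.
have [q5 q6 q7 q8] : [/\ rarr s1 DEP = dp, rarr s1 MAT = rarr s MAT, iarr s1 AC 0 = m & iarr s1 MC 0 = M].
  by rewrite !sm2 // !sm1.
apply: runs_seq_setr; rewrite /= q2 q3; set s2 := State _ _.
apply: runs_seq.
have s2X i : i < M -> rarr s2 DD (mk i) = if mk i == A u then 0%R else (dp (mk i) + dp (A u))%R.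
  by move=> iM; rewrite /s2 /= /update /= I1M.
refine (runs_post (leqnn _) _ (run_relax (mk := mk) (M := M) hW n_gt0 inst to hdp pa0 (X := DD) _ _ _ mP _ _ _)) => //.
move=> s3 [rX le3 low3] [sm3 sm4].
have wd j : 0 < j < M -> (d (mk j) (mparent (pa := pa) mk j) <= mweight (dp := dp) (pa := pa) mk j)%R.
  by move=> jb; have [_ _ h _ _] := mparent_cases inst to hdp pa0 n_gt0 mP jb.
have Xge i : i < M -> (d (mk i) (A u) <= rarr s3 DD (mk i))%R.
  apply: (low3 (fun i => d i (A u))) => [j jb|j jM].
    have := wd j jb.
    have := tree_dist_triangle inst (vx (mparent (pa := pa) mk j)) (vx (mk j)) (vx (A u)).
    have := tree_dist_triangle inst (vx (mk j)) (vx (mparent (pa := pa) mk j)) (vx (A u)).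
    by rewrite (tree_dist_sym inst (vx (mparent (pa := pa) mk j)) (vx (mk j))); split; lra.
  rewrite s2X //; case: eqP => [->|_]; first by rewrite tree_distxx.
  have := tree_dist_triangle inst (vx (mk j)) (vx 0) (vx (A u)).
  have := dist_root inst to hdp (mk_lt mP n_gt0 jM); have := dist_root inst to hdp (AN u um).
  by rewrite (tree_dist_sym inst (vx (A u)) (vx 0)); lra.
have [f [fmk _ fL]] := relaxed_extension inst to hdp mP n_gt0 rX.
have XE i : i < m -> rarr s3 DD (A i) = d (A i) (A u).
  move=> im; have [j jM jE] := Amk i im; apply/le_anti; apply/andP; split; last by rewrite -jE Xge.
  have [ju juM juE] := Amk u um.
  have fu : (f (A u) <= 0)%R.
    rewrite -juE fmk // juE; apply: le_trans (le3 _) _.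
    by rewrite -juE s2X // juE eqxx.
  have := lipschitz_dist (f := f \o ps) (conn_tree_graph inst (vx (A i)) (vx (A u)))
    (fun x y z => position_lipschitz inst to hdp fL).
  have fA : f (A i) = rarr s3 DD (A i) by rewrite -jE fmk.
  by rewrite /= !(to_psK to) ?AN // fA => h; lra.
have [r1 r2 r3] : [/\ iarr s3 AA = A, iarr s3 U_ 0 = u & iarr s3 AC 0 = m] by rewrite !sm3.
have r4 : rarr s3 MAT = rarr s MAT by rewrite sm4.
pose I2 j s' := forall l, rarr s' MAT l =
  if (u * m <= l) && (l < u * m + j) then d (A (l - u * m)) (A u) else rarr s MAT l.
refine (runs_post (leqnn _) _ (runs_for (I := I2) (N := m) _ _ _ _ _)) => //.
- by move=> s4 h _ l; rewrite h mulSn [m + _]addnC.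
- by move=> s' [sm5 _] /=; rewrite sm5.
- by move=> l /=; rewrite addn0 r4 ifF //; lia.
move=> j s' jm [sm5 sm6] vE Ij.
have [t1 t2 t3 t4] : [/\ iarr s' AA = A, iarr s' U_ 0 = u, iarr s' AC 0 = m & rarr s' DD = rarr s3 DD].
  by rewrite !sm5 // sm6.
apply: runs_setr; rewrite /update /= t1 t2 t3 t4 vE => _ l /=.
case: eqP => [->|ne].
  by rewrite XE // addKn leq_addr ltn_add2l ltnSn.
rewrite Ij; have -> // : (u * m <= l) && (l < u * m + j) = (u * m <= l) && (l < u * m + j.+1).
by move: ne; move: (u * m) => um' ne; lia.
Qed.

Lemma run_matrix s mk M m A : iarr s MK = mk -> marks mk M -> iarr s MC 0 = M ->
  M < W -> m < W -> iarr s PAR = pa -> rarr s DEP = dp -> iarr s AC 0 = m -> iarr s AA = A ->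
  (forall i, i < m -> exists2 j, j < M & mk j = A i) ->
  runs matrix s (m * (M * 19 + m * 3 + 11) + 2) (fun s' => forall i j, i < m -> j < m ->
    rarr s' MAT (i * m + j) = d (A i) (A j)).
Proof.
move=> sM mP sC MW mW sP sD sAC sA Amk.
pose I u s' := forall i j, i < u -> j < m -> rarr s' MAT (i * m + j) = d (A i) (A j).
apply: (runs_time (t := m * ((M * 19 + m * 3 + 9) + 2) + 2)); first by nia.
refine (runs_post (leqnn _) _ (runs_for (I := I) (N := m) _ _ _ _ _)) => //.
- by move=> s' [sm5 _] /=; rewrite sm5.
move=> u s' um [sm1 sm2] vE Iu.
have [q1 q2 q3 q4] : [/\ iarr s' MK = mk, iarr s' AA = A, iarr s' MC 0 = M & iarr s' PAR = pa].
  by rewrite !sm1.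
have [q5 q6] : rarr s' DEP = dp /\ iarr s' AC 0 = m by rewrite sm2 // sm1.
apply: runs_post (run_matrix_row q1 mP q3 MW mW q4 q5 q6 q2 Amk vE um) => // s2 h _ _ i j iu jm /=.
rewrite h; have [iE|ine] := eqVneq i u.
  rewrite iE addKn leq_addr mulSn addnC ltn_add2r jm /=.
  exact: tree_dist_sym.
have iu' : i < u by lia.
have lt : i * m + j < u * m.
  by apply: (@leq_trans (i.+1 * m)); [rewrite mulSn addnC ltn_add2r | rewrite leq_mul2r iu' orbT].
by rewrite leqNgt lt /= Iu.
Qed.

End RunMatrix.

(** * Enumeration of the shortcut sets *)

Section Rank.
Implicit Types (t u : nat -> nat) (k N : nat).

(* The position of the nondecreasing sequence [t 0 <= ... <= t k.-1] in the
   colexicographic order. *)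
Definition rank t k := \sum_(i < k) 'C(t i + i, i.+1).

Definition nondec t k := forall i, i.+1 < k -> t i <= t i.+1.

Lemma rankS t k : rank t k.+1 = rank t k + 'C(t k + k, k.+1).
Proof. exact: big_ord_recr. Qed.

Lemma bin_mono a b i : a <= b -> 'C(a, i) <= 'C(b, i).
Proof. by move=> ab; apply: leq_bin2l. Qed.

(** This is the combinatorial number system with the strictly increasing digits [t i + i]: by
    Pascal's rule, raising [t k] by one gains more than all lower digits amount to. *)
Lemma rank_lt t k : nondec t k.+1 -> rank t k < 'C(t k + k, k).
Proof.
elim: k => [|k IH] st; first by rewrite /rank big_ord0 bin0.
rewrite rankS; apply: (@leq_trans 'C((t k).+1 + k, k.+1)).
  by rewrite addSn binS addnC ltn_add2l IH // => i ik; apply: st; exact: ltnW.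
by apply: bin_mono; rewrite addSnnS leq_add2r; apply: st.
Qed.

Lemma rankS_lt t k : nondec t k.+1 -> rank t k.+1 < 'C((t k).+1 + k, k.+1).
Proof. by move=> st; rewrite rankS addSn binS addnC ltn_add2l rank_lt. Qed.

Lemma rank_inj t u k : nondec t k -> nondec u k -> rank t k = rank u k ->
  forall i, i < k -> t i = u i.
Proof.
have lt_case t' u' k' : nondec t' k'.+1 -> rank t' k'.+1 = rank u' k'.+1 -> u' k' <= t' k'.
  move=> st E; rewrite leqNgt; apply/negP => lt.
  have := rankS_lt st; rewrite E rankS ltnNge => /negP; apply.
  apply: leq_trans (leq_addl _ _); apply: bin_mono.
  by rewrite leq_add2r.
elim: k => // k IH st su E.
have tk : t k = u k.
  by apply/eqP; rewrite eqn_leq (lt_case u t) // (lt_case t u).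
move=> i; rewrite ltnS leq_eqVlt => /predU1P[->//|]; apply: IH.
- by move=> j jk; apply: st; exact: ltnW.
- by move=> j jk; apply: su; exact: ltnW.
by move: E; rewrite !rankS tk => /addIn.
Qed.

Lemma rank_bound t k N : 0 < k -> nondec t k -> (forall i, i < k -> t i < N) ->
  rank t k < 'C(N + k, k).
Proof.
case: k => // k _ st tN; apply: leq_trans (rankS_lt st) _.
by apply: bin_mono; have := tN k (ltnSn k); lia.
Qed.

Lemma rank_mono t u k : (forall i, i < k -> t i <= u i) -> rank t k <= rank u k.
Proof. by move=> tu; apply: leq_sum => i _; apply: bin_mono; rewrite leq_add2r tu. Qed.

(** The colexicographic successor, when [j] is the least index at which [t] can be raised and remain
    nondecreasing. *)
Definition succ_tuple t j i := if i < j then 0 else if i == j then (t j).+1 else t i.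

Lemma nondec_succ t j k : j < k -> nondec t k -> (j.+1 < k -> t j < t j.+1) -> nondec (succ_tuple t j) k.
Proof.
move=> jk st lt i ik; rewrite /succ_tuple.
have [ij|ji] := ltnP i j; first by [].
rewrite (_ : (i.+1 < j) = false); last by lia.
rewrite (_ : (i.+1 == j) = false); last by lia.
by case: eqP ik => [->|_] ik; [apply: lt | apply: st].
Qed.

Lemma hockey v j : 'C(v + j.+1, j.+1) = (\sum_(i < j.+1) 'C(v + i, i.+1)).+1.
Proof.
elim: j => [|j IH]; first by rewrite big_ord_recr big_ord0 /= addn1 addn0 !bin1.
by rewrite big_ord_recr /= addnS binS IH addnC addSn.
Qed.

(** The zeroed entries contribute nothing, as ['C(i, i.+1) = 0], and [hockey] says that raising the
    entry [j] gains one more than the equal entries up to [j] contributed. *)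
Lemma rank_succ t j k : j < k -> (forall i, i <= j -> t i = t j) ->
  rank (succ_tuple t j) k = (rank t k).+1.
Proof.
move=> jk tE; have kE : k = j.+1 + (k - j.+1) by lia.
rewrite /rank kE !big_split_ord /= -addSn; congr (_ + _); last first.
  apply: eq_bigr => i _; rewrite /succ_tuple ifF; last by lia.
  by rewrite ifF //; lia.
rewrite big_ord_recr /= /succ_tuple ltnn eqxx big1 => [|i _]; last first.
  by rewrite ltn_ord bin_small.
rewrite add0n addSnnS hockey; congr _.+1; apply: eq_bigr => i _.
by rewrite tE // -ltnS.
Qed.

End Rank.

Section Codes.
Context {n : nat} (av : nat -> 'I_n) (m : nat).

Definition code1 x := av (x %/ m).
(** The remainder modulo [m], written with the operations of the machine. *)
Definition code2 x := av (x - x %/ m * m).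

Definition code_set (l : seq nat) : {set {set 'I_n}} :=
  [set p | has (fun x => (code1 x != code2 x) && (p == [set code1 x; code2 x])) l].

Lemma code_set_rcons l x : code_set (rcons l x) =
  if code1 x != code2 x then [set code1 x; code2 x] |: code_set l else code_set l.
Proof.
apply/setP => p; rewrite inE has_rcons; case: ifP => /= ne; rewrite !inE ?ne //.
Qed.

Lemma code_set_nil : code_set [::] = finset.set0.
Proof. by apply/setP => p; rewrite !inE. Qed.

Definition vset : {set 'I_n} := [set av i | i : 'I_m].

Hypothesis m_gt0 : 0 < m.

Lemma code_divn x : x < m * m -> x %/ m < m /\ x - x %/ m * m < m.
Proof.
move=> xm; rewrite ltn_divLR // xm; split=> //.
by rewrite {1}(divn_eq x m) addKn ltn_pmod.
Qed.

Lemma code_set_shortcuts l : (forall x, x \in l -> x < m * m) -> code_set l \subset shortcuts vset.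
Proof.
move=> lm; apply/fintype.subsetP => p; rewrite inE => /hasP[x xl /andP[ne /eqP->]].
have [h1 h2] := code_divn (lm x xl).
rewrite inE cards2 ne andbT finset.subUset !finset.sub1set.
by apply/andP; split; apply/imsetP; [exists (Ordinal h1) | exists (Ordinal h2)].
Qed.

Lemma code_set_card l : #|code_set l| <= size l.
Proof.
elim/last_ind: l => [|l x IH]; first by rewrite code_set_nil cards0.
rewrite code_set_rcons size_rcons; case: ifP => _; last exact: leqW.
by rewrite cardsU1; apply: (leq_add (leq_b1 _)).
Qed.

Lemma code_set_perm l1 l2 : l1 =i l2 -> code_set l1 = code_set l2.
Proof. by move=> E; apply/setP => p; rewrite !inE; apply: eq_has_r. Qed.

(** A set with fewer than [k] pairs is padded with the code 0, which decodes to twice the same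
    vertex; sorting the codes does not change the set. *)
Lemma code_set_surj (S : {set {set 'I_n}}) k : S \subset shortcuts vset -> #|S| <= k ->
  exists t, [/\ nondec t k, forall i, i < k -> t i < m * m & code_set (mkseq t k) = S].
Proof.
move=> /fintype.subsetP SA Sk.
have pc (p : {set 'I_n}) : exists x, p \in S -> [/\ x < m * m, code1 x != code2 x & p = [set code1 x; code2 x]].
  have [pS|] := boolP (p \in S); last by exists 0.
  have := SA p pS; rewrite inE => /andP[/fintype.subsetP pA /cards2P[a [b [ab pE]]]].
  have /imsetP[i _ aE] : a \in vset by apply: pA; rewrite pE !inE eqxx.
  have /imsetP[j _ bE] : b \in vset by apply: pA; rewrite pE !inE eqxx orbT.
  have d1 : (i * m + j) %/ m = i by rewrite divnMDl // divn_small ?addn0.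
  exists (i * m + j) => _; rewrite /code1 /code2 d1 addKn -aE -bE; split=> //.
  apply: (@leq_trans (i.+1 * m)); last by rewrite leq_mul2r ltn_ord orbT.
  by rewrite mulSn addnC ltn_add2r.
have [f fP] := boolp.choice pc.
pose l := sort leq ([seq f p | p <- enum S] ++ nseq (k - #|S|) 0).
have sl : size l = k by rewrite size_sort size_cat size_map size_nseq -cardE subnKC.
exists (nth 0 l); split.
- move=> i ik; have := sort_sorted leq_total ([seq f p | p <- enum S] ++ nseq (k - #|S|) 0).
  by move=> /(sortedP 0); apply; rewrite -/l sl.
- move=> i ik; have : nth 0 l i \in l by rewrite mem_nth ?sl.
  rewrite mem_sort mem_cat => /orP[/mapP[p]|].
    by rewrite mem_enum => pS ->; case: (fP p pS).
  by rewrite mem_nseq => /andP[_ /eqP->]; rewrite muln_gt0 m_gt0.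
rewrite -sl mkseq_nth (code_set_perm (mem_sort leq _)).
have c0 : code1 0 = code2 0 by rewrite /code1 /code2 div0n.
apply/setP => p; rewrite inE has_cat; apply/orP/idP => [[/hasP[x /mapP[q]]|/hasP[x]]|pS].
- by rewrite mem_enum => qS -> /andP[_ /eqP->]; have [_ _ <-] := fP q qS.
- by rewrite mem_nseq => /andP[_ /eqP->]; rewrite c0 eqxx.
left; apply/hasP; exists (f p); first by rewrite map_f // mem_enum.
by have [_ -> <-] := fP p pS; rewrite eqxx.
Qed.

End Codes.

Notation TT := 15 (only parsing).
Notation L_ := 40 (only parsing).
Notation A_ := 41 (only parsing).
Notation B_ := 42 (only parsing).
Notation CV := 11 (only parsing).
Notation BEST := 12 (only parsing).
Notation TMP2 := 14 (only parsing).

Definition mat_entry (l i j : iexp) : rexp := RGet MAT ((l * scalar AC + i) * scalar AC + j)%P.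

Definition decode : cmd := (
  SetI A_ #0 (IDiv TT.[$L_] $AC) ;;
  SetI B_ #0 (TT.[$L_] - $A_ * $AC))%P.

Definition try_route (x y : iexp) : cmd := (
  SetR TMP2 #0 (RAdd (RAdd (mat_entry $L_ $U_ x) (RCost ORD.[AA.[$A_]] ORD.[AA.[$B_]])) (mat_entry $L_ y $V_)) ;;
  If (BLeR (RGet TMP2 #0) (RGet TMP #0)) (SetR TMP #0 (RGet TMP2 #0)) Skip)%P.

(* Layer [l] of [MAT] holds the distances after the first [l] shortcuts. *)
Definition levels : cmd := for_ L_ kE (
  decode ;;
  for_ U_ ($AC) (for_ V_ ($AC) (
    SetR TMP #0 (mat_entry $L_ $U_ $V_) ;;
    try_route $A_ $B_ ;;
    try_route $B_ $A_ ;;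
    SetR MAT ((($L_ + #1) * $AC + $U_) * $AC + $V_) (RGet TMP #0))))%P.

Definition max_level (l : iexp) : cmd := (
  SetR CV #0 RZero ;;
  for_ U_ ($AC) (for_ V_ ($AC) (
    If (BLeR (mat_entry l $U_ $V_) (RGet CV #0)) Skip (SetR CV #0 (mat_entry l $U_ $V_)))))%P.

Definition emit : cmd := (
  SetI 3 #0 #0 ;;
  for_ L_ kE (
    decode ;;
    If (BEqI ORD.[AA.[$A_]] ORD.[AA.[$B_]]) Skip (
      SetI 4 3.[#0] ORD.[AA.[$A_]] ;;
      SetI 5 3.[#0] ORD.[AA.[$B_]] ;;
      SetI 3 #0 (3.[#0] + #1))))%P.

Definition advance : cmd := (
  SetI J_ #0 #0 ;;
  While (BAnd (BNot (BLeI kE ($J_ + #1))) (BEqI TT.[$J_] TT.[$J_ + #1])) (SetI J_ #0 ($J_ + #1)) ;;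
  If (BLeI ($AC * $AC) (TT.[$J_] + #1)) (SetI RUN #0 #0)
    (SetI TT $J_ (TT.[$J_] + #1) ;; for_ I_ ($J_) (SetI TT $I_ #0)))%P.

(* [TT] runs through the nondecreasing [k]-tuples of codes [i * m + j] in
   colexicographic order; a code of two equal vertices adds no shortcut. *)
Definition enumerate : cmd := (
  SetI RUN #0 #1 ;;
  max_level #0 ;;
  SetR BEST #0 (RGet CV #0) ;;
  While (BEqI $RUN #1) (
    levels ;;
    max_level kE ;;
    If (BLeR (RGet BEST #0) (RGet CV #0)) Skip (SetR BEST #0 (RGet CV #0) ;; emit) ;;
    advance))%P.

Section RunEnum.
Context {R : realType} {W n : nat} {e : rel 'I_n} {c : 'I_n -> 'I_n -> R}.
Implicit Types (s : state R) (t : nat -> nat).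
Hypothesis hW : (n + 2) ^ 6 <= W.
Hypothesis n_gt0 : 0 < n.
Hypothesis inst : doat_instance e c.
Local Notation o := (cost_oracle c).
Local Notation runs := (runs (W := W) (o := o)).
Local Notation T := (tree_graph e c).
Context {A : nat -> nat} {av : nat -> 'I_n} {m k : nat}.
Hypothesis m_gt0 : 0 < m.
Hypothesis m_le : m <= n.
Hypothesis k_W : k < W.
Hypothesis k_gt0 : 0 < k.

Definition subset_of t j := code_set av m (mkseq t j).
Definition level t j i l := dist (add_shortcuts c T (subset_of t j)) (av i) (av l).

Definition ready s := [/\ iarr s AC 0 = m, iarr s 0 1 = k, iarr s AA = A &
  forall i, i < m -> iarr s ORD (A i) = av i].

Lemma subset_shortcuts t j : (forall i, i < j -> t i < m * m) -> subset_of t j \subset shortcuts (vset av m).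
Proof.
move=> tm; apply: code_set_shortcuts => // x /mapP[i].
by rewrite mem_iota => /andP[_ ij] ->; apply: tm.
Qed.

(** If a code decodes to twice the same vertex, the graph does not change; the oracle then returns 0
    and the minimum is left as it was by the triangle inequality. *)
Lemma level_step t j i l : (forall i, i <= j -> t i < m * m) -> i < m -> l < m ->
  let a := t j %/ m in let b := t j - t j %/ m * m in
  level t j.+1 i l = Num.min (level t j i l)
    (Num.min (level t j i a + o (av a) (av b) + level t j b l)%R
             (level t j i b + o (av a) (av b) + level t j a l)%R).
Proof.
move=> tm im lm a b.
have pS := shortcuts_proper (subset_shortcuts (t := t) (j := j) (fun i ij => tm i (ltnW ij))).
rewrite /level /subset_of mkseqS code_set_rcons /code1 /code2 -/a -/b cost_oracleE.
case: eqVneq => [ab|ab]; last by rewrite (TS_add inst) //.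
rewrite -ab addr0; have h := TS_triangle inst pS (av i) (av a) (av l).
by rewrite /subset_of /= minxx; apply/esym/min_idPl.
Qed.

Definition idx j i l := (j * m + i) * m + l.

Lemma idx_inj j i l j' i' l' : i < m -> l < m -> i' < m -> l' < m ->
  idx j i l = idx j' i' l' -> [/\ j = j', i = i' & l = l'].
Proof.
move=> im lm im' lm' E.
have l1 : l = l' by have := congr1 (modn^~ m) E; rewrite /idx !modnMDl !modn_small.
have ij : j * m + i = j' * m + i'.
  by have := congr1 (divn^~ m) E; rewrite /idx !divnMDl // !divn_small // !addn0.
have i1 : i = i' by have := congr1 (modn^~ m) ij; rewrite !modnMDl !modn_small.
have j1 : j = j' by have := congr1 (divn^~ m) ij; rewrite !divnMDl // !divn_small // !addn0.
by [].
Qed.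

Lemma mW : m < W. Proof. by apply: (small2 hW); nia. Qed.
Lemma mmW : m * m < W. Proof. by apply: (small2 hW); nia. Qed.

Lemma run_decode s t j : ready s -> iarr s TT j = t j -> iarr s L_ 0 = j -> t j < m * m ->
  runs decode s 2 (fun s' => iarr s' A_ 0 = t j %/ m /\ iarr s' B_ 0 = t j - t j %/ m * m).
Proof.
move=> [h1 h2 h3 h4] tE lE tm; have [d1 d2] := code_divn m_gt0 tm.
apply: runs_seq_seti; rewrite /= h1 lE tE; first exact: ltn_trans mW.
by apply: runs_seti; rewrite /update /= h1 lE tE //; exact: ltn_trans mW.
Qed.

Lemma run_try_route s x y j u v a b (D : nat -> nat -> R) : ready s ->
  iarr s L_ 0 = j -> iarr s U_ 0 = u -> iarr s V_ 0 = v -> u < m -> v < m ->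
  (forall i l, i < m -> l < m -> rarr s MAT (idx j i l) = D i l) ->
  iarr s A_ 0 < m -> iarr s B_ 0 < m ->
  ieval s x = a -> ieval s y = b -> a < m -> b < m ->
  runs (try_route x y) s 3 (fun s' => rarr s' TMP 0 =
    Num.min (rarr s TMP 0) (D u a + o (av (iarr s A_ 0)) (av (iarr s B_ 0)) + D b v)%R).
Proof.
move=> [h1 h2 h3 h4] lE uE vE um vm hD Am Bm xE yE am bm.
have min_if (p q : R) : (if (p <= q)%R then p else q) = Num.min q p.
  by rewrite minElt; case: ltgtP => // ->.
apply: runs_seq_setr; rewrite /= h1 h3 lE uE vE xE yE -!/(idx _ _ _) !hD // !h4 //.
apply: runs_if; rewrite /update /= => cmp.
  by apply: runs_setr; rewrite /update /= -min_if cmp.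
by apply: runs_skip; rewrite /= -min_if (negbTE cmp).
Qed.

Definition levels_ok t j s := forall j' i l, j' <= j -> i < m -> l < m ->
  rarr s MAT (idx j' i l) = level t j' i l.

Lemma run_levels s t : ready s -> (forall j, j < k -> iarr s TT j = t j /\ t j < m * m) ->
  levels_ok t 0 s ->
  runs levels s (k * (m * (m * 10 + 4) + 6) + 2) (fun s' => levels_ok t k s').
Proof.
move=> rd tE l0; have [h1 h2 h3 h4] := rd.
refine (runs_post (t := k * ((2 + (m * ((m * (8 + 2) + 2) + 2) + 2)) + 2) + 2) _ _
  (runs_for (I := levels_ok t) (N := k) _ _ _ _ _)) => //.
- by rewrite leq_add2r leq_mul2l; apply/orP; right; rewrite -addnA; lia.
- by move=> s' [sm _] /=; rewrite sm.
move=> j s' jk [sm1 sm2] vE lj.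
have rd1 : ready s' by rewrite /ready !sm1.
have [tj tm] := tE j jk; have tj' : iarr s' TT j = t j by rewrite sm1.
apply: runs_seq.
apply: runs_post (run_decode rd1 tj' vE tm) => // s1 [aE bE] [sm3 sm4].
have rd2 : ready s1 by rewrite /ready !sm3.
set a := t j %/ m in aE bE; set b := t j - a * m in bE.
have [am bm] : a < m /\ b < m by apply: code_divn.
pose I u s2 := forall j' i l, i < m -> l < m -> (j' <= j) || (j' == j.+1) && (i < u) ->
  rarr s2 MAT (idx j' i l) = level t j' i l.
refine (runs_post (leqnn _) _ (runs_for (I := I) (N := m) _ _ _ _ _)) => //.
- move=> s2 hI _ _ j' i l j'j im lm; apply: hI => //; rewrite im.
  by lia.
- exact: mW.
- by move=> s2 [sm5 _] /=; rewrite sm5 //; case: rd2.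
- by move=> j' i l im lm; rewrite ltn0 andbF orbF => j'j; rewrite /= sm4 // lj.
move=> u s2 um [sm5 sm6] uE Iu.
pose I' v s3 := forall j' i l, i < m -> l < m ->
  (j' <= j) || (j' == j.+1) && ((i < u) || (i == u) && (l < v)) ->
  rarr s3 MAT (idx j' i l) = level t j' i l.
refine (runs_post (leqnn _) _ (runs_for (I := I') (N := m) _ _ _ _ _)) => //.
- move=> s3 hI _ _ j' i l im lm h; apply: hI => //; rewrite lm.
  by lia.
- exact: mW.
- by move=> s3 [sm7 _] /=; rewrite sm7 //= sm5 //; case: rd2.
- by move=> j' i l im lm; rewrite ltn0 andbF orbF => h; apply: Iu.
move=> v s3 vm [sm7 sm8] vE3 Iv.
have rd3 : ready s3 by case: rd2 => *; split; rewrite ?sm7 // ?sm5.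
have [q1 q2 q3 q4] : [/\ iarr s3 L_ 0 = j, iarr s3 U_ 0 = u, iarr s3 A_ 0 = a & iarr s3 B_ 0 = b].
  by rewrite !sm7 // uE !sm5 // aE bE sm3.
have [r1 _ _ _] := rd3.
have hD i l : i < m -> l < m -> rarr s3 MAT (idx j i l) = level t j i l.
  by move=> im lm; apply: Iv => //; rewrite leqnn.
apply: runs_seq_setr; rewrite /= r1 q1 q2 vE3 -/(idx _ _ _) hD //.
set s4 := State _ _; apply: (runs_seq (t1 := 3) (t2 := 4)).
apply: runs_post (run_try_route (j := j) (u := u) (v := v) (a := a) (b := b) (D := level t j) _ _ _ _ _ _ _ _ _ _ _ _ _) => //; last first.
- by rewrite /= q4.
- by rewrite /= q3.
move=> s5 t5 [sm9 sm10]; apply: (runs_seq (t1 := 3) (t2 := 1)).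
have [p1 p2 p3 p4] : [/\ iarr s5 L_ 0 = j, iarr s5 U_ 0 = u, iarr s5 A_ 0 = a & iarr s5 B_ 0 = b].
  by rewrite !sm9.
have p5 : iarr s5 V_ 0 = v by rewrite sm9.
have rd5 : ready s5 by case: rd3 => *; split; rewrite ?sm9.
apply: runs_post (run_try_route (j := j) (u := u) (v := v) (a := b) (b := a) (D := level t j) _ _ _ _ _ _ _ _ _ _ _ _ _) => //; last first.
- by rewrite p4.
- by rewrite p3.
- by move=> i l im lm; rewrite sm10 // -hD.
move=> s6 t6 [sm11 sm12].
have [w1 w2 w3] : [/\ iarr s6 L_ 0 = j, iarr s6 U_ 0 = u & iarr s6 V_ 0 = v] by rewrite !sm11.
have w4 : iarr s6 AC 0 = m by rewrite sm11 //; case: rd5.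
have w5 : rarr s6 MAT = rarr s3 MAT by rewrite sm12 // sm10.
have w6 : rarr s6 TMP 0 = level t j.+1 u v.
  rewrite t6 t5 p3 p4 /= q3 q4 level_step //; last by move=> i ij; case: (tE i ltac:(lia)).
  by rewrite /update /= -/a -/b minA.
apply: runs_setr; rewrite /update /= w1 w2 w3 w4 addn1 -/(idx _ _ _) => _ j' i l im lm h /=.
case: eqP => [E|ne]; first by have [-> -> ->] := idx_inj im lm um vm E; rewrite w6.
rewrite w5; apply: Iv => //; case: (j' <= j) h => //= /andP[/eqP j'E h]; rewrite j'E eqxx /=.
case/orP: h => [->//|/andP[/eqP iE lv]]; rewrite iE eqxx ltnn /=.
by have [lE|] := eqVneq l v; [case: ne; rewrite j'E iE lE | lia].
Qed.

(** The maximum is described by its upper bounds: this passes easily through the nested loops and is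
    compared with a diameter by [eq_by_upper]. *)
Lemma run_max_level s lx l (D : nat -> nat -> R) : ready s -> (lx = IConst 0 \/ lx = kE) -> ieval s lx = l ->
  (forall i j, i < m -> j < m -> rarr s MAT (idx l i j) = D i j) ->
  runs (max_level lx) s (m * (m * 4 + 4) + 3) (fun s' => forall x : R,
    (rarr s' CV 0 <= x)%R <-> (0 <= x)%R /\ forall i j, i < m -> j < m -> (D i j <= x)%R).
Proof.
move=> rd lxE lE hD; have [h1 h2 h3 h4] := rd.
rewrite addn3; apply: runs_seq_setr; rewrite /=; set s1 := State _ _.
pose I u s' := forall x : R, (rarr s' CV 0 <= x)%R <->
  (0 <= x)%R /\ forall i j, i < u -> j < m -> (D i j <= x)%R.
refine (runs_post (t := m * ((m * (2 + 2) + 2) + 2) + 2) _ _ (runs_for (I := I) (N := m) _ _ _ _ _)) => //.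
- by rewrite addn2 !ltnS leq_mul2l; apply/orP; right; lia.
- exact: mW.
- by move=> s' [sm _] /=; rewrite sm.
- by move=> x; rewrite /= /update /=; split=> [h|[]].
move=> u s' um [sm1 sm2] uE Iu.
pose I' v s2 := forall x : R, (rarr s2 CV 0 <= x)%R <-> (0 <= x)%R /\
  forall i j, j < m -> (i < u) || (i == u) && (j < v) -> (D i j <= x)%R.
refine (runs_post (leqnn _) _ (runs_for (I := I') (N := m) _ _ _ _ _)) => //.
- move=> s2 hI _ _ x; rewrite /= hI; split=> -[x0 h]; split=> // i j.
    by move=> iu jm; apply: h => //; rewrite jm andbT orbC -leq_eqVlt.
  by rewrite andbC => jm; rewrite jm /= orbC -leq_eqVlt => iu; apply: h.
- exact: mW.
- by move=> s2 [sm3 _] /=; rewrite sm3 //= sm1.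
- move=> x; rewrite /= Iu; split=> -[x0 h]; split=> // i j.
    by move=> jm; rewrite ltn0 andbF orbF => iu; apply: h.
  by move=> iu jm; apply: h => //; rewrite iu.
move=> v s2 vm [sm3 sm4] vE Iv.
have [q1 q2] : iarr s2 AC 0 = m /\ iarr s2 U_ 0 = u by rewrite !sm3 //= sm1.
have q3 : ieval s2 lx = l.
  case: lxE lE => -> //= <-; have k1 : iarr s2 0 = iarr s 0 by rewrite sm3 //= sm1.
  by rewrite k1.
have q4 : rarr s2 MAT = rarr s MAT by rewrite sm4 // sm2.
have entry : reval o s2 (mat_entry lx (scalar U_) (scalar V_)) = D u v.
  by rewrite /= q1 q2 q3 q4 vE -/(idx _ _ _) hD.
have ext (x : R) : (D u v <= x)%R -> (forall i j, j < m -> (i < u) || (i == u) && (j < v) -> (D i j <= x)%R) ->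
    forall i j, j < m -> (i < u) || (i == u) && (j < v.+1) -> (D i j <= x)%R.
  move=> Dx h i j jm /orP[iu|/andP[/eqP-> jv]]; first by apply: h => //; rewrite iu.
  have [->//|jne] := eqVneq j v.
  by apply: h => //; rewrite eqxx ltnn /=; lia.
have sub (x : R) : (forall i j, j < m -> (i < u) || (i == u) && (j < v.+1) -> (D i j <= x)%R) ->
    forall i j, j < m -> (i < u) || (i == u) && (j < v) -> (D i j <= x)%R.
  move=> h i j jm /orP[iu|/andP[iu jv]]; apply: h => //; first by rewrite iu.
  by lia.
have uv (x : R) : (forall i j, j < m -> (i < u) || (i == u) && (j < v.+1) -> (D i j <= x)%R) -> (D u v <= x)%R.
  by move=> h; apply: h => //; rewrite eqxx ltnSn orbT.
apply: runs_if; cbn [beval]; rewrite entry => cmp.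
  apply: runs_skip => _ x; rewrite /= Iv; split=> -[x0 h]; split=> //; last exact: sub.
  by apply: ext => //; apply: le_trans cmp _; apply/Iv.
apply: runs_setr => _ x; rewrite /set_scalar; cbn [iarr rarr]; rewrite entry /update /=.
have cmp' : (rarr s2 CV 0 <= D u v)%R by rewrite ltW // ltNge.
split=> [Dx|[x0 h]]; last exact: uv.
have /Iv[x0 h] := le_trans cmp' Dx; split=> //; exact: ext.
Qed.

Lemma run_emit s t : ready s -> (forall j, j < k -> iarr s TT j = t j /\ t j < m * m) ->
  runs emit s (k * 8 + 3) (fun s' => output_shortcuts s' (subset_of t k)).
Proof.
move=> rd tE; have [h1 h2 h3 h4] := rd.
pose prs j := [seq (code1 av m x, code2 av m x) | x <- mkseq t j & code1 av m x != code2 av m x].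
pose I j s' := iarr s' 3 0 = size (prs j) /\ forall i, i < size (prs j) ->
  iarr s' 4 i = nth 0 [seq nat_of_ord p.1 | p <- prs j] i /\
  iarr s' 5 i = nth 0 [seq nat_of_ord p.2 | p <- prs j] i.
rewrite addn3; apply: runs_seq_seti => /=; first exact: leq_ltn_trans (leq0n _) mW.
refine (runs_post (t := k * (6 + 2) + 2) _ _ (runs_for (I := I) (N := k) _ _ _ _ _)) => //.
- by rewrite addn2.
- move=> s' [i1 i2] _; exists (prs k); split=> //.
  apply/setP => p; rewrite !inE; apply/hasP/mapP => [[x xt /andP[ne /eqP->]]|[q /mapP[x]]].
    by exists (code1 av m x, code2 av m x) => //; apply: map_f; rewrite mem_filter ne.
  by rewrite mem_filter => /andP[ne xt] -> ->; exists x => //; rewrite ne eqxx.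
- by move=> s' [sm _] /=; rewrite sm.
move=> j s' jk [sm1 sm2] vE [i1 i2].
have rd1 : ready s' by rewrite /ready !sm1.
have [tj tm] := tE j jk; have tj' : iarr s' TT j = t j by rewrite sm1.
apply: (runs_seq (t1 := 2) (t2 := 4)).
apply: runs_post (run_decode rd1 tj' vE tm) => // s1 [aE bE] [sm3 sm4].
have [g1 g2 g3 g4] : ready s1 by rewrite /ready !sm3.
have [am bm] := code_divn m_gt0 tm.
have [f1 f2 f3] : [/\ iarr s1 3 = iarr s' 3, iarr s1 4 = iarr s' 4 & iarr s1 5 = iarr s' 5] by rewrite !sm3.
have oa : iarr s1 ORD (iarr s1 AA (iarr s1 A_ 0)) = code1 av m (t j) by rewrite g3 aE g4.
have ob : iarr s1 ORD (iarr s1 AA (iarr s1 B_ 0)) = code2 av m (t j) by rewrite g3 bE g4.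
have szj : size (prs j) <= j.
  by rewrite size_map size_filter (leq_trans (count_size _ _)) ?size_mkseq.
have prsS : prs j.+1 = if code1 av m (t j) != code2 av m (t j) then rcons (prs j) (code1 av m (t j), code2 av m (t j)) else prs j.
  rewrite /prs mkseqS filter_rcons; case: ifP => // _; exact: map_rcons.
have oW (x : 'I_n) : x < W by apply: ltn_trans (ltn_ord x) _; apply: (small2 hW); nia.
apply: runs_if; rewrite /= oa ob (inj_eq val_inj) => ne.
  by apply: runs_skip => _; rewrite /I prsS ne /set_scalar /update /= f1 f2 f3.
apply: runs_seq_seti; rewrite /= ?oa //.
apply: runs_seq_seti; rewrite /update /= ?ob //.
apply: runs_seti; rewrite /update /= f1 i1 addn1; first by lia.
move=> _; rewrite /I prsS ne size_rcons /set_scalar /update /=; split=> // i ilt.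
rewrite !map_rcons !nth_rcons !(size_map _ (prs j)) f2 f3.
have [il|il|_] := ltngtP i (size (prs j)); first exact: i2; last by [].
by move: ilt; rewrite ltnS leqNgt il.
Qed.

Lemma run_advance s t : ready s -> nondec t k -> (forall j, j < k -> iarr s TT j = t j /\ t j < m * m) ->
  iarr s RUN 0 = 1 ->
  runs advance s (k * 5 + 6) (fun s' =>
    (iarr s' RUN 0 = 0 /\ forall j, j < k -> t j = (m * m).-1) \/
    (iarr s' RUN 0 = 1 /\ exists t', [/\ nondec t' k, rank t' k = (rank t k).+1 &
        forall j, j < k -> iarr s' TT j = t' j /\ t' j < m * m])).
Proof.
move=> rd st tE rE; have [h1 h2 h3 h4] := rd.
apply: (runs_time (t := ((k.-1 * 2 + 1) + ((k * (1 + 2) + 2).+2)).+1)); first by lia.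
have W0 : 0 < W by apply: leq_ltn_trans mW.
apply: runs_seq_seti => //=.
pose I l s' := iarr s' J_ 0 + l = k.-1 /\ forall i, i <= iarr s' J_ 0 -> t i = t (iarr s' J_ 0).
apply: runs_seq.
refine (runs_post (leqnn _) _ (runs_while (I := I) (N := k.-1) (tb := 1) _ _)); last first.
- move=> l s' [i1 i2] [sm _] /= /andP[b1 /eqP b2].
  set j := iarr s' J_ 0 in i1 i2 b1 b2.
  have kk : iarr s' 0 1 = k by rewrite sm.
  rewrite kk addn1 -ltnNge in b1.
  have ttE i : i < k -> iarr s' TT i = t i by move=> ik; rewrite sm //=; case: (tE i ik).
  rewrite addn1 !ttE // in b2; last exact: ltnW.
  apply: runs_seti; rewrite /= -/j addn1; first exact: ltn_trans b1 k_W.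
  exists l.-1; first by lia.
  rewrite /I /= /update /=; split; first by lia.
  by move=> i; rewrite leq_eqVlt => /predU1P[->//|]; rewrite ltnS => /i2->.
- by rewrite /I /= /update /=; split=> // i; rewrite leqn0 => /eqP->.
move=> s' [[l _ [i1 i2]] /= stop] [sm _].
set j := iarr s' J_ 0 in i1 i2 stop.
have jk : j < k by lia.
have kk : iarr s' 0 1 = k by rewrite sm.
have ttE i : i < k -> iarr s' TT i = t i by move=> ik; rewrite sm //=; case: (tE i ik).
have lt : j.+1 < k -> t j < t j.+1.
  move=> j1; move: stop; rewrite kk addn1 -ltnNge j1 /= !ttE // => ne.
  by rewrite ltn_neqAle ne st.
have acE : iarr s' AC 0 = m by rewrite sm.
apply: runs_if; rewrite /= acE -/j ttE // addn1 => cmp.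
  have tj : t j = (m * m).-1 by have [_] := tE j jk; lia.
  apply: runs_seti => //=; left; rewrite /update /=; split=> // i ik.
  have [ij|ji] := leqP i j; first by rewrite i2.
  have j1 : j.+1 < k by lia.
  have t1 := lt j1; have [_ t2] := tE j.+1 j1.
  by rewrite tj in t1; lia.
rewrite -ltnNge in cmp.
apply: runs_seq_seti; rewrite /= -/j ttE // addn1; first exact: ltn_trans cmp mmW.
pose I2 l s2 := forall i, i < k -> iarr s2 TT i = if i < l then 0 else if i == j then (t j).+1 else t i.
apply: (runs_time (t := j * (1 + 2) + 2)); first by rewrite leq_add2r leq_mul2r ltnW ?orbT.
refine (runs_post (leqnn _) _ (runs_for (I := I2) (N := j) _ _ _ _ _)) => //.
- move=> s2 hI [sm2 _]; right; split; first by rewrite sm2 // /update /= sm.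
  exists (succ_tuple t j); split; [exact: nondec_succ | exact: rank_succ |].
  move=> i ik; split; first by rewrite hI.
  rewrite /succ_tuple; case: (ltnP i j) => ij; first by rewrite muln_gt0 m_gt0.
  by case: eqP => // _; case: (tE i ik).
- exact: ltn_trans jk k_W.
- by move=> s2 [sm2 _] /=; rewrite sm2.
- move=> i ik /=; rewrite /update /= ; case: eqP => // ne.
  exact: ttE.
move=> l2 s2 lj [sm2 _] vE hI; apply: runs_seti => //=; rewrite vE => _ i ik.
rewrite /set_scalar /update /= ltnS leq_eqVlt; case: eqP => //= _; exact: hI.
Qed.

Lemma diam_char S x : (diam (vset av m) (add_shortcuts c T S) <= x)%R <->
  (0 <= x)%R /\ forall i j, i < m -> j < m -> (dist (add_shortcuts c T S) (av i) (av j) <= x)%R.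
Proof.
split=> [h|[x0 h]].
  split=> [|i j im jm]; first exact: le_trans (diam_ge0) h.
  by apply: le_trans h; apply: dist_le_diam; apply/imsetP; [exists (Ordinal im) | exists (Ordinal jm)].
by apply: diam_le => // u v /imsetP[i _ ->] /imsetP[j _ ->]; apply: h.
Qed.

Lemma eq_by_upper (a b : R) : (forall x, (a <= x)%R <-> (b <= x)%R) -> a = b.
Proof. by move=> h; apply/le_anti/andP; split; [apply/h | apply/(h a)]. Qed.

Local Notation val t := (diam (vset av m) (add_shortcuts c T (subset_of t k))).

(** The remaining iterations are counted by [N - rank t k], because [advance] raises the rank by
    exactly one; at every moment [BEST] is at most the value of each tuple of smaller rank. By
    [code_set_surj] the tuples reach all candidate sets. *)
Lemma run_enumerate s : ready s -> (forall j, iarr s TT j = 0) -> iarr s 3 0 = 0 ->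
  (forall i j, i < m -> j < m -> rarr s MAT (i * m + j) = dist T (av i) (av j)) ->
  runs enumerate s ('C(m * m + k, k) * (k * (m * (m * 10 + 4) + 20) + m * (m * 4 + 4) + 22) + m * (m * 4 + 4) + 6)
   (fun s' => exists S, [/\ output_shortcuts s' S, S \subset shortcuts (vset av m), #|S| <= k &
     forall S' : {set {set 'I_n}}, S' \subset shortcuts (vset av m) -> #|S'| <= k ->
      (diam (vset av m) (add_shortcuts c T S) <= diam (vset av m) (add_shortcuts c T S'))%R]).
Proof.
move=> rd t0 o0 M0; have [h1 h2 h3 h4] := rd.
have W1 : 1 < W by apply: (small2 hW); nia.
pose N := 'C(m * m + k, k).
pose base s' := forall i j, i < m -> j < m -> rarr s' MAT (i * m + j) = dist T (av i) (av j).
pose sorted t := nondec t k /\ forall j, j < k -> t j < m * m.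
pose I l s' := [/\ exists S, [/\ output_shortcuts s' S, S \subset shortcuts (vset av m), #|S| <= k & rarr s' BEST 0 = diam (vset av m) (add_shortcuts c T S)],
  base s' &
  (iarr s' RUN 0 = 1 /\ exists t, [/\ sorted t, forall j, j < k -> iarr s' TT j = t j, l + rank t k = N, 0 < l &
     forall u, sorted u -> rank u k < rank t k -> (rarr s' BEST 0 <= val u)%R]) \/
  (iarr s' RUN 0 = 0 /\ forall u, sorted u -> (rarr s' BEST 0 <= val u)%R)].
apply: (runs_time (t := (((m * (m * 4 + 4) + 3) + (N * ((k * (m * (m * 10 + 4) + 6) + 2) + ((m * (m * 4 + 4) + 3) + ((k * 8 + 3).+2 + (k * 5 + 6)))).+1 + 1).+1).+1))).
  rewrite -/N; set X := m * (m * 10 + 4); set Y := m * (m * 4 + 4).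
  suff : N * (k * (X + 6) + 2 + (Y + 3 + ((k * 8 + 3).+2 + (k * 5 + 6)))).+1 <= N * (k * (X + 20) + Y + 22) by lia.
  by rewrite leq_mul2l; apply/orP; right; lia.
apply: runs_seq_seti => //=; set s1 := State _ _.
have rd1 : ready s1 by [].
apply: runs_seq.
have e0 i j : i < m -> j < m -> rarr s1 MAT (idx 0 i j) = dist T (av i) (av j).
  by move=> im jm; rewrite /idx mul0n add0n; apply: M0.
apply: runs_post (run_max_level (l := 0) rd1 _ _ e0) => //; last by left.
move=> s2 cvE [sm1 sm2].
(* [BEST] starts with the value of the empty set, which is the set that an output of length 0
   encodes; so the recorded value and output agree from the start. *)
have c0E : rarr s2 CV 0 = diam (vset av m) (add_shortcuts c T finset.set0).
  apply: eq_by_upper => x; rewrite cvE diam_char.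
  by split=> -[x0 h]; split=> // i j im jm; have := h i j im jm; rewrite (TS0 (e := e)).
apply: runs_seq_setr; rewrite /= c0E; set s3 := State _ _.
have k0N : rank (fun=> 0) k = 0.
  by rewrite /rank big1 // => i _; rewrite add0n bin_small.
refine (runs_post (leqnn _) _ (runs_while (I := I) (N := N) _ _)); last first.
- move=> l s' [[S [out SA Sk bestE]] bs [[run [t [[st tm] tE0 lr l0 best]]]|[run _]]] [sm3 sm4] /= /eqP; last by rewrite run.
  move=> _; have rd' : ready s' by case: rd1 => *; split; rewrite ?sm3 //= ?sm1.
  have tE j : j < k -> iarr s' TT j = t j /\ t j < m * m by move=> jk; split; [apply: tE0 | apply: tm].
  apply: runs_seq.
  have lv0 : levels_ok t 0 s'.
    move=> j i l'; rewrite leqn0 => /eqP-> im l'm; rewrite /idx mul0n add0n bs //.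
    by rewrite /level /subset_of /mkseq /= code_set_nil (TS0 (e := e)).
  apply: runs_post (run_levels rd' tE lv0) => // s4 lvk [sm5 sm6].
  have rd4 : ready s4 by case: rd' => *; split; rewrite ?sm5.
  apply: runs_seq.
  apply: runs_post (run_max_level (l := k) rd4 _ _ (fun i j im jm => lvk k i j (leqnn _) im jm)) => //; [|by right|by case: rd4].
  move=> s5 cv5 [sm7 sm8].
  have rd5 : ready s5 by case: rd4 => *; split; rewrite ?sm7.
  have cE : rarr s5 CV 0 = val t.
    by apply: eq_by_upper => x; rewrite cv5 diam_char.
  have bE : rarr s5 BEST 0 = diam (vset av m) (add_shortcuts c T S) by rewrite sm8 // sm6.
  have tE5 j : j < k -> iarr s5 TT j = t j /\ t j < m * m by rewrite sm7 // sm5 //; apply: tE.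
  have bs5 : base s5.
    move=> i j im jm; rewrite sm8 //.
    have := lvk 0 i j (leq0n _) im jm; rewrite /idx mul0n add0n => ->.
    by rewrite /level /subset_of /mkseq /= code_set_nil (TS0 (e := e)).
  have out5 : output_shortcuts s5 S.
    by case: out => es [p1 p2 p3]; exists es; split; rewrite ?sm7 // ?sm5 //; move=> i ilt; rewrite !sm7 // !sm5 //; apply: p2.
  have run5 : iarr s5 RUN 0 = 1 by rewrite sm7 // sm5.
  pose Q s6 := exists S6, [/\ output_shortcuts s6 S6, S6 \subset shortcuts (vset av m), #|S6| <= k,
     rarr s6 BEST 0 = diam (vset av m) (add_shortcuts c T S6) &
     (rarr s6 BEST 0 <= rarr s' BEST 0)%R /\ (rarr s6 BEST 0 <= val t)%R].
  apply: runs_seq; apply: (@runs_post _ _ _ _ _ (k * 8 + 3).+2 (k * 8 + 3).+2 Q) => //; last first.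
    apply: runs_if; rewrite /= cE bE => cmp.
      by apply: runs_skip; exists S; rewrite bE bestE; split.
    apply: runs_seq_setr; rewrite /= cE; set s6 := State _ _.
    have rd6 : ready s6 by [].
    apply: runs_post (run_emit rd6 tE5) => // s7 out7 [_ sm9].
    have b7 : rarr s7 BEST 0 = val t by rewrite sm9.
    exists (subset_of t k); split=> //; first exact: subset_shortcuts.
      by apply: leq_trans (code_set_card _ _ _) _; rewrite size_mkseq.
    by rewrite b7 bestE; split=> //; rewrite ltW // ltNge.
  move=> s6 [S6 [out6 S6A S6k b6 [b6a b6b]]] [sm9 sm10].
  have rd6 : ready s6 by case: rd5 => *; split; rewrite ?sm9.
  have tE6 j : j < k -> iarr s6 TT j = t j /\ t j < m * m by rewrite sm9 //; apply: tE5.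
  have run6 : iarr s6 RUN 0 = 1 by rewrite sm9.
  apply: runs_post (run_advance rd6 st tE6 run6) => // s7 adv [sm11 sm12].
  have b7 : rarr s7 BEST = rarr s6 BEST by rewrite sm12.
  have bs7 : base s7 by move=> i j im jm; rewrite sm12 // sm10 // bs5.
  have out7 : output_shortcuts s7 S6.
    by case: out6 => es [p1 p2 p3]; exists es; split; rewrite ?sm11 //; move=> i ilt; rewrite !sm11 //; apply: p2.
  have upto u : sorted u -> rank u k <= rank t k -> (rarr s7 BEST 0 <= val u)%R.
    rewrite b7 => -[su um]; rewrite leq_eqVlt => /predU1P[E|lt]; last by apply: le_trans b6a (best u (conj su um) lt).
    have -> : subset_of u k = subset_of t k; last exact: b6b.
    rewrite /subset_of; congr code_set; apply/eq_in_map => i; rewrite mem_iota => /andP[_ ik].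
    exact: rank_inj su st E i ik.
  exists l.-1; first by lia.
  have outS : exists S, [/\ output_shortcuts s7 S, S \subset shortcuts (vset av m), #|S| <= k & rarr s7 BEST 0 = diam (vset av m) (add_shortcuts c T S)].
    by exists S6; rewrite b7.
  split=> //; case: adv => [[r0 tmax]|[r7 [t' [st' rk' tE']]]].
    right; split=> // u su; apply: upto => //; apply: rank_mono => j jk.
    by rewrite tmax // -ltnS prednK ?muln_gt0 ?m_gt0 //; case: su => _; apply.
  left; split=> //; exists t'; split.
  + by split=> // j /tE'[].
  + by move=> j /tE'[].
  + by rewrite rk'; lia.
  + have : rank t' k < N by apply: rank_bound => // j /tE'[].
    by rewrite rk'; lia.
  + by move=> u su; rewrite rk' ltnS; apply: upto.
- split.
  + exists finset.set0; split=> //=.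
    * exists [::]; split=> //=; rewrite sm1 //= /update /= o0.
    * exact: finset.sub0set.
    * by rewrite cards0.
  + by move=> i j im jm; rewrite /s3 /= /update /= sm2 // /s1 /= M0.
  left; split; first by rewrite /= sm1.
  exists (fun=> 0); split.
  + by split=> // j _; rewrite muln_gt0 m_gt0.
  + by move=> j _; rewrite /= sm1 //= /update /=.
  + by rewrite k0N addn0.
  + by rewrite bin_gt0 leq_addl.
  + by move=> u _; rewrite k0N.
move=> s' [[l _ [[S [out SA Sk bestE]] _ fin]] /= stop] _.
exists S; split=> // S' S'A S'k; rewrite -bestE.
case: fin => [[run _]|[_ best]]; first by rewrite run in stop.
have [t [st tm codeS]] := code_set_surj m_gt0 S'A S'k.
by rewrite -codeS; apply: best.
Qed.

End RunEnum.

(** * Assembling the program *)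

Lemma tree_order_ext n (e : rel 'I_n) vx ps pa pa' : (forall i, 0 < i < n -> pa' i = pa i) ->
  tree_order e vx ps pa -> tree_order e vx ps pa'.
Proof.
move=> E [h1 h2 h3 h4 h5 h6]; split=> //.
- by move=> i ib; rewrite E //; apply: h4.
- move=> i j ilt jlt /(h5 i j ilt jlt) /orP[]/andP[z0 h].
    by rewrite z0 E ?z0 // h.
  by apply/orP; right; rewrite z0 E ?z0.
move=> i ib [h|h]; first by apply: h6 => //; left.
have [iN|iN] := eqVneq i.+1 n; first by apply: h6 => //; left.
by apply: h6 => //; right; rewrite -E //; case/andP: ib; lia.
Qed.

Lemma is_depth_ext (R : realType) n (c : 'I_n -> 'I_n -> R) vx pa pa' dp :
  (forall i, 0 < i < n -> pa' i = pa i) -> is_depth c vx pa dp -> is_depth c vx pa' dp.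
Proof. by move=> E [h1 h2]; split=> // i ib; rewrite E //; apply: h2. Qed.

Lemma children_ext n pa pa' i : (forall i, 0 < i < n -> pa' i = pa i) ->
  children (n := n) (pa := pa') i = children (n := n) (pa := pa) i.
Proof.
move=> E; apply: eq_bigr => j _; case: (posnP j) => // j0.
by rewrite E // j0 ltn_ord.
Qed.

Definition prepare n0 : cmd := (init_edges ;; peel ;; parents ;; mark n0)%P.

Section Prepare.
Context {R : realType} {W n : nat} {e : rel 'I_n} {c : 'I_n -> 'I_n -> R}.
Context {es : seq ('I_n * 'I_n)}.
Implicit Types (s : state R).
Hypothesis hW : (n + 2) ^ 6 <= W.
Hypothesis inst : doat_instance e c.
Hypothesis hes : edge_list e es.
Local Notation runs := (runs (W := W) (o := cost_oracle c)).

Lemma vertices_gt0 : 0 < n.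
Proof. by have [[n0 _ _ _ _] _ _] := inst; rewrite card_ord in n0. Qed.

Lemma input_state_ok k : input_ok es (input_state R k es).
Proof.
split=> // p i ilt; rewrite /= !(nth_map p) //.
Qed.

Lemma run_prepare n0 k : runs (prepare n0) (input_state R k es) (n * 45 + 10) (fun s =>
  exists vx ps, let pa := iarr s PAR in
    [/\ tree_order e vx ps pa, pa 0 = 0, is_depth c vx pa (rarr s DEP),
      forall i, i < n -> iarr s ORD i = vx i & forall i, i < n -> rarr s MU i = rarr s DEP i] /\
    [/\ iarr s MC 0 = size [seq i <- iota 0 n | marked (e := e) (vx := vx) (pa := pa) n0 i],
        arr_list (iarr s MK) [seq i <- iota 0 n | marked (e := e) (vx := vx) (pa := pa) n0 i],
        iarr s AC 0 = size [seq i <- iota 0 n | chosen (e := e) (vx := vx) n0 i] &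
        arr_list (iarr s AA) [seq i <- iota 0 n | chosen (e := e) (vx := vx) n0 i]]).
Proof.
have n_gt0 := vertices_gt0; have [[_ e_sym e_irr e_conn _] _ _] := inst; have [ses _] := hes.
apply: (runs_time (t := (n * 6 + 2) + ((n * 24 + 4) + ((n * 7 + 2) + (n * 8 + 2))))); first by lia.
apply: runs_seq; apply: runs_post (run_init_edges hW n_gt0 ses (input_state_ok k) _) => //.
move=> s1 sd [sm1 sm2].
apply: runs_seq; apply: runs_post (run_peel hW n_gt0 e_sym e_irr e_conn hes _ sd _) => //; last first.
- by move=> i; split; rewrite sm1.
- by rewrite sm1.
move=> s2 [vx [ps [pa [to oE pE qE]]]] [sm3 sm4].
apply: runs_seq; apply: runs_post (run_parents (c := c) hW n_gt0 to e_irr _ oE pE qE _) => //; last first.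
- by move=> i; split; rewrite ?sm3 ?sm1 // sm4 // sm2.
- by rewrite sm3 // sm1.
move=> s3 [par0 parE chE dpE muE] [sm5 sm6].
have paE i : 0 < i < n -> iarr s3 PAR i = pa i by exact: parE.
have to' := tree_order_ext paE to.
have chE' i : i < n -> iarr s3 CH i = children (n := n) (pa := iarr s3 PAR) i.
  by move=> ilt; rewrite chE // (children_ext _ paE).
apply: runs_post (run_mark (c := c) hW n_gt0 to' e_sym n0 _ _ _ _ chE') => //; last first.
- by rewrite sm5 // sm3 // sm1.
- by rewrite sm5 // sm3 // sm1.
- by rewrite sm5 // sm3 // sm1.
move=> s4 [q1 q2 q3 q4] [sm7 sm8].
have p4 : iarr s4 PAR = iarr s3 PAR by rewrite sm7.
have d4 : rarr s4 DEP = rarr s3 DEP by rewrite sm8.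
exists vx, ps; rewrite p4 d4 /=; split; split=> //.
- exact: is_depth_ext paE dpE.
- by move=> i ilt; rewrite sm7 // sm5 // oE.
- by move=> i ilt; rewrite sm8 // muE.
Qed.

End Prepare.

Section Finish.
Context {R : realType} {W n : nat} {e : rel 'I_n} {c : 'I_n -> 'I_n -> R}.
Context {vx : nat -> 'I_n} {ps : 'I_n -> nat} {pa : nat -> nat} {dp : nat -> R}.
Implicit Types (s : state R).
Hypothesis hW : (n + 2) ^ 6 <= W.
Hypothesis n_gt0 : 0 < n.
Hypothesis inst : doat_instance e c.
Hypothesis to : tree_order e vx ps pa.
Hypothesis hdp : is_depth c vx pa dp.
Hypothesis pa0 : pa 0 = 0.
Local Notation runs := (runs (W := W) (o := cost_oracle c)).
Local Notation T := (tree_graph e c).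
Local Notation inner := (inner (e := e) (vx := vx) (pa := pa)).
Local Notation marks := (marks (e := e) (vx := vx) (pa := pa)).
Local Notation marked := (marked (e := e) (vx := vx) (pa := pa)).
Local Notation chosen := (chosen (e := e) (vx := vx)).

Lemma marks_marked n0 mk : arr_list mk [seq i <- iota 0 n | marked n0 i] ->
  marks mk (size [seq i <- iota 0 n | marked n0 i]).
Proof.
move=> mkE; have e_sym : symmetric e by have [[]] := inst.
apply: (marks_eq (mk := nth 0 [seq i <- iota 0 n | marked n0 i])); first by move=> j jl; rewrite mkE.
apply: marks_filter => //.
- by rewrite /marked /inner /= orbT.
- by rewrite /marked (not_inner_last to n_gt0) ?orbT // prednK.
by move=> i ilt; rewrite /marked negb_or negbK => /andP[].
Qed.

Lemma size_marked n0 : n0 <= n ->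
  size [seq i <- iota 0 n | marked n0 i] <= 1 + 3 * #|leaves e|.
Proof.
move=> nn; have e_sym : symmetric e by have [[]] := inst.
apply: leq_trans (card_not_inner to e_sym).
rewrite size_filter -sum1_count big_mkcond /= -{1}(subn0 n) big_mkord.
by apply: leq_sum => i _; rewrite /marked ltnNge nn /=; case: (inner i).
Qed.

Lemma size_chosen n0 : n0 <= n ->
  size [seq i <- iota 0 n | chosen n0 i] = #|branch_vertices e|.
Proof.
move=> nn; rewrite size_filter -sum1_count big_mkcond /= -{1}(subn0 n) big_mkord.
rewrite (card_positions to); apply: eq_bigr => i _.
by rewrite /chosen ltnNge nn /=; case: leqP.
Qed.

Lemma run_finish s mk M m A k : iarr s MK = mk -> marks mk M -> iarr s MC 0 = M ->
  M <= n -> m <= n -> 0 < m -> 0 < k -> k < W ->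
  iarr s PAR = pa -> rarr s DEP = dp -> iarr s AC 0 = m -> iarr s AA = A -> iarr s 0 1 = k ->
  (forall i, i < n -> iarr s ORD i = vx i) -> (forall j, iarr s TT j = 0) -> iarr s 3 0 = 0 ->
  (forall i, i < m -> exists2 j, j < M & mk j = A i) ->
  runs (matrix ;; enumerate)%P s (m * (M * 19 + m * 3 + 11) + 2 +
     ('C(m * m + k, k) * (k * (m * (m * 10 + 4) + 20) + m * (m * 4 + 4) + 22) + m * (m * 4 + 4) + 6))
   (fun s' => exists2 S, output_shortcuts s' S &
      optimal_shortcuts (vset (fun i => vx (A i)) m) T c k S).
Proof.
move=> sM mP sC Mn mn m0 k0 kW sP sD sA sAA sk sO sT s3 Amk.
have nW x : x <= n -> x < W by move=> xn; apply: (small2 hW); nia.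
apply: runs_seq.
apply: runs_post (run_matrix hW n_gt0 inst to hdp pa0 sM mP sC (nW _ Mn) (nW _ mn) sP sD sA sAA Amk) => //.
move=> s1 matE [sm1 sm2].
have rd : ready (A := A) (av := fun i => vx (A i)) (m := m) (k := k) s1.
  split; rewrite ?sm1 // => i im; apply: sO.
  by have [j jM <-] := Amk i im; apply: (mk_lt mP).
apply: runs_post (run_enumerate hW n_gt0 inst m0 mn kW k0 rd _ _ matE) => //.
- by move=> s2 [S [q1 q2 q3 q4]] _; exists S.
- by move=> j; rewrite sm1.
- by rewrite sm1.
Qed.

End Finish.

(** The case [k = 0] is answered at once: [eta] would be about [2 * sqrt n], and the bound for
    computing that many centers is of order [n * log n]. *)
Definition program n0 : cmd := (If (BEqI kE #0) Skip (
  prepare n0 ;;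
  If (BLeI #n0 nE) (compute_eta ;; gonz) Skip ;;
  matrix ;; enumerate))%P.

Definition finish_time M m k := m * (M * 19 + m * 3 + 11) + 2 +
  ('C(m * m + k, k) * (k * (m * (m * 10 + 4) + 20) + m * (m * 4 + 4) + 22) + m * (m * 4 + 4) + 6).

Definition large_time n l E L k := n * 45 + 12 + (E.+2 * ((2 * k + 2) * 3 + 8) +
  (E * ((1 + 3 * l + E) * (L * 4 + 32) + 17) + 3)) + finish_time (1 + 3 * l + E) E k.

Lemma finish_time_mono M M' m k : M <= M' -> finish_time M m k <= finish_time M' m k.
Proof. by move=> h; rewrite /finish_time !leq_add2r leq_mul2l !leq_add2r leq_mul2r h !orbT. Qed.

Section Program.
Context {R : realType} {W n : nat} {e : rel 'I_n} {c : 'I_n -> 'I_n -> R}.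
Context {es : seq ('I_n * 'I_n)} {k : nat}.
Implicit Types (s : state R).
Hypothesis hW : (n + 2) ^ 6 <= W.
Hypothesis inst : doat_instance e c.
Hypothesis hes : edge_list e es.
Hypothesis k_gt0 : 0 < k.
Hypothesis k_W : k < W.
Local Notation runs := (runs (W := W) (o := cost_oracle c)).
Local Notation T := (tree_graph e c).

Lemma run_program_small n0 : n < n0 ->
  runs (program n0) (input_state R k es) (n * 45 + 12 + finish_time n n k)
   (fun s => exists2 S, output_shortcuts s S & optimal_shortcuts [set: 'I_n] T c k S).
Proof.
move=> nn; have n_gt0 := vertices_gt0 inst.
apply: (runs_time (t := ((n * 45 + 10) + (1 + finish_time n n k)).+1)); first by lia.
apply: runs_if => /= h; first by move: k_gt0; rewrite (eqP h).
apply: runs_seq; apply: runs_post (run_prepare hW inst hes n0 k) => //.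
move=> s1 [vx [ps /= [[to pa0 hdp oE muE] [mcE mkE acE aaE]]]] [sm1 sm2].
have all_n (a : pred nat) : (forall i, a i) -> [seq i <- iota 0 n | a i] = iota 0 n.
  by move=> ha; apply/all_filterP/allP => i _.
have lm : [seq i <- iota 0 n | marked (e := e) (vx := vx) (pa := iarr s1 PAR) n0 i] = iota 0 n.
  by apply: all_n => i; rewrite /marked nn.
have la : [seq i <- iota 0 n | chosen (e := e) (vx := vx) n0 i] = iota 0 n.
  by apply: all_n => i; rewrite /chosen nn.
have mks := marks_marked n_gt0 inst to pa0 mkE.
rewrite lm size_iota in mcE mkE mks; rewrite la size_iota in acE aaE.
apply: runs_seq; apply: runs_if => h1; first by move: h1; rewrite /= sm1 //= leqNgt nn.
apply: runs_skip.
apply: runs_post (run_finish (A := iarr s1 AA) hW n_gt0 inst to hdp pa0 (erefl _) mks mcE (leqnn _) (leqnn _) n_gt0 k_gt0 k_W (erefl _) (erefl _) acE (erefl _) _ oE _ _ _) => //; last first.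
- by move=> i ilt; exists i; rewrite // mkE ?size_iota // aaE ?size_iota.
- by rewrite sm1.
- by move=> j; rewrite sm1.
- by rewrite sm1.
move=> s2 [S out opt] _; exists S => //.
suff <- : vset (fun i => vx (iarr s1 AA i)) n = [set: 'I_n] by [].
apply/setP => v; rewrite inE; apply/imsetP; exists (Ordinal (to_ps to v)) => //=.
by rewrite aaE ?size_iota ?(to_ps to) // nth_iota ?(to_ps to) // (to_vxK to).
Qed.

Lemma run_program_large n0 E L : n0 <= n -> n <= 2 ^ L -> Defs.eta R n k = E ->
  E ^ (2 * k + 2) <= n * 2 ^ (2 * k + 2) < E.+1 ^ (2 * k + 2) ->
  2 * k + 2 < W -> n * 2 ^ (2 * k + 2) < W -> E.+1 ^ (2 * k + 2) < W ->
  #|leaves e| < E -> 1 + 3 * #|leaves e| + E < n ->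
  runs (program n0) (input_state R k es) (large_time n #|leaves e| E L k)
   (fun s => exists2 S, output_shortcuts s S & S \subset shortcuts [set: 'I_n] /\ #|S| <= k /\ reduction_output e c k S).
Proof.
move=> nn nL etaE Eb qW tW EW lE lEn; have n_gt0 := vertices_gt0 inst.
have e_sym : symmetric e by have [[]] := inst.
apply: (runs_time (t := ((n * 45 + 10) + ((E.+2 * ((2 * k + 2) * 3 + 8) +
  (E * ((1 + 3 * #|leaves e| + E) * (L * 4 + 32) + 17) + 3)).+1 + finish_time (1 + 3 * #|leaves e| + E) E k)).+1)).
  by rewrite /large_time; lia.
have W1 : 1 < W by apply: (small2 hW); nia.
apply: runs_if => /= h; first by move: k_gt0; rewrite (eqP h).
apply: runs_seq; apply: runs_post (run_prepare hW inst hes n0 k) => //.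
move=> s1 [vx [ps /= [[to pa0 hdp oE muE] [mcE mkE acE aaE]]]] [sm1 sm2].
have mks := marks_marked n_gt0 inst to pa0 mkE.
have Mle := size_marked inst to nn; have bE := size_chosen to nn.
have bl := branch_le_leaves to e_sym.
set lm := [seq _ <- _ | marked _ _] in mcE mkE mks Mle.
set la := [seq _ <- _ | chosen _ _] in acE aaE bE.
rewrite bE in acE; set b := #|branch_vertices e| in bE acE bl.
have bltE : b < E by apply: leq_ltn_trans lE.
have bhE : b + (E - b) = E by rewrite subnKC // ltnW.
apply: runs_seq; apply: runs_if => h1; last by move: h1; rewrite /= sm1 //= nn.
apply: runs_seq; apply: runs_post (run_eta _ _ W1 qW tW Eb EW n_gt0) => //; [|by rewrite sm1|by rewrite sm1].
move=> s2 etE [sm3 sm4].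
have [p2 d2] : iarr s2 PAR = iarr s1 PAR /\ rarr s2 DEP = rarr s1 DEP by rewrite sm3 // sm4.
have [mc2 mk2 ac2 aa2] : [/\ iarr s2 MC = iarr s1 MC, iarr s2 MK = iarr s1 MK, iarr s2 AC = iarr s1 AC & iarr s2 AA = iarr s1 AA] by rewrite !sm3.
apply: runs_post (run_gonz (b := b) (h := E - b) (M0 := size lm) (mk0 := iarr s1 MK) (o := cost_oracle c) hW n_gt0 inst to hdp pa0 nL _ _ _ p2 d2 _ _ _ mk2 mks _) => //; first last.
- by move=> i ilt; rewrite sm4 // muE.
- by rewrite mc2.
- by rewrite ac2.
- by rewrite etE bhE.
- by rewrite subn_gt0.
- by apply: leq_ltn_trans lEn; lia.
- by rewrite bhE; apply: leq_ltn_trans lEn; lia.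
- move=> s3 [gi ac3 aa3] [sm5 sm6].
  have [cnt0 ac mc mks3 old rX cen cle gz] := gi.
  set M := size lm + (E - b).-1 in mc mks3 old rX cen cle.
  have ME : M <= 1 + 3 * #|leaves e| + E by rewrite /M; lia.
  have k3 : iarr s3 0 = iarr s1 0 by rewrite sm5 // sm3.
  (* The matrix is filled from labels at marks, so each chosen position has to be a mark: branch
     vertices are not [inner], and centers were inserted. *)
  have aaN i : i < E -> exists2 j, j < M & iarr s3 MK j = iarr s3 AA i.
    move=> iE; case: (ltnP i b) => ib; last first.
      have [|_ _ ] := cen (i - b); first by rewrite ltn_sub2r.
      by rewrite subnKC.
    rewrite aa3 // aa2 aaE ?bE //.
    have : nth 0 la i \in la by rewrite mem_nth // bE.
    rewrite mem_filter => /andP[ch it].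
    have : nth 0 la i \in lm.
      rewrite mem_filter it andbT /marked ltnNge nn /=; apply/negP => /and3P[_ _ /eqP d2'].
      by move: ch; rewrite /chosen ltnNge nn d2'.
    case/(nthP 0) => j jl jE; have [j' j'l j'E] := old j jl.
    by exists j' => //; rewrite j'E mkE.
  apply: (runs_time (finish_time_mono E k ME)).
  have E0 : 0 < E by apply: leq_ltn_trans bltE.
  apply: runs_post (run_finish (A := iarr s3 AA) hW n_gt0 inst to hdp pa0 (erefl _) mks3 mc _ _ E0 k_gt0 k_W _ _ _ (erefl _) _ _ _ _ aaN) => //.
  + move=> s4 [S out [SA Sk opt]] _.
    have AE : vset (fun i => vx (iarr s3 AA i)) E =
        branch_vertices e :|: [set centers (vx := vx) b s3 i | i : 'I_(E - b)].
      apply/setP => v; rewrite !inE; apply/imsetP/orP => [[i _ ->]|].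
        case: (ltnP i b) => ib; last first.
          right; apply/imsetP; have il : i - b < E - b by rewrite ltn_sub2r // ltn_ord.
          by exists (Ordinal il) => //; rewrite /centers /= subnKC.
        left; rewrite aa3 // aa2 aaE ?bE //.
        have : nth 0 la i \in la by rewrite mem_nth // bE.
        by rewrite mem_filter => /andP[]; rewrite /chosen ltnNge nn.
      case=> [dv|/imsetP[i _ ->]]; last first.
        have il : b + i < E by rewrite -ltn_subRL ltn_ord.
        by exists (Ordinal il).
      have : ps v \in la.
        by rewrite mem_filter /chosen (to_vxK to) dv orbT mem_iota (to_ps to).
      case/(nthP 0) => j jl jE; rewrite bE in jl.
      exists (Ordinal (ltn_trans jl bltE)) => //=.
      by rewrite aa3 // aa2 aaE ?bE // jE (to_vxK to).
    exists S => //; split; last split=> //.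
      apply/fintype.subsetP => p /(fintype.subsetP SA); rewrite !inE => /andP[_ ->].
      by rewrite finset.subsetT.
    split; rewrite etaE //; exists (centers (vx := vx) b s3) => //.
    rewrite AE in SA opt; split=> // S' S'A S'k.
    (* The program minimises the diameter of [A] in [T + S], which is the diameter of the reduced
       instance. *)
    by rewrite !(reduced_diam inst) //; apply: opt.
  + by lia.
  + by lia.
  + by rewrite sm5 // p2.
  + by rewrite sm6 // d2.
  + by rewrite ac3 bhE.
  + by rewrite k3 sm1.
  + by move=> i ilt; rewrite sm5 // sm3 // oE.
  + by move=> j; rewrite sm5 // sm3 // sm1.
  + by rewrite sm5 // sm3 // sm1.
rewrite leq_add2r; apply: leq_mul; first exact: leq_subr.
by rewrite leq_add2r leq_mul2r (leq_add Mle) ?orbT ?leq_subr.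
Qed.

End Program.

(** * Total time *)

(** From the factor [a] on, each factor of [k!] is at least [a]. *)
Lemma exp_le_fact a k : a ^ k <= a ^ a * k`!.
Proof.
elim: k => [|k IH]; first by rewrite muln1 expn_gt0; case: a.
rewrite factS; have [ka|ak] := ltnP k a.
  rewrite -[leqLHS]muln1 leq_mul ?muln_gt0 ?fact_gt0 //.
  by rewrite leq_pexp2l // (leq_ltn_trans _ ka).
by rewrite expnS mulnCA leq_mul // (leq_trans ak).
Qed.

Lemma ffact_le_exp n m : n ^_ m <= n ^ m.
Proof.
elim: m => // m IH; by rewrite ffactnSr expnSr leq_mul // leq_subr.
Qed.

Section Budget.
Variables (n k E M l : nat).
Hypothesis k_gt0 : 0 < k.
Hypothesis hM : forall i, 16 ^ i <= M * i`!.
Hypothesis E_pow : E ^ (2 * k + 2) <= n * 2 ^ (2 * k + 2).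
Hypothesis qE : 2 * k + 2 <= E.

Lemma bin_budget : 'C(E * E + k, k) * (k * (E * E)) <= 4 * M * n.
Proof.
have kE : k <= E * E by nia.
rewrite -(leq_pmul2r (fact_gt0 k)).
apply: (@leq_trans (4 * 16 ^ k * n)); last first.
  rewrite (_ : 4 * M * n * k`! = 4 * (M * k`!) * n); last by ring.
  by rewrite leq_mul2r leq_mul2l hM !orbT.
apply: (@leq_trans ((2 * (E * E)) ^ k * (k * (E * E)))).
  rewrite mulnAC leq_mul2r bin_ffact (leq_trans (ffact_le_exp _ _)) ?orbT //.
  by rewrite leq_exp2r //; lia.
have -> : (2 * (E * E)) ^ k * (k * (E * E)) = 2 ^ k * k * E ^ (2 * k + 2).
  by rewrite expnMn -[E * E]/(E ^ 2) -expnM expnD; ring.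
apply: (leq_trans (leq_mul (leqnn _) E_pow)).
have -> : 2 ^ (2 * k + 2) = 4 * (2 ^ k * 2 ^ k) by rewrite expnD mulnC mul2n -addnn expnD.
have -> : 16 ^ k = 2 ^ k * 2 ^ k * (2 ^ k * 2 ^ k) by rewrite -!expnMn.
have : k <= 2 ^ k by rewrite ltnW // ltn_expl.
move: (2 ^ k) => z kz.
rewrite (_ : z * k * (n * (4 * (z * z))) = 4 * (z * z * z) * n * k); last by ring.
rewrite (_ : 4 * (z * z * (z * z)) * n = 4 * (z * z * z) * n * z); last by ring.
by rewrite leq_mul2l kz orbT.
Qed.

(** Divide [E_pow] by the power of [E] with exponent [2k - 2], which is at least the same power of
    2; this uses [k >= 1]. *)
Lemma square_budget : (E * E) * (E * E) <= 16 * n.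
Proof.
have qq : 2 * k + 2 = 4 + (2 * k - 2) by lia.
move: E_pow; rewrite qq !expnD => h.
have h2 : 2 ^ (2 * k - 2) <= E ^ (2 * k - 2).
  by case: (2 * k - 2) => // j; rewrite leq_exp2r //; lia.
have z : 0 < E ^ (2 * k - 2) by rewrite expn_gt0; lia.
rewrite -(leq_pmul2r z) (_ : E * E * (E * E) = E ^ 4); last by rewrite !expnS expn0; ring.
by apply: (leq_trans h); rewrite mulnA [n * _]mulnC -[2 ^ 4]/16 leq_mul2l h2 orbT.
Qed.

(** Apart from the linear passes and the enumeration, every term is at most a constant times
    [E ^ 4]: there are [O(E)] marks, and the logarithm has been replaced by [q * E <= E * E]. *)
Lemma large_time_le : l < E -> 0 < n -> large_time n l E ((2 * k + 2) * E) k <= (5000 + 256 * M) * n.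
Proof.
move=> lE n0; have b1 := bin_budget; have b2 := square_budget.
rewrite /large_time /finish_time; move: qE; set q := 2 * k + 2 => qE'.
have E4 : 4 <= E by lia.
have N4 : 1 + 3 * l + E <= 4 * E by lia.
move: (1 + 3 * l + E) N4 => N N4.
move: ('C(_, _)) b1 => B b1.
have [X XE] : {X | X = E * E} by exists (E * E).
have EX : 4 * E <= X by rewrite XE leq_mul2r E4 orbT.
rewrite -XE in b1 b2.
have X1 : 16 <= X by lia.
have X2 : X <= X * X by rewrite leq_pmulr //; lia.
have t1 : E.+2 * (q * 3 + 8) <= 33 * X by rewrite XE; nia.
have qX : q * E <= X by rewrite XE leq_mul2r qE' orbT.
have t2 : E * (N * (q * E * 4 + 32) + 17) + 3 <= 16 * (X * X) + 148 * X.
  have : E * (N * (q * E * 4 + 32) + 17) <= E * (4 * E * (X * 4 + 32) + 17).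
    by rewrite leq_mul2l leq_add2r leq_mul ?orbT // leq_add2r leq_mul2r qX.
  have -> : E * (4 * E * (X * 4 + 32) + 17) = 16 * (X * X) + 128 * X + 17 * E.
    by rewrite XE; ring.
  by lia.
have t3 : E * (N * 19 + E * 3 + 11) + 2 <= 92 * X.
  have : E * (N * 19 + E * 3 + 11) <= E * (4 * E * 19 + E * 3 + 11).
    by rewrite leq_mul2l !leq_add2r leq_mul2r N4 !orbT.
  have -> : E * (4 * E * 19 + E * 3 + 11) = 79 * X + 11 * E by rewrite XE; ring.
  by lia.
have e10 : E * (E * 10 + 4) = 10 * X + 4 * E by rewrite XE; ring.
have e4 : E * (E * 4 + 4) = 4 * X + 4 * E by rewrite XE; ring.
have t4 : k * (E * (E * 10 + 4) + 20) + E * (E * 4 + 4) + 22 <= 64 * (k * X).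
  have : k * (E * (E * 10 + 4) + 20) <= k * (32 * X) by rewrite leq_mul2l e10; apply/orP; right; lia.
  have : X <= k * X by rewrite leq_pmull.
  by rewrite e4; lia.
have t5 : B * (k * (E * (E * 10 + 4) + 20) + E * (E * 4 + 4) + 22) <= 256 * (M * n).
  apply: (leq_trans (leq_mul (leqnn B) t4)); rewrite mulnCA; lia.
by rewrite e4; lia.
Qed.

(** So crude a bound on [log n] is enough, since [square_budget] leaves room for a factor
    [E * E]. *)
Lemma log_budget : n * 2 ^ (2 * k + 2) < E.+1 ^ (2 * k + 2) -> n <= 2 ^ ((2 * k + 2) * E).
Proof.
move=> h; apply: (@leq_trans (n * 2 ^ (2 * k + 2))); first by rewrite leq_pmulr // expn_gt0.
apply: (leq_trans (ltnW h)); rewrite [_ * E]mulnC expnM leq_exp2r ?addn2 //.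
exact: ltn_expl.
Qed.

End Budget.

Local Open Scope ring_scope.

(** For [k = 0] the program computes no centers, but its empty answer still has to be a possible
    output of the reduction. *)
Lemma gonzalez_exists (R : realType) (V : finType) (G : wgraph R V) (v0 : V) h :
  exists x, gonzalez G h x.
Proof.
elim: h => [|h [x gx]]; first by exists (fun=> v0) => md i; rewrite ltn0 andbF.
pose w := [arg max_(v > v0) mindist (G := G) (x := x) h v]%O.
pose x' i := if i == h then w else x i.
exists x' => md i /andP[i0]; rewrite ltnS => ih v.
have E u : md i u = mindist (G := G) (x := x) i u.
  by apply: mindist_ext => // j ji; rewrite /x' ltn_eqF // (leq_trans ji).
rewrite (E v) (E (x' i)) /x'; have [->|ne] := eqVneq i h.
  by rewrite /w; case: arg_maxP => // z _; apply.
by apply: gx; rewrite i0 ltn_neqAle ne.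
Qed.

Lemma optimal_shortcuts0 (R : realType) (V : finType) (A : {set V}) (G : wgraph R V) (c : V -> V -> R) :
  optimal_shortcuts A G c 0 finset.set0.
Proof.
split; [exact: finset.sub0set | by rewrite cards0 |].
by move=> S _; rewrite leqn0 cards_eq0 => /eqP->.
Qed.

Lemma optimal_le (R : realType) (V : finType) (A : {set V}) (G : wgraph R V) (c : V -> V -> R) k S S' (eps : R) :
  0 < eps -> optimal_shortcuts A G c k S -> optimal_shortcuts A G c k S' ->
  diam A (add_shortcuts c G S) <= (1 + eps) * diam A (add_shortcuts c G S').
Proof.
move=> eps0 [_ _ opt] [SA Sk _]; apply: le_trans (opt _ SA Sk) _.
by rewrite ler_peMl ?diam_ge0 // lerDl ltW.
Qed.

(** The largest number is met in the last trial for [eta]: it is at most [2 * E] to the power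
    [2k + 2], hence at most [n ^ 3]. *)
Lemma word_bounds n k E d : (6 <= d)%N -> (0 < n)%N -> (2 ^ (2 * k + 2) <= n)%N -> (0 < E)%N ->
  (E ^ (2 * k + 2) <= n * 2 ^ (2 * k + 2))%N ->
  [/\ k < (n + 2) ^ d, 2 * k + 2 < (n + 2) ^ d, n * 2 ^ (2 * k + 2) < (n + 2) ^ d
    & E.+1 ^ (2 * k + 2) < (n + 2) ^ d]%N.
Proof.
move=> d6 n0 qn E0 Epow.
have W x : (x <= n * n * n)%N -> (x < (n + 2) ^ d)%N.
  move=> h; apply: leq_ltn_trans h _; apply: (@leq_trans ((n + 2) ^ 3)%N).
    by rewrite !expnS expn0 muln1 mulnA; nia.
  by rewrite leq_exp2l ?addn2 // (leq_trans _ d6).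
have q1 : (2 * k + 2 <= n)%N by apply: leq_trans qn; rewrite ltnW // ltn_expl.
have nn : (n <= n * n)%N by rewrite leq_pmulr.
have nnn : (n * n <= n * n * n)%N by rewrite leq_pmulr.
split.
- by apply: W; lia.
- by apply: W; lia.
- by apply: W; apply: leq_trans nnn; rewrite leq_mul2l qn orbT.
apply: W; apply: (@leq_trans ((2 * E) ^ (2 * k + 2))%N).
  by rewrite leq_exp2r ?addn2 //; lia.
rewrite expnMn; apply: leq_trans (leq_mul qn Epow) _.
by rewrite -mulnA leq_mul2l leq_mul2l qn !orbT.
Qed.

Theorem theorem4 (R : realType) (eps : R) (heps : 0 < eps)
    (kbound : nat -> nat)
    (hk : (fun n => (kbound n)%:R : R) =o_eventually (fun n => Num.sqrt (ln n%:R) : R))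
    (C : R) :
  exists n0 : nat,
    (* every run of the reduction-based algorithm yields a (1+eps)-approximation *)
    (forall (n k : nat) (e : rel 'I_n) (c : 'I_n -> 'I_n -> R)
        (S' Sopt : {set {set 'I_n}}),
      (n0 <= n)%N -> (k <= kbound n)%N ->
      doat_instance e c -> metric c ->
      #|leaves e|%:R <= C * n%:R `^ (((2 * k + 2) ^ 2)%N%:R^-1) ->
      reduction_output e c k S' ->
      optimal_shortcuts [set: 'I_n] (tree_graph e c) c k Sopt ->
      diam [set: 'I_n] (add_shortcuts c (tree_graph e c) S')
        <= (1 + eps) * diam [set: 'I_n] (add_shortcuts c (tree_graph e c) Sopt))
    /\
    (* a single program carries it out in O(n) steps, with words of O(log n) bits *)
    exists (prog : cmd) (K d : nat),
    forall (n k : nat) (e : rel 'I_n) (c : 'I_n -> 'I_n -> R)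
        (es : seq ('I_n * 'I_n)),
      (k <= kbound n)%N ->
      doat_instance e c -> metric c ->
      #|leaves e|%:R <= C * n%:R `^ (((2 * k + 2) ^ 2)%N%:R^-1) ->
      edge_list e es ->
      exists (t : nat) (s : state R) (S' : {set {set 'I_n}}),
        [/\ exec ((n + 2) ^ d)%N (cost_oracle c) prog (input_state R k es) t s
              /\ (t <= K * n)%N,
            output_shortcuts s S',
            S' \subset shortcuts [set: 'I_n] /\ (#|S'| <= k)%N,
            if (n < n0)%N then
              optimal_shortcuts [set: 'I_n] (tree_graph e c) c k S'
            else reduction_output e c k S'
          & forall Sopt : {set {set 'I_n}},
              optimal_shortcuts [set: 'I_n] (tree_graph e c) c k Sopt ->
              diam [set: 'I_n] (add_shortcuts c (tree_graph e c) S')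
                <= (1 + eps)
                   * diam [set: 'I_n] (add_shortcuts c (tree_graph e c) Sopt)].
Proof.
have [n0 large] := eta_large C heps hk.
have approx (n k : nat) (e : rel 'I_n) (c : 'I_n -> 'I_n -> R) (S' Sopt : {set {set 'I_n}}) :
    (n0 <= n)%N -> (k <= kbound n)%N -> doat_instance e c -> metric c ->
    #|leaves e|%:R <= C * n%:R `^ (((2 * k + 2) ^ 2)%N%:R^-1) ->
    reduction_output e c k S' ->
    optimal_shortcuts [set: 'I_n] (tree_graph e c) c k Sopt ->
    diam [set: 'I_n] (add_shortcuts c (tree_graph e c) S')
      <= (1 + eps) * diam [set: 'I_n] (add_shortcuts c (tree_graph e c) Sopt).
  move=> nn kn inst mc hl; have n_gt0 := vertices_gt0 inst.
  have [te _ _] := inst; have [_ e_sym _ _ _] := te; have [es hes] := tree_edge_list te.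
  (* The tree order is extracted from a run of [prepare]; the threshold and the number of shortcuts
     given to it are irrelevant to the order. *)
  have [_ [s [_ _ [vx [ps [[to _ hdp _ _] _]]]]]] := run_prepare (leqnn _) inst hes 0%N k.
  have [_ _ _ _ h] := large n k _ nn kn n_gt0 hl.
  by apply: (approximation inst mc to hdp heps); apply: h; apply: branch_le_leaves to e_sym.
exists n0; split=> //.
have [M hM] : exists M, forall i, (16 ^ i <= M * i`!)%N by exists (16 ^ 16)%N; exact: exp_le_fact.
have [K0 hK0] : exists K0, forall n k E l, (0 < k)%N -> (E ^ (2 * k + 2) <= n * 2 ^ (2 * k + 2))%N ->
    (2 * k + 2 <= E)%N -> (l < E)%N -> (0 < n)%N -> (large_time n l E ((2 * k + 2) * E) k <= K0 * n)%N.
  by exists (5000 + 256 * M)%N => n k E l k0 h1 h2 h3 h4; exact: large_time_le.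
(* Below [n0] nothing relates [k] to [n], so the word length is adapted to the largest value of
   [kbound] there, and the running times of these finitely many cases are bounded by [Ks]. *)
pose kmax := (\max_(n < n0) kbound n)%N.
pose small n k := (n * 45 + 12 + finish_time n n k)%N.
pose Ks := (\max_(n < n0) \max_(k < kmax.+1) small n k)%N.
exists (program n0), (K0 + Ks).+1, (6 + kmax)%N => n k e c es kn inst mc hl hes.
have n_gt0 := vertices_gt0 inst.
suff [t [s [S' [[run tK] out Sk alt]]]] : exists (t : nat) (s : state R) (S' : {set {set 'I_n}}),
    [/\ exec ((n + 2) ^ (6 + kmax))%N (cost_oracle c) (program n0) (input_state R k es) t s
          /\ (t <= (K0 + Ks).+1 * n)%N,
        output_shortcuts s S', S' \subset shortcuts [set: 'I_n] /\ (#|S'| <= k)%N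
      & if (n < n0)%N then optimal_shortcuts [set: 'I_n] (tree_graph e c) c k S'
        else reduction_output e c k S'].
  exists t, s, S'; split=> // Sopt opt; case: ltnP alt => nn alt.
    exact: optimal_le heps alt opt.
  exact: approx alt opt.
have hW : ((n + 2) ^ 6 <= (n + 2) ^ (6 + kmax))%N by rewrite leq_exp2l ?addn2 // leq_addr.
have [k0|k0] := posnP k.
  subst k; exists 1%N, (input_state R 0 es), finset.set0; split.
  - split; last by rewrite muln_gt0 n_gt0.
    by apply: exec_If => /=; apply: exec_Skip.
  - by exists [::]; split=> //; apply/setP => p; rewrite !inE.
  - by split; [exact: finset.sub0set | rewrite cards0].
  case: ltnP => nn; first exact: optimal_shortcuts0.
  have [_ lE _ _ _] := large n 0%N _ nn kn n_gt0 hl.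
  have [x gx] := gonzalez_exists (tree_graph e c) (Ordinal n_gt0)
    (Defs.eta R n 0 - #|branch_vertices e|)%N.
  split; last by exists x => //; exact: optimal_shortcuts0.
  have [te _ _] := inst; have [_ e_sym _ _ _] := te.
  have [_ [s [_ _ [vx [ps [[to _ _ _ _] _]]]]]] := run_prepare (leqnn _) inst hes 0%N 0%N.
  exact: leq_ltn_trans (branch_le_leaves to e_sym) lE.
case: (ltnP n n0) => nn.
  have kk : (k <= kmax)%N by apply: leq_trans kn (@leq_bigmax _ (fun i : 'I_n0 => kbound i) (Ordinal nn)).
  have kW : (k < (n + 2) ^ (6 + kmax))%N.
    apply: leq_ltn_trans kk _; apply: (@leq_trans (2 ^ (6 + kmax))%N).
      by apply: leq_ltn_trans (leq_addl 6 kmax) _; apply: ltn_expl.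
    by rewrite leq_exp2r // addn2.
  have [t [s [run tl [S out opt]]]] := run_program_small hW inst hes k0 kW nn.
  exists t, s, S; split=> //; last by case: opt.
  split=> //; apply: leq_trans tl _; rewrite -/(small n k).
  have h1 : (small n k <= Ks)%N.
    apply: leq_trans (@leq_bigmax _ (fun i : 'I_n0 => \max_(k < kmax.+1) small i k)%N (Ordinal nn)).
    have kS : (k < kmax.+1)%N by [].
    exact: (@leq_bigmax _ (fun j : 'I_kmax.+1 => small n j) (Ordinal kS)).
  by apply: leq_trans h1 _; apply: leq_trans (leqW (leq_addl _ _)) (leq_pmulr _ n_gt0).
have [qE lE qn lEn _] := large n k _ nn kn n_gt0 hl.
have /andP[Ea Eb] := eta_pow (R := R) n k.
have E0 : (0 < Defs.eta R n k)%N by apply: leq_ltn_trans lE.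
have [w1 w2 w3 w4] := word_bounds (leq_addr kmax 6) n_gt0 qn E0 Ea.
have [t [s [run tl [S out [SA [Sk red]]]]]] :=
  run_program_large hW inst hes k0 w1 nn (log_budget Eb) (erefl _) (eta_pow (R := R) n k) w2 w3 w4 lE lEn.
exists t, s, S; split=> //; split=> //; apply: leq_trans tl _.
apply: leq_trans (hK0 _ _ _ _ k0 Ea qE lE n_gt0) _.
by rewrite leq_mul2r leqW ?orbT ?leq_addr.
Qed.
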